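(* Let $k\ge1$. Suppose that $\mathcal S_{k+1}$ is finite and that $X_0$ is a $k$-cycle (i.e. $\partial_kX_0=0$). Then the process $(X_t)_{t\ge0}$ on $\mathcal R(X_0)$ is non-explosive, recurrent, and admits a unique invariant measure $\pi$. Furthermore, $$\int_{\mathcal C_k}\|\sigma\|_{\mathcal C_k}^2\,d\pi(\sigma)<\infty.$$
   Context: Let $\mathbf C$ be a simplicial complex on a finite or countable ordered vertex set $V$. Oriented $k$-simplexes are written $[v_0,\dots,v_k]$ and change sign when two vertices are exchanged. $\mathcal S_k$ is the set of $k$-simplexes of $\mathbf C$, each of which may appear with positive or negative orientation, and $\mathcal S_k^+$ is the set of positively oriented ones, i.e. those $[v_0,\dots,v_k]$ with $v_0<\dots<v_k$. $\mathcal C_k$ is the real vector space of $k$-chains $\sigma=\sum_{\tau\in\mathcal S_k^+}\lambda_\tau(\sigma)\tau$ (finitely many nonzero coefficients), with the inner product for which $\mathcal S_k^+$ is an orthonormal basis, so $\|\sigma\|_{\mathcal C_k}^2=\sum_{\tau\in\mathcal S_k^+}|\lambda_\tau(\sigma)|^2$. $\mathcal C^k$ is its dual, identified with $\mathcal C_k$ through this inner product ($\eta^*$ denotes the cochain associated with a chain $\eta$), and $\langle f,\sigma\rangle_{\mathcal C^k,\mathcal C_k}=f(\sigma)$. The boundary map $\partial_k:\mathcal C_k\to\mathcal C_{k-1}$ is linear with $\partial_k[v_0,\dots,v_k]=\sum_{i=0}^k(-1)^i[v_0,\dots,v_{i-1},v_{i+1},\dots,v_k]$. Random walk: for a $k$-chain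 $\sigma$ and an oriented $(k+1)$-simplex $\tau\in\mathcal S_{k+1}$ (either orientation allowed) put $w(\sigma,\partial_{k+1}\tau)=\max(\langle(\partial_{k+1}\tau)^*,\sigma\rangle_{\mathcal C^k,\mathcal C_k},0)$. Write $\sigma\sim\sigma'$ if there is $\tau\in\mathcal S_{k+1}$ with $w(\sigma,\partial_{k+1}\tau)>0$ and $\sigma'=\sigma-\partial_{k+1}\tau$; then set $K(\sigma,\sigma')=w(\sigma,\sigma-\sigma')$. Set $K(0,0)=1$, and $K(\sigma,\sigma')=0$ in all other cases. $X=(X_t)_{t\ge0}$ is the continuous-time pure-jump Markov process on $\mathcal C_k$ with generator $\mathcal AF(\sigma)=\sum_{\sigma'\sim\sigma}(F(\sigma')-F(\sigma))K(\sigma,\sigma')$, defined for the functions $F:\mathcal C_k\to\mathbb R$ for which this sum is finite. For a $k$-chain $\sigma$, $\mathcal R(\sigma)$, called the recurrence class of $\sigma$, denotes the set of all $k$-chains that can be attained by $X$ starting from $\sigma$. *)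

(* Defs.v *)
From HB Require Import structures.
From mathcomp Require Import all_boot all_order all_algebra finmap.
From mathcomp Require Import all_classical all_reals all_analysis.
From mathcomp Require Import measurable_realfun.

Set Implicit Arguments.
Unset Strict Implicit.
Unset Printing Implicit Defensive.

Import Order.TTheory GRing.Theory Num.Theory.

Local Open Scope classical_set_scope.
Local Open Scope ring_scope.

Record complex disp (V : orderType disp) := Complex {
  face_of : set {fset V};
  complex_neq0 : forall s, face_of s -> s != fset0%fset;
  complex_sub : forall s t, face_of s -> (t `<=` s)%fset -> t != fset0%fset -> face_of t }.

(* A vertex set s stands for the positively oriented simplex [v_0, ..., v_k],
   where v_0 < ... < v_k are the elements of s. *)
Definition simplexes disp (V : orderType disp) (C : complex V) (k : nat) :
  set {fset V} := [set s | face_of C s /\ #|` s|%fset = k.+1].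

Section Chains.
Context (R : realType) disp (V : orderType disp) (C : complex V).
Implicit Type k : nat.

Definition finsupp_fun k : {pred simplexes C k -> R} :=
  fun f => `[< finite_set [set t | f t != 0] >].

Lemma finsupp_fun_submod k : submod_closed (@finsupp_fun k).
Proof.
split=> [|a f g /asboolP fin_f /asboolP fin_g]; apply/asboolP.
  by rewrite (_ : [set _ | _] = set0)// -subset0 => t /=; rewrite eqxx.
apply: (@sub_finite_set _ _
  ([set t | f t != 0] `|` [set t | g t != 0])); last by rewrite finite_setU.
move=> t /= afgt; have [ft0|] := eqVneq (f t) 0; last by left.
right; apply: contra_neq afgt => gt0.
by change (a * f t + g t = 0); rewrite ft0 gt0 mulr0 addr0.
Qed.

HB.instance Definition _ k :=
  GRing.isSubmodClosed.Build R (simplexes C k -> R) (@finsupp_fun k)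
    (finsupp_fun_submod k).

(* lambda_tau(sigma) is sigma tau. *)
Record chain k := Chain {
  coef :> simplexes C k -> R;
  coef_finsupp : coef \in @finsupp_fun k }.

HB.instance Definition _ k := [isSub for @coef k].
HB.instance Definition _ k := [Choice of chain k by <:].
HB.instance Definition _ k := [SubChoice_isSubLmodule of chain k by <:].
HB.instance Definition _ k := isPointed.Build (chain k) 0.

(* Chains carry the discrete sigma-algebra: the walk started from a given
   chain only visits countably many of them. *)
HB.instance Definition _ k := @isMeasurable.Build default_measure_display
  (chain k) discrete_measurable discrete_measurable0
  discrete_measurableC discrete_measurableU.

Lemma simplex_chain_subproof k (t : simplexes C k) :
  (fun u => (u == t)%:R) \in @finsupp_fun k.
Proof.
apply/asboolP; apply: (@sub_finite_set _ _ [set t]); last exact: finite_set1.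
by move=> u /=; case: (eqVneq u t) => //= _; rewrite eqxx.
Qed.

Definition simplex_chain k (t : simplexes C k) : chain k :=
  Chain (simplex_chain_subproof t).

Lemma facet_subproof k (t : simplexes C k.+1) (v : val t) :
  (val t `\ val v)%fset \in simplexes C k.
Proof.
have [Ct ct] : simplexes C k.+1 (val t) by apply: set_mem; exact: valP.
have cf : #|` (val t `\ val v)%fset| = k.+1.
  by apply/succn_inj; rewrite -ct (cardfsD1 (val v) (val t)) (valP v).
apply/mem_set; split=> //; apply: complex_sub Ct (fsubD1set _ _) _.
by rewrite -cardfs_gt0 cf.
Qed.

Definition facet k (t : simplexes C k.+1) (v : val t) : simplexes C k :=
  SigSub (facet_subproof v).

(* The position i of v = v_i in [v_0, ..., v_k]. *)
Definition vertex_rank (s : {fset V}) (v : s) : nat :=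
  index (val v) (sort <=%O (enum_fset s)).

(* Boundary maps are indexed by their target: this is \partial_(k+1). *)
Definition simplex_boundary k (t : simplexes C k.+1) : chain k :=
  \sum_(v : val t) (-1) ^+ vertex_rank v *: simplex_chain (facet v).

Definition boundary k (s : chain k.+1) : chain k :=
  \sum_(t \in [set: simplexes C k.+1]) s t *: simplex_boundary t.

Definition inner k (s s' : chain k) : R :=
  \sum_(t \in [set: simplexes C k]) s t * s' t.

Definition normsq k (s : chain k) : R := inner s s.

(* Simplexes with either orientation, the opposite of an oriented simplex
   being identified with its negative as a chain. *)
Definition oriented k : set (chain k) :=
  [set e | exists t, e = simplex_chain t \/ e = - simplex_chain t].

Definition weight k (s e : chain k) : R := Num.max (inner e s) 0.

Definition neighbour k (s s' : chain k) : Prop :=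
  exists2 t : chain k.+1, oriented t &
    0 < weight s (boundary t) /\ s' = s - boundary t.

Definition transition k (s s' : chain k) : R :=
  if `[< neighbour s s' >] then weight s (s - s')
  else if (s == 0) && (s' == 0) then 1 else 0.

Definition generator k (F : chain k -> R) (s : chain k) : R :=
  \sum_(s' \in [set s' | neighbour s s']) (F s' - F s) * transition s s'.

End Chains.

Section JumpProcess.
Context (R : realType) dE (E : measurableType dE).
Variable A : (E -> R) -> E -> R.

Definition rate (x y : E) : R := A \1_[set y] x.

Definition exit_rate (x : E) : R := - rate x x.

Definition jump_prob (x y : E) : R :=
  if exit_rate x == 0 then (x == y)%:R
  else if x == y then 0 else rate x y / exit_rate x.

(* A pure-jump Markov process with generator A on the countably many states it
   can visit, with the law of the process started from x for each x, described
   by its embedded chain and holding times: given the embedded chain, the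
   holding times are independent and exponential with parameters
   exit_rate (skel n).  A holding time at an absorbing state is +oo. *)
Record jump_process d (Omega : measurableType d) := JumpProcess {
  law : E -> probability Omega R;
  skel : nat -> Omega -> E;
  hold : nat -> Omega -> \bar R;
  measurable_skel : forall n, measurable_fun [set: Omega] (skel n);
  measurable_hold : forall n, measurable_fun [set: Omega] (hold n);
  hold_gt0 : forall n w, (0 < hold n w)%E;
  law_skel_hold : forall x n (y : nat -> E) (s : nat -> R),
    (forall i, 0 <= s i) ->
    law x ([set w | forall i, (i <= n)%N -> skel i w = y i] `&`
           [set w | forall i, (i < n)%N -> ((s i)%:E < hold i w)%E]) =
    ((y 0 == x)%:R *
     \prod_(i < n) (jump_prob (y i) (y i.+1) *
                    expR (- exit_rate (y i) * s i)))%:E }.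

Context d (Omega : measurableType d) (X : jump_process Omega).

Definition jump_time (n : nat) (w : Omega) : \bar R :=
  (\sum_(i < n) hold X i w)%E.

(* X_t, or None from the explosion time on. *)
Definition state (t : R) (w : Omega) : option E :=
  xget None [set Some (skel X n w) | n in
    [set n | (jump_time n w <= t%:E < jump_time n.+1 w)%E]].

Definition state_in (t : R) (B : set E) : set Omega :=
  [set w | exists2 y, B y & state t w = Some y].

Definition attainable (x : E) : set E :=
  [set y | (0 < law X x (\bigcup_(t in `[0%R, +oo[) state_in t [set y]))%E].

Definition non_explosive (D : set E) : Prop :=
  forall x, D x -> {ae law X x, forall w, jump_time ^~ w @ \oo --> +oo%E}.

Definition occupation_time (B : set E) (w : Omega) : \bar R :=
  lebesgue_measure [set t : R | 0 <= t /\ state_in t B w].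

(* Harris recurrence on D.  It agrees with recurrence of every state when D is
   irreducible, and allows D to contain transient states. *)
Definition recurrent (D : set E) : Prop :=
  exists phi : {sigma_finite_measure set E -> \bar R},
    (0 < phi D)%E /\
    forall B, measurable B -> B `<=` D -> (0 < phi B)%E ->
      forall x, D x -> {ae law X x, forall w, occupation_time B w = +oo%E}.

Definition invariant_probability (D : set E) (pi : probability E R) : Prop :=
  pi D = 1%E /\
  forall t, 0 <= t -> forall B, measurable B -> B `<=` D ->
    (\int[pi]_(x in D) law X x (state_in t B) = pi B)%E.

End JumpProcess.

(* Main.v *)
From HB Require Import structures.
Require Import Defs.
From mathcomp Require Import all_boot all_order all_algebra finmap.
From mathcomp Require Import all_classical all_reals all_analysis.
From mathcomp Require Import measurable_realfun.
From mathcomp Require Import ring lra zify.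

(* Along the walk, f = |.|^2 satisfies A f <= beta - eps * f: the drift of f at x
   is at most sum_e |e|^4 - sum_e max(<e, x>, 0)^2, and, the set of steps being
   symmetric, the last sum is half of sum_e <e, x>^2, which controls |x|^2 on
   X0 + span(steps) through the Gram matrix of the steps.  On this class the
   coefficients of a chain differ from those of X0 by integers, so that f has
   finite level sets.
   Two chains x and y of the class have a common successor: writing
   y - x = sum_i c_i v_i with integers c_i and steps v_i, the identity
   |y - x|^2 = sum_i c_i (<v_i, y> - <v_i, x>) shows that some v_i or - v_i moves y
   towards x or x towards y, and sum_i |c_i| decreases.  Hence some state z can be
   reached from every state of the class.
   A function that is subharmonic and bounded is then maximal at z, so the chance
   of avoiding all long stays at z vanishes: there are infinitely many of them, so
   the walk does not explode and is Harris recurrent for the Dirac mass at z.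
   The occupation measure of an excursion from z is subinvariant for the jump
   rates, and f is integrable for it by the drift inequality.  The forward
   equation makes it subinvariant for the semigroup, hence invariant since masses
   agree; uniqueness holds because P_1(x, z) > 0 for all x. *)

Set Implicit Arguments.
Unset Strict Implicit.
Unset Printing Implicit Defensive.

Import Order.TTheory GRing.Theory Num.Theory.
Import numFieldNormedType.Exports.

Local Open Scope classical_set_scope.
Local Open Scope ring_scope.

(** * Sums over countable sets *)

(** A step [e] is allowed at [x] only when [<e, x> > 0], and it can be undone at once only if
    [<e, x> < |e|^2]; so the class of [X0] need not be irreducible and may contain states that are
    never revisited. This is why every argument is anchored at one state [z]. Explosion is excluded
    by time spent rather than by a bound on the exit rates: each long stay at [z] takes more than
    one unit of time. The state [z] may be absorbing, as the zero chain is; then the invariant law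
    is the Dirac mass at [z], and this case has to be separated before anything is divided by
    [exit_rate]. [jump_process] prescribes only the probabilities of finite paths together with
    lower bounds on holding times. The Markov property for other past events, and from it the
    forward equation, are derived by uniqueness of measures. Excursions and trajectories are
    truncated at [n] jumps, where sums are finite and inequalities come by induction on [n];
    equality is recovered only at the end, from total masses. *)

Section Esum.
Context (R : realType).
Local Open Scope ereal_scope.

Lemma fin_adde_eq0 (a b : \bar R) : a \is a fin_num -> a = a + b -> b = 0.
Proof.
move: a b => [a| |] [b| |]// _ [] /eqP.
by rewrite -{1}[a]addr0 (inj_eq (addrI a)) => /eqP <-.
Qed.

Lemma countable_bij_nat (I : pointedType) (B : set I) : countable B ->
  exists (K : set nat) (g : nat -> I), set_bij K B g.
Proof.
move=> /countable_bijP[K]; rewrite card_eq_sym => /card_set_bijP[g bg].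
by exists K, g.
Qed.

Lemma measure_bigcup_esum d (T : measurableType d) (mu : {measure set T -> \bar R})
    (I : pointedType) (B : set I) (F : I -> set T) :
  countable B -> (forall i, measurable (F i)) -> trivIset B F ->
  mu (\bigcup_(i in B) F i) = \esum_(i in B) mu (F i).
Proof.
move=> /countable_bij_nat[K [g bg]] mF tF; have [gK gi gs] := bg.
rewrite (reindex_bigcup g K B)// measure_bigcup//; last first.
  move=> i j Ki Kj [t [Fi Fj]]; apply: gi; rewrite ?inE//.
  by apply: tF; [exact: gK|exact: gK|exists t].
rewrite (reindex_esum K B g)// nneseries_esum//.
by rewrite (_ : [set x | x \in K] = K)// set_mem_set.
Qed.

Lemma esum_ge_term (I : choiceType) (B : set I) (a : I -> \bar R) i :
  B i -> (forall j, B j -> 0 <= a j) -> a i <= \esum_(j in B) a j.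
Proof.
move=> Bi a0; apply: esum_ge; exists [set i]; last by rewrite fsbig_set1.
by split; [exact: finite_set1|move=> _ ->].
Qed.

Lemma esum_eq0 (I : choiceType) (B : set I) (a : I -> \bar R) :
  (forall j, B j -> 0 <= a j) -> \esum_(j in B) a j = 0 ->
  forall i, B i -> a i = 0.
Proof.
move=> a0 s0 i Bi; apply/eqP; rewrite eq_le a0// andbT -s0.
exact: esum_ge_term.
Qed.

(** The differences [b i - a i] are non-negative and sum to zero, because the totals agree and are
    finite. The passages from subinvariance to invariance rest on this. *)
Lemma esum_eq_of_le (I : choiceType) (B : set I) (a b : I -> \bar R) :
  (forall i, B i -> 0 <= a i <= b i) ->
  \esum_(i in B) a i = \esum_(i in B) b i -> \esum_(i in B) b i < +oo ->
  forall i, B i -> a i = b i.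
Proof.
move=> ab eab boo i Bi.
have a0 j : B j -> 0 <= a j by move=> /ab/andP[].
have lab j : B j -> a j <= b j by move=> /ab/andP[].
have b0 j : B j -> 0 <= b j by move=> Bj; exact: le_trans (a0 _ Bj) (lab _ Bj).
have bfin j : B j -> b j \is a fin_num.
  by move=> Bj; rewrite ge0_fin_numE ?b0//; apply: le_lt_trans boo; exact: esum_ge_term.
have afin j : B j -> a j \is a fin_num.
  by move=> Bj; rewrite ge0_fin_numE ?a0//; apply: le_lt_trans (lab _ Bj) _;
    rewrite ltey_eq bfin.
have h j : B j -> 0 <= b j - a j.
  by move=> Bj; rewrite suber_ge0 ?lab// afin.
have eb : \esum_(j in B) b j = \esum_(j in B) a j + \esum_(j in B) (b j - a j).
  rewrite -esumD//.

  by apply: eq_esum => j Bj; rewrite addeC subeK// afin.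
have sfin : \esum_(j in B) a j \is a fin_num.
  by rewrite eab ge0_fin_numE// esum_ge0.
have d0 : \esum_(j in B) (b j - a j) = 0.
  have := eb; rewrite -eab => /eqP; rewrite -[X in X == _]adde0.
  move=> /eqP /(congr1 (fun x => x - \esum_(j in B) a j)).
  by rewrite ![_ + _ - _]addeAC !subee// !add0e => ->.
have := esum_eq0 h d0 Bi => /eqP; rewrite sube_eq ?bfin ?fin_num_adde_defl ?afin//.
by rewrite add0e => /eqP ->.
Qed.

Lemma esumZl (I : pointedType) (B : set I) (c : R) (a : I -> \bar R) :
  countable B -> (0 <= c)%R -> (forall i, B i -> 0 <= a i) ->
  \esum_(i in B) (c%:E * a i) = c%:E * \esum_(i in B) a i.
Proof.
move=> /countable_bij_nat[K [g bg]] c0 a0; have [gK gi gs] := bg.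
rewrite !(reindex_esum K B g)//.
rewrite -(set_mem_set K) -!nneseries_esum.
- rewrite nneseriesZl// => n /set_mem Kn; exact/a0/gK.
- by move=> n /set_mem Kn; exact/a0/gK.
- by move=> n /set_mem Kn; rewrite mule_ge0 ?lee_fin//; exact/a0/gK.
Qed.

Lemma esum_exchange (I J : choiceType) (B : set I) (C : set J) (a : I -> J -> \bar R) :
  (forall i j, B i -> C j -> 0 <= a i j) ->
  \esum_(i in B) \esum_(j in C) a i j = \esum_(j in C) \esum_(i in B) a i j.
Proof.
move=> a0; rewrite !esum_esum//; last by move=> j i Cj Bi; exact: a0.
rewrite (reindex_esum (C `*`` (fun=> B)) _ (fun x => (x.2, x.1)))//; split=> //=.
- by move=> [j i] [].
- by move=> [i1 j1] [i2 j2] /= _ _ [-> ->].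
- by move=> [i j] [Bi Cj]; exists (j, i).
Qed.

End Esum.

(** * Measures and integrals on countable sets of atoms *)

Section DiscreteMeasure.
Context (R : realType) dE (E : measurableType dE).
Hypothesis mE : forall B : set E, measurable B.
Local Open Scope ereal_scope.
Variable mu : {measure set E -> \bar R}.

Lemma bigcup_set1_id (T : Type) (B : set T) : \bigcup_(x in B) [set x] = B.
Proof. by rewrite bigcup_imset1 image_id. Qed.

Lemma trivIset_set1 (B : set E) : trivIset B (fun x => [set x]).
Proof. by move=> i j _ _ [t [-> ->]]. Qed.

Lemma measure_discrete (B : set E) : countable B ->
  mu B = \esum_(x in B) mu [set x].
Proof.
move=> cB; rewrite -[in LHS](bigcup_set1_id B) measure_bigcup_esum//.
exact: trivIset_set1.
Qed.

Lemma integral_discrete (B : set E) (g : E -> \bar R) : countable B ->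
  (forall x, B x -> 0 <= g x) ->
  \int[mu]_(x in B) g x = \esum_(x in B) (g x * mu [set x]).
Proof.
move=> /countable_bij_nat[K [h bh]] g0; have [hK hi hs] := bh.
(* The empty set stands for indices outside [K], so that the partition of [B] is indexed by all
   integers. *)
pose F n : set E := if n \in K then [set h n] else set0.
have BF : B = \bigcup_n F n.
  apply/seteqP; split=> x.
    by move=> /hs[n Kn <-]; exists n => //; rewrite /F mem_set.
  by move=> [n _]; rewrite /F; case: ifPn => // /set_mem Kn ->; exact: hK.
rewrite [in LHS]BF ge0_integral_bigcup -?BF//; last first.
  move=> i j _ _ [t []]; rewrite /F; case: ifPn => // iK ->.
  by case: ifPn => // jK /hi; apply.
rewrite (reindex_esum K B h)//.
rewrite -[in RHS](set_mem_set K) -nneseries_esum; last first.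
  by move=> n /set_mem Kn; rewrite mule_ge0// g0//; exact: hK.
rewrite [in RHS]eseries_mkcond; apply: eq_eseriesr => n _.
rewrite /F; case: ifPn => nK; last by rewrite integral_set0.
rewrite (eq_integral (cst (g (h n)))); last by move=> y /[!inE] ->.
by rewrite integral_cst.
Qed.

End DiscreteMeasure.

(** * Embedded chain and holding times *)

(* [p] and [q] are the jump probabilities and rates on the closed set D, and
   [nxt x] lists the possible targets of a jump from x. *)
Record jump_chain (R : realType) (E : eqType) (p : E -> E -> R) (q : E -> R)
    (D : set E) (nxt : E -> seq E) : Prop := JumpChain {
  jc_countable : countable D;
  jc_uniq : forall x, uniq (nxt x);
  jc_next : forall x y, D x -> y \in nxt x -> D y;
  jc_ge0 : forall x y, D x -> 0 <= p x y;
  jc_out : forall x y, D x -> y \notin nxt x -> p x y = 0;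
  jc_sum : forall x, D x -> \sum_(y <- nxt x) p x y = 1;
  jc_rate : forall x, D x -> 0 <= q x }.

Section Law.
Context (R : realType) dE (E : measurableType dE) (A : (E -> R) -> E -> R)
  d (Omega : measurableType d) (X : jump_process A Omega).
Hypothesis mE : forall B : set E, measurable B.
Local Notation q := (exit_rate A).
Local Notation p := (jump_prob A).
Local Open Scope ereal_scope.

Definition skel_in n (B : set E) : set Omega := skel X n @^-1` B.
Definition hold_gt n (s : R) : set Omega := [set w | s%:E < hold X n w].
Definition path_lt n (y : nat -> E) : set Omega :=
  [set w | forall i, (i < n)%N -> skel X i w = y i].
Definition holds_gt n (s : nat -> R) : set Omega :=
  [set w | forall i, (i < n)%N -> (s i)%:E < hold X i w].

Lemma measurable_skel_in n B : measurable (skel_in n B).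
Proof. by rewrite -[skel_in _ _]setTI; exact: measurable_skel. Qed.

Lemma measurable_hold_gt n s : measurable (hold_gt n s).
Proof.
rewrite (_ : hold_gt n s = setT `&` hold X n @^-1` `]s%:E, +oo[%classic).
  by apply: measurable_hold => //; exact: emeasurable_itv.
rewrite setTI; apply/seteqP; split=> w /=; rewrite in_itv/= andbT//.
Qed.

Lemma path_ltS n y : path_lt n.+1 y = path_lt n y `&` skel_in n [set y n].
Proof.
apply/seteqP; split=> [w h|w [h hn] i].
  by split=> [i ilt|]; [exact: h (leqW ilt)|exact: h].
by rewrite /= ltnS leq_eqVlt => /predU1P[->//|]; exact: h.
Qed.

Lemma path_lt0 y : path_lt 0 y = setT.
Proof. by apply/seteqP; split=> // w _ i. Qed.

Lemma holds_gtS n s : holds_gt n.+1 s = holds_gt n s `&` hold_gt n (s n).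
Proof.
apply/seteqP; split=> [w h|w [h hn] i].
  by split=> [i ilt|]; [exact: h (leqW ilt)|exact: h].
by rewrite /= ltnS leq_eqVlt => /predU1P[->//|]; exact: h.
Qed.

Lemma holds_gt0 s : holds_gt 0 s = setT.
Proof. by apply/seteqP; split=> // w _ i. Qed.

Lemma measurable_path_lt n y : measurable (path_lt n y).
Proof.
elim: n => [|n ih]; first by rewrite path_lt0.
by rewrite path_ltS; apply: measurableI => //; exact: measurable_skel_in.
Qed.

Lemma measurable_holds_gt n s : measurable (holds_gt n s).
Proof.
elim: n => [|n ih]; first by rewrite holds_gt0.
by rewrite holds_gtS; apply: measurableI => //; exact: measurable_hold_gt.
Qed.

Hint Resolve measurable_skel_in measurable_hold_gt measurable_path_lt
  measurable_holds_gt : core.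

Lemma path_lt_ext n y y' : (forall i, (i < n)%N -> y i = y' i) ->
  path_lt n y = path_lt n y'.
Proof.
by move=> h; apply/seteqP; split=> w hw i ilt; rewrite hw ?h.
Qed.

Lemma hold_gt_le0 n s : (s <= 0)%R -> hold_gt n s = setT.
Proof.
move=> s0; apply/seteqP; split=> // w _ /=.
by apply: le_lt_trans (hold_gt0 X n w); rewrite lee_fin.
Qed.

Lemma law_path x n y s : (forall i, 0 <= s i)%R ->
  law X x (path_lt n.+1 y `&` holds_gt n s) =
  ((y 0 == x)%:R * \prod_(i < n) (p (y i) (y i.+1) *
     expR (- q (y i) * s i)))%:E.
Proof. by move=> s0; exact: (law_skel_hold X). Qed.

(** Thresholds are non-negative because [law_skel_hold] covers only these. Since holding times are
    positive, a zero threshold is no condition: this gives [setT], and lets a family for [n] be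
    padded to one for [n.+1]. *)
Definition hold_rays n : set (set Omega) :=
  [set holds_gt n s | s in [set s : nat -> R | forall i, (0 <= s i)%R]].

Lemma hold_raysI n : setI_closed (hold_rays n).
Proof.
move=> _ _ [s s0 <-] [t t0 <-]; exists (fun i => Num.max (s i) (t i)).
  by move=> i; rewrite le_max s0.
apply/seteqP; split=> [w h|w [h h'] i ilt].
  by split=> i ilt; apply: le_lt_trans (h i ilt); rewrite lee_fin le_max lexx ?orbT.
by rewrite EFin_max gt_max h// h'.
Qed.

Lemma hold_raysT n : hold_rays n setT.
Proof.
exists (fun=> 0%R) => //; apply/seteqP; split=> // w _ i _; exact: hold_gt0.
Qed.

Lemma hold_rays_measurable n : hold_rays n `<=` measurable.
Proof. by move=> _ [s _ <-]. Qed.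

Lemma hold_raysW n : hold_rays n `<=` hold_rays n.+1.
Proof.
move=> _ [s s0 <-]; exists (fun i => if (i < n)%N then s i else 0%R).
  by move=> i; case: ifP.
rewrite holds_gtS ltnn hold_gt_le0// setIT.
by apply/seteqP; split=> w h i ilt; have := h i ilt; rewrite ilt.
Qed.

(** Both sides are finite measures in [B]. They agree on the pi-system [hold_rays n] by the product
    formula, hence on the sigma-algebra that it generates. *)
Lemma law_path_step x n y s B : (0 <= s)%R -> (0 <= p (y n) (y n.+1))%R ->
  <<s hold_rays n >> B ->
  law X x (B `&` (path_lt n.+2 y `&` hold_gt n s)) =
  law X x (B `&` path_lt n.+1 y) *
    (p (y n) (y n.+1) * expR (- q (y n) * s))%:E.
Proof.
move=> s0 p0.
have c0 : (0 <= p (y n) (y n.+1) * expR (- q (y n) * s))%R.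
  by rewrite mulr_ge0// expR_ge0.
have m1 : measurable (path_lt n.+2 y `&` hold_gt n s) by exact: measurableI.
have m2 : measurable (path_lt n.+1 y) by [].
move=> hB; rewrite muleC.
apply: (@g_sigma_algebra_measure_unique _ R _ (hold_rays n)
    (@hold_rays_measurable n) (fun=> setT) _ _
    (mrestr (law X x) m1) (mscale (NngNum c0) (mrestr (law X x) m2))) => //.
- by move=> _; exact: hold_raysT.
- by rewrite bigcup_const//; exists 0%N.
- exact: hold_raysI.
- move=> _ [t t0 <-]; rewrite /= /mscale /= /mrestr.
  have -> : holds_gt n t `&` (path_lt n.+2 y `&` hold_gt n s) =
    path_lt n.+2 y `&` holds_gt n.+1 (fun i => if i == n then s else t i).
    rewrite setICA holds_gtS eqxx.
    congr (_ `&` (_ `&` _)); apply/seteqP; split=> w h i ilt; have := h i ilt;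
      by rewrite (ltn_eqF ilt).
  rewrite law_path; last by move=> i; case: ifP.
  rewrite [in RHS]setIC law_path// -EFinM big_ord_recr/= eqxx.
  congr (_%:E); rewrite [in RHS]mulrC -!mulrA; congr (_ * (_ * _))%R.
  by apply: eq_bigr => i _; rewrite (ltn_eqF (ltn_ord i)).
- by move=> _; rewrite /= /mrestr setTI (le_lt_trans (probability_le1 _ _)) ?ltry.
Qed.

(* Events decided by the embedded chain up to time n and the first n holding
   times: on each fixed path they are generated by the holding times. *)
Definition past n : set (set Omega) := [set B | measurable B /\
  forall y, exists2 B', <<s hold_rays n >> B' &
    B `&` path_lt n.+1 y = B' `&` path_lt n.+1 y].

Lemma past_measurable n B : past n B -> measurable B.
Proof. by case. Qed.

Lemma past_hold_rays n B : <<s hold_rays n >> B -> past n B.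
Proof.
move=> hB; split; last by move=> y; exists B.
have := smallest_sub (@sigma_algebra_measurable _ Omega) (@hold_rays_measurable n).
exact.
Qed.

Lemma pastT n : past n setT.
Proof. by apply: past_hold_rays; apply: sub_sigma_algebra; exact: hold_raysT. Qed.

Lemma pastC n B : past n B -> past n (~` B).
Proof.
move=> [mB hB]; split; first exact: measurableC.
move=> y; have [B' mB' e] := hB y; exists (~` B').
  by rewrite -setTD; apply: sigma_algebraCD.
apply/seteqP; split=> w [nB pw]; split=> // Bw; apply: nB.
  by have [] : (B `&` path_lt n.+1 y) w by rewrite e.
by have [] : (B' `&` path_lt n.+1 y) w by rewrite -e.
Qed.

Lemma past_bigcup n (F : nat -> set Omega) :
  (forall i, past n (F i)) -> past n (\bigcup_i F i).
Proof.
move=> hF; split; first by apply: bigcup_measurable => i _; case: (hF i).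
move=> y; have /choice[F' hF'] : forall i, exists B', <<s hold_rays n >> B' /\
    F i `&` path_lt n.+1 y = B' `&` path_lt n.+1 y.
  by move=> i; have [_ /(_ y)[B' ? ?]] := hF i; exists B'.
exists (\bigcup_i F' i).
  by apply: sigma_algebra_bigcup => i; have [] := hF' i.
by rewrite !setI_bigcupl; apply: eq_bigcupr => i _; have [] := hF' i.
Qed.

Lemma pastU n B C : past n B -> past n C -> past n (B `|` C).
Proof.
move=> hB hC; rewrite -bigcup2E; apply: past_bigcup => -[|[|i]]//=.
by rewrite -setCT; apply: pastC; exact: pastT.
Qed.

Lemma pastI n B C : past n B -> past n C -> past n (B `&` C).
Proof.
move=> hB hC; rewrite -[B `&` C]setCK setCI.
by apply: pastC; apply: pastU; exact: pastC.
Qed.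

Lemma pastW n B : past n B -> past n.+1 B.
Proof.
move=> [mB hB]; split=> // y; have [B' hB' e] := hB y; exists B'.
  exact: (sub_smallest2r (@smallest_sigma_algebra _ setT _) (@hold_raysW n)).
by rewrite (path_ltS n.+1) !setIA e.
Qed.

Lemma past_skel n i Y : (i <= n)%N -> past n (skel_in i Y).
Proof.
move=> ilen; split=> // y; have [Yy|nYy] := pselect (Y (y i)).
  exists setT; first by apply: sub_sigma_algebra; exact: hold_raysT.
  apply/seteqP; split=> w [_ pw]; split=> //; rewrite /skel_in/=.
  by rewrite (pw i).
exists set0; first exact: sigma_algebra0.
rewrite set0I -subset0 => w [+ pw]; rewrite /skel_in/= (pw i)//.
Qed.

Lemma past_hold n i s : (i < n)%N -> past n (hold_gt i s).
Proof.
move=> ilt; have [s0|s0] := leP s 0%R.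
  by rewrite hold_gt_le0//; exact: pastT.
apply: past_hold_rays; apply: sub_sigma_algebra.
exists (fun j => if j == i then s else 0%R).
  by move=> j; case: ifP => // _; exact: ltW.
apply/seteqP; split=> w h; first by have := h i ilt; rewrite eqxx.
by move=> j _; case: eqP => [->//|_]; exact: hold_gt0.
Qed.

Variables (D : set E) (nxt : E -> seq E).
Hypothesis jc : jump_chain p q D nxt.

Lemma measure_skel_seq (mu : {measure set Omega -> \bar R}) n M (s : seq E) :
  uniq s -> measurable M ->
  mu (M `&` skel_in n [set` s]) = \sum_(w <- s) mu (M `&` skel_in n [set w]).
Proof.
move=> us mM; elim: s us => [_|a s ih /= /andP[nas us]].
  by rewrite big_nil (_ : [set` [::]] = set0) ?preimage_set0 ?setI0//;
    apply/seteqP; split.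
rewrite big_cons -ih// -measureU//; last 3 first.
- exact: measurableI.
- exact: measurableI.
- rewrite -subset0 => w [[_ h1] [_ h2]]; move: h1 h2 nas; rewrite /skel_in/= => -> ->//.
congr (mu _); rewrite -setIUr; congr (_ `&` _).
apply/seteqP; split=> w; rewrite /skel_in/= inE.
  by move=> /predU1P[]; [left|right].
by move=> [->|->]; rewrite ?eqxx ?orbT.
Qed.

Lemma measure_skelID (mu : {measure set Omega -> \bar R}) n M (B : set E) :
  measurable M ->
  mu M = mu (M `&` skel_in n B) + mu (M `&` skel_in n (~` B)).
Proof.
move=> mM; rewrite -measureU//; last 3 first.
- exact: measurableI.
- exact: measurableI.
- by rewrite -subset0 => w [[_ h] [_]]; exact.
by rewrite -setIUr /skel_in -preimage_setU setUv preimage_setT setIT.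
Qed.

Lemma measure_skel_esum (mu : {measure set Omega -> \bar R}) n M :
  measurable M -> mu (skel_in n (~` D)) = 0 ->
  mu M = \esum_(e in D) mu (M `&` skel_in n [set e]).
Proof.
move=> mM n0; rewrite -measure_bigcup_esum; last 3 first.
- exact: jc_countable jc.
- by move=> i; exact: measurableI.
- by move=> i j _ _ [w [[_ /= <-] [_ /= <-]]].
have -> : \bigcup_(e in D) (M `&` skel_in n [set e]) = M `&` skel_in n D.
  apply/seteqP; split=> w; first by move=> [e De [Mw /= sw]]; split=> //;
    rewrite /skel_in/= sw.
  by move=> [Mw Dw]; exists (skel X n w).
rewrite (measure_skelID mu n D mM).
rewrite [X in _ + X](_ : _ = 0) ?adde0//.
by apply: subset_measure0 n0 => //; exact: measurableI.
Qed.

(** Summing over the last state of a path removes the condition on it, so agreement on paths of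
    length [n] descends to all shorter ones; [j] counts the states removed. *)
Lemma measure_eq_path n (m1 m2 : {measure set Omega -> \bar R}) :
  (forall i, (i < n)%N -> m1 (skel_in i (~` D)) = 0) ->
  (forall i, (i < n)%N -> m2 (skel_in i (~` D)) = 0) ->
  (forall y, (forall i, D (y i)) -> m1 (path_lt n y) = m2 (path_lt n y)) ->
  forall j, (j <= n)%N -> forall y, (forall i, D (y i)) ->
    m1 (path_lt (n - j) y) = m2 (path_lt (n - j) y).
Proof.
move=> h1 h2 h; elim=> [_ y Dy|j ih jn y Dy]; first by rewrite subn0; exact: h.
have lt : (n - j.+1 < n)%N by rewrite ltn_subrL (leq_trans _ jn).
have e : (n - j = (n - j.+1).+1)%N by rewrite subnSK.
rewrite (measure_skel_esum (n := (n - j.+1)%N))//; last exact: h1.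
rewrite [RHS](measure_skel_esum (n := (n - j.+1)%N))//; last exact: h2.
apply: eq_esum => v Dv; set m := (n - j.+1)%N in lt e *.
have := ih (ltnW jn) (fun i => if i == m then v else y i).
rewrite e path_ltS eqxx (@path_lt_ext m _ y)//.
  by apply=> i; case: ifP.
by move=> i im; rewrite (ltn_eqF im).
Qed.

End Law.

Section Law.
Context (R : realType) dE (E : measurableType dE) (A : (E -> R) -> E -> R)
  d (Omega : measurableType d) (X : jump_process A Omega).
Hypothesis mE : forall B : set E, measurable B.
Local Notation q := (exit_rate A).
Local Notation p := (jump_prob A).
Local Open Scope ereal_scope.
Local Notation skel_in := (skel_in X).
Local Notation hold_gt := (hold_gt X).
Local Notation past := (past X).
Local Notation path_lt := (path_lt X).
Hint Extern 0 (measurable (skel_in _ _)) => by apply: measurable_skel_in : core.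
Hint Extern 0 (measurable (hold_gt _ _)) => exact: measurable_hold_gt : core.
Hint Extern 0 (measurable (path_lt _ _)) => by apply: measurable_path_lt : core.

Variables (D : set E) (nxt : E -> seq E).
Hypothesis jc : jump_chain p q D nxt.

(** Applied to restrictions [mrestr] of the law to two events, this lifts to the whole space an
    identity known on each fixed path. *)
Lemma measureT_eq_path n (m1 m2 : {measure set Omega -> \bar R}) x : D x ->
  (forall i, (i < n)%N -> m1 (skel_in i (~` D)) = 0) ->
  (forall i, (i < n)%N -> m2 (skel_in i (~` D)) = 0) ->
  (forall y, (forall i, D (y i)) -> m1 (path_lt n y) = m2 (path_lt n y)) ->
  m1 setT = m2 setT.
Proof.
move=> Dx h1 h2 h.
have := measure_eq_path mE jc h1 h2 h (leqnn n) (fun=> Dx).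
by rewrite subnn path_lt0.
Qed.

Lemma law_path_next x n y w s B : D (y n) -> (0 <= s)%R ->
  <<s hold_rays X n >> B ->
  law X x (B `&` path_lt n.+1 y `&` skel_in n.+1 [set w] `&` hold_gt n s) =
  law X x (B `&` path_lt n.+1 y) * (p (y n) w * expR (- q (y n) * s))%:E.
Proof.
move=> Dy s0 hB; pose y' i := if i == n.+1 then w else y i.
have e : path_lt n.+1 y = path_lt n.+1 y'.
  by apply: path_lt_ext => i ilt; rewrite /y' (ltn_eqF ilt).
have yn : y' n = y n by rewrite /y' (ltn_eqF (ltnSn n)).
have ynS : y' n.+1 = w by rewrite /y' eqxx.
rewrite e -yn -{2}ynS -(law_path_step mE) ?yn ?ynS//; last exact: jc_ge0 jc _ _ Dy.
by rewrite (path_ltS _ n.+1) ynS !setIA.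
Qed.

Lemma sum_next c y e : D y -> (0 <= e)%R ->
  \sum_(w <- nxt y) c * (p y w * e)%:E = c * e%:E :> \bar R.
Proof.
move=> Dy e0; rewrite -ge0_sume_distrr; last first.
  by move=> w _; rewrite lee_fin mulr_ge0// (jc_ge0 jc).
by rewrite sumEFin -mulr_suml (jc_sum jc)// mul1r.
Qed.

(** The jump probabilities over [nxt (y n)] already sum to 1, so no mass is left for other
    targets. *)
Lemma law_path_out x n y : D (y n) ->
  law X x (path_lt n.+1 y `&` skel_in n.+1 (~` [set` nxt (y n)])) = 0.
Proof.
move=> Dy; have h : law X x (path_lt n.+1 y `&` skel_in n.+1 [set` nxt (y n)]) =
    law X x (path_lt n.+1 y).
  rewrite (measure_skel_seq X mE)//; last exact: jc_uniq jc _.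
  rewrite -[RHS]mule1 -(sum_next _ Dy ler01); apply: eq_bigr => w _.
  have := law_path_next x w Dy (lexx 0%R) (B := setT).
  rewrite hold_gt_le0// setIT !setTI mulr0 expR0; apply.
  by apply: sub_sigma_algebra; exact: hold_raysT.
have := h; rewrite [X in _ = X ->
  _](measure_skelID X mE (law X x) n.+1 [set` nxt (y n)])//.
by apply: fin_adde_eq0; rewrite fin_num_measure//; exact: measurableI.
Qed.

Lemma law_skel0 x : law X x (skel_in 0 [set x]) = 1.
Proof.
have := law_path X x 0 (fun=> x) (fun=> lexx 0%R).
rewrite holds_gt0 setIT big_ord0 eqxx mulr1 path_ltS path_lt0 setTI.
by [].
Qed.

Lemma law_out x n : D x -> law X x (skel_in n (~` D)) = 0.
Proof.
move=> Dx; elim/ltn_ind: n => -[_|n ih].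
  apply/eqP; rewrite eq_le measure_ge0 andbT.
  have <- : law X x (~` skel_in 0 [set x]) = 0.
    by rewrite probability_setC// law_skel0 subee.
  apply: le_measure; rewrite ?inE//; first exact: measurableC.
  by move=> w h e; apply: h; rewrite /= e.
have mS : measurable (skel_in n.+1 (~` D)) by [].
(* The restriction to the event of being outside [D] at time [n.+1] is compared with the restriction
   to the empty set, path by path. *)
suff : mrestr (law X x) mS setT = mrestr (law X x) measurable0 setT.
  by rewrite /= /mrestr !setTI measure0.
apply: (@measureT_eq_path n.+1 _ _ x) => //.
- move=> i ilt; rewrite /= /mrestr; apply: subset_measure0 (ih i ilt) => //.
  + exact: measurableI.
- by move=> i ilt; rewrite /= /mrestr setI0 measure0.
move=> y Dy; rewrite /= /mrestr setI0 measure0.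
apply: subset_measure0 (law_path_out x (Dy n)) => //.
- exact: measurableI.
- exact: measurableI.
apply: setIS => w h /= hn; apply: h; exact: (jc_next jc (Dy n) hn).
Qed.

(** The Markov property relative to [past]. Both sides are compared on each path of length [n.+1],
    where [B] may be replaced by an event on the holding times alone, and [law_path_next]
    applies. *)
Lemma law_step x n B y w s : D x -> past n B -> D y -> (0 <= s)%R ->
  law X x (B `&` skel_in n [set y] `&` skel_in n.+1 [set w] `&` hold_gt n s) =
  law X x (B `&` skel_in n [set y]) * (p y w * expR (- q y * s))%:E.
Proof.
move=> Dx pB Dy s0; have mB := past_measurable pB.
have c0 : (0 <= p y w * expR (- q y * s))%R.
  by rewrite mulr_ge0 ?expR_ge0// (jc_ge0 jc).
have m1 : measurable
    (B `&` skel_in n [set y] `&` skel_in n.+1 [set w] `&` hold_gt n s).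
  by do 3 (apply: measurableI => //).
have m2 : measurable (B `&` skel_in n [set y]) by exact: measurableI.
suff : mrestr (law X x) m1 setT = mscale (NngNum c0) (mrestr (law X x) m2) setT.
  by rewrite /= /mscale /= /mrestr !setTI muleC.
apply: (@measureT_eq_path n.+1 _ _ x) => //.
- move=> i ilt; rewrite /= /mrestr; apply: subset_measure0 (law_out i Dx) => //.
  exact: measurableI.
- move=> i ilt; rewrite /= /mscale /= /mrestr (_ : law X x _ = 0) ?mule0//.
  apply: subset_measure0 (law_out i Dx) => //.
  exact: measurableI.
move=> yy Dyy; rewrite /= /mscale /= /mrestr.
have [e|ne] := eqVneq (yy n) y; last first.
  have h0 : path_lt n.+1 yy `&` (B `&` skel_in n [set y]) = set0.
    rewrite -subset0 => v [h [_ /= e]]; move/eqP : ne; apply.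
    by rewrite -e h.
  by rewrite !setIA -(setIA (path_lt _ _)) h0 !set0I measure0 mule0.
have sub : path_lt n.+1 yy `<=` skel_in n [set y].
  by move=> v h; rewrite /skel_in/= h.
have [_ /(_ yy)[B' hB' eB]] := pB.
have -> : path_lt n.+1 yy `&` (B `&` skel_in n [set y]) =
    B' `&` path_lt n.+1 yy.
  by rewrite -eB setICA (setIidl sub).
rewrite -!setIA (setIA (path_lt _ _)) (setIC (path_lt _ _)) -!setIA.
rewrite (setIA (path_lt n.+1 yy)) (setIidl sub) !setIA eB.
by rewrite law_path_next ?e// muleC.
Qed.

Lemma law_next x n B y w : D x -> past n B -> D y ->
  law X x (B `&` skel_in n [set y] `&` skel_in n.+1 [set w]) =
  law X x (B `&` skel_in n [set y]) * (p y w)%:E.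
Proof.
move=> Dx pB Dy; have := law_step w Dx pB Dy (lexx 0%R).
by rewrite hold_gt_le0// setIT mulr0 expR0 mulr1.
Qed.

Lemma law_next_out x n B y : D x -> past n B -> D y ->
  law X x (B `&` skel_in n [set y] `&` skel_in n.+1 (~` [set` nxt y])) = 0.
Proof.
move=> Dx pB Dy; set M := B `&` skel_in n [set y].
have mM : measurable M by apply: measurableI => //; exact: past_measurable pB.
have h : law X x (M `&` skel_in n.+1 [set` nxt y]) = law X x M.
  rewrite (measure_skel_seq X mE)//; last exact: jc_uniq jc _.
  rewrite -[RHS]mule1 -(sum_next _ Dy ler01); apply: eq_bigr => w _.
  by rewrite mulr1; exact: law_next.
have := h; rewrite [X in _ = X -> _](measure_skelID X mE (law X x) n.+1 [set` nxt y])//.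
by apply: fin_adde_eq0; rewrite fin_num_measure//; exact: measurableI.
Qed.

Lemma law_sum_next x n B y M : D x -> past n B -> D y -> measurable M ->
  law X x (B `&` skel_in n [set y] `&` M) =
  \sum_(w <- nxt y) law X x (B `&` skel_in n [set y] `&` skel_in n.+1 [set w] `&` M).
Proof.
move=> Dx pB Dy mM; set N := B `&` skel_in n [set y].
have mN : measurable N by apply: measurableI => //; exact: past_measurable pB.
under eq_bigr do rewrite setIAC.
rewrite -(measure_skel_seq X mE) ?(jc_uniq jc)//; last exact: measurableI.
rewrite [LHS](measure_skelID X mE (law X x) n.+1 [set` nxt y]); last exact: measurableI.
rewrite [X in _ + X](_ : _ = 0) ?adde0//.
apply: subset_measure0 (law_next_out Dx pB Dy) => //.
- by do 2 (apply: measurableI => //); exact: measurable_skel_in mE _ _.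
- by apply: measurableI.
- by apply: setSI; exact: subIsetl.
Qed.

Lemma law_hold x n B y s : D x -> past n B -> D y -> (0 <= s)%R ->
  law X x (B `&` skel_in n [set y] `&` hold_gt n s) =
  law X x (B `&` skel_in n [set y]) * (expR (- q y * s))%:E.
Proof.
move=> Dx pB Dy s0; rewrite law_sum_next//.
under eq_bigr do rewrite law_step//.
by rewrite sum_next// expR_ge0.
Qed.

End Law.

(** * Image measures, laws of independent pairs, laws given by rays *)

Section FiniteImage.
Context d1 d2 (T1 : measurableType d1) (T2 : measurableType d2) (R : realType).
Variables (m : {finite_measure set T1 -> \bar R}) (f : T1 -> T2).
Hypothesis mf : measurable_fun setT f.

(** The measurability proof is an argument so that the structures of measure and of finite measure
    can be attached to this name. *)
Definition image_measure of measurable_fun setT f := pushforward m f.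
Local Notation im := (image_measure mf).

Let im0 : im set0 = 0%E. Proof. exact: (@measure0 _ _ _ (pushforward m f)). Qed.

Let im_ge0 B : (0 <= im B)%E. Proof. exact: (@measure_ge0 _ _ _ (pushforward m f)). Qed.

Let im_sigma_additive : semi_sigma_additive im.
Proof. exact: (@measure_semi_sigma_additive _ _ _ (pushforward m f)). Qed.

HB.instance Definition _ := isMeasure.Build _ _ _ im
  im0 im_ge0 im_sigma_additive.

Let im_fin : fin_num_fun im.
Proof.
move=> B mB; rewrite /image_measure /pushforward fin_num_measure//.
by rewrite -[X in measurable X]setTI; exact: mf.
Qed.

HB.instance Definition _ := @Measure_isFinite.Build _ _ _ im im_fin.

End FiniteImage.

Section Independent.
Context d (Omega : measurableType d) d1 (T1 : measurableType d1)
  d2 (T2 : measurableType d2) (R : realType).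
Local Open Scope ereal_scope.

(** The hypothesis identifies the law of the pair on rectangles with a product measure, which is
    determined by them; the right-hand side computes it by sections. Two measures occur because the
    law will be restricted to different events on the two sides. *)
Lemma joint_law (m m' : {finite_measure set Omega -> \bar R})
    (nu : {finite_measure set T2 -> \bar R}) (U : Omega -> T1) (V : Omega -> T2)
    (mU : measurable_fun setT U) (mV : measurable_fun setT V) :
  (forall B1 B2, measurable B1 -> measurable B2 ->
    m' (U @^-1` B1 `&` V @^-1` B2) = m (U @^-1` B1) * nu B2) ->
  forall C, measurable C ->
    m' [set w | C (U w, V w)] = \int[m]_w nu (xsection C (U w)).
Proof.
move=> h C mC; have mUV : measurable_fun setT (fun w => (U w, V w)).
  exact: measurable_fun_pair.
have := @product_measure_unique _ _ T1 T2 R (image_measure m mU) nu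
  (image_measure m' mUV) _ C mC.
rewrite /= /image_measure /pushforward /= => <-; last first.
  by move=> B1 B2 mB1 mB2; rewrite -h.
rewrite /product_measure1 /= ge0_integral_pushforward//.
exact: measurable_fun_xsection.
Qed.

End Independent.

Section RayLaw.
Context d (Omega : measurableType d) (R : realType).
Local Open Scope ereal_scope.

Lemma eq_law_rays (m m' : {finite_measure set Omega -> \bar R})
    (U V : Omega -> \bar R) :
  measurable_fun setT U -> measurable_fun setT V ->
  m setT = m' setT ->
  (forall r : R, m [set w | r%:E < U w] = m' [set w | r%:E < V w]) ->
  forall B, measurable B -> m (U @^-1` B) = m' (V @^-1` B).
Proof.
move=> mU mV eT h B mB.
(* The rays miss [-oo] and do not cover; [setT] is added to have a covering sequence inside the
   generating family. *)
pose G : set (set \bar R) := [set setT] `|` @ErealGenOInfty.G R.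
have mG : @measurable _ (\bar R) = <<s G >>.
  have e := ErealGenOInfty.measurableE R.
  rewrite [LHS]e; apply/seteqP; split.
    by apply: sub_sigma_algebra2 => Y; right.
  apply: smallest_sub; first exact: smallest_sigma_algebra.
  move=> Y [->|[r ->]]; last by apply: sub_sigma_algebra; exists r.
  rewrite -[X in _ X](setCK setT) setCT -setTD; apply: sigma_algebraCD.
  exact: sigma_algebra0.
apply: (measure_unique G (fun=> setT) mG _ _ _
   (image_measure m mU) (image_measure m' mV)) => //.
- move=> Y Z [->|[r ->]] [->|[s ->]]; rewrite ?setTI ?setIT;
  try by [left|right; eexists].
  right; exists (Num.max r s); apply/seteqP; split=> x /=;
    rewrite !in_itv/= !andbT EFin_max gt_max; first by move=> [-> ->].
  by move=> /andP[].
- by move=> _; left.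
- by rewrite bigcup_const//; exists 0%N.
- move=> Y [->|[r ->]]; rewrite /image_measure /pushforward//=.
  have e (W : Omega -> \bar R) : W @^-1` [set` `]r%:E, +oo[] = [set w | r%:E < W w].
    by apply/seteqP; split=> w /=; rewrite in_itv/= andbT.
  rewrite /image_measure /pushforward (e U) (e V); exact: h.
- by move=> _; rewrite -ge0_fin_numE// fin_num_measure.
Qed.

End RayLaw.

Section Flow.
Context (R : realType) dE (E : measurableType dE) (A : (E -> R) -> E -> R)
  d (Omega : measurableType d) (X : jump_process A Omega).
Hypothesis mE : forall B : set E, measurable B.
Local Notation q := (exit_rate A).
Local Notation p := (jump_prob A).
Local Open Scope ereal_scope.
Local Notation skel_in := (skel_in X).
Local Notation hold_gt := (hold_gt X).
Local Notation past := (past X).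
Local Notation J := (jump_time X).
Hint Extern 0 (measurable (skel_in _ _)) => by apply: measurable_skel_in : core.
Hint Extern 0 (measurable (hold_gt _ _)) => exact: measurable_hold_gt : core.

Lemma jump_timeS n w : J n.+1 w = J n w + hold X n w.
Proof. by rewrite /jump_time big_ord_recr. Qed.

Lemma jump_time0 w : J 0 w = 0.
Proof. by rewrite /jump_time big_ord0. Qed.

Lemma jump_time_ge0 n w : 0 <= J n w.
Proof. by apply: sume_ge0 => i _; exact/ltW/hold_gt0. Qed.

Lemma measurable_jump_time n : measurable_fun setT (J n).
Proof. by apply: emeasurable_sum => i; exact: measurable_hold. Qed.

(** [J n] is the sum of the first [n] holding times, hence measurable for the sigma-algebra they
    generate, which is put on [Omega] through [g_sigma_algebraType]. *)
Lemma past_jump_time n (B : set \bar R) : measurable B -> past n (J n @^-1` B).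
Proof.
move=> mB; apply: past_hold_rays.
have mh (i : 'I_n) : measurable_fun setT
  (hold X i : g_sigma_algebraType (hold_rays X n) -> \bar R).
  apply: (measurability (@ErealGenOInfty.G R)) => [|_ [_ [r ->] <-]].
    exact: ErealGenOInfty.measurableE.
  rewrite setTI (_ : _ @^-1` _ = hold_gt i r); last first.
    by apply/seteqP; split=> w /=; rewrite in_itv/= andbT.
  have [r0|r0] := leP r 0%R; first by rewrite hold_gt_le0.
  apply: sub_sigma_algebra.
  exists (fun j => if j == i :> nat then r else 0%R).
    by move=> j; case: ifP => // _; exact: ltW.
  apply/seteqP; split=> w h; first by have := h i (ltn_ord i); rewrite eqxx.
  by move=> j _; case: eqP => [->//|_]; exact: hold_gt0.
have mJ : measurable_fun setT (J n : g_sigma_algebraType (hold_rays X n) -> \bar R).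
  exact: emeasurable_sum.
by have := mJ measurableT B mB; rewrite setTI.
Qed.

Variables (D : set E) (nxt : E -> seq E).
Hypothesis jc : jump_chain p q D nxt.

(** Extends [law_step] from rays to all measurable [H]. The exponential law is represented by
    holding time 0 of the process started at [y], which spares the construction of an exponential
    measure. *)
Lemma law_hold_in x n B y w (H : set \bar R) : D x -> past n B -> D y -> measurable H ->
  law X x (B `&` skel_in n [set y] `&` skel_in n.+1 [set w] `&` hold X n @^-1` H) =
  law X x (B `&` skel_in n [set y]) *
    law X y (skel_in 0 [set y] `&` skel_in 1 [set w] `&` hold X 0 @^-1` H).
Proof.
move=> Dx pB Dy mH; set P := law X x (B `&` skel_in n [set y]).
have Pfin : P \is a fin_num by rewrite fin_num_measure//; apply: measurableI => //;
  exact: past_measurable pB.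
have P0 : (0 <= fine P)%R by apply: fine_ge0; rewrite /P; apply: measure_ge0.
have mB : measurable (B `&` skel_in n [set y] `&` skel_in n.+1 [set w]).
  by do 2 apply: measurableI => //; exact: past_measurable pB.
have m0 : measurable (skel_in 0 [set y] `&` skel_in 1 [set w]).
  exact: measurableI.
have h s : (0 <= s)%R -> law X x
  (B `&` skel_in n [set y] `&` skel_in n.+1 [set w] `&` hold_gt n s) =
   P * law X y (skel_in 0 [set y] `&` skel_in 1 [set w] `&` hold_gt 0 s).
  move=> s0; rewrite (law_step mE jc)//; congr (_ * _).
  have := law_step mE jc w Dy (pastT X 0) Dy s0.
  by rewrite !setTI law_skel0// mul1e.
have e := @eq_law_rays _ Omega R (mrestr (law X x) mB)
  (mscale (NngNum P0) (mrestr (law X y) m0)) (hold X n) (hold X 0)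
  (measurable_hold X n) (measurable_hold X 0).
have := e _ _ H mH; rewrite /= /mscale /= /mrestr fineK//.
rewrite ![_ @^-1` H `&` _]setIC; apply.
- by have := h 0%R (lexx _); rewrite !hold_gt_le0// !setIT !setTI.
move=> r; rewrite -/(hold_gt n r) -/(hold_gt 0 r).
rewrite (setIC (hold_gt n r)) (setIC (hold_gt 0 r)).
have [r0|/ltW r0] := leP r 0%R; last exact: h.
by have := h 0%R (lexx _); rewrite !hold_gt_le0.
Qed.

End Flow.

(** * The forward equation *)

Section ExpIntegral.
Context (R : realType).
Local Open Scope ereal_scope.
Notation leb := (@lebesgue_measure R).

Lemma continuous_expR_affine (c j : R) : continuous (fun s : R => expR (- c * (s - j))).
Proof.
move=> z; apply: continuous_comp; last exact: continuous_expR.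
apply: cvgM; first exact: cvg_cst.
by apply: cvgB; [exact: cvg_id|exact: cvg_cst].
Qed.

(** The factor [c] is kept in front of the integral so that the formula includes [c = 0], the rate
    of an absorbing state. *)
Lemma integral_expR_itv (c j t : R) : (0 <= c)%R -> (j <= t)%R ->
  c%:E * \int[leb]_(s in `[j, t]) (expR (- c * (s - j)))%:E =
  (1 - expR (- c * (t - j)))%:E.
Proof.
move=> c0; rewrite le_eqVlt => /predU1P[->|jt].
  by rewrite set_itv1 integral_set1 mule0 subrr mulr0 expR0 subrr.
have mexp : measurable_fun setT (fun s : R => expR (- c * (s - j))).
  by apply: continuous_measurable_fun; exact: continuous_expR_affine.
rewrite -ge0_integralZl//; last first.
  by apply/measurable_EFinP; exact: measurable_funTS.
under eq_integral do rewrite -EFinM.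
have d z : is_derive (z : R) (1%R : R) (fun s : R => (- expR (- c * (s - j)))%R)
  (c * expR (- c * (z - j)))%R.
  apply: is_derive_eq.
  rewrite /GRing.scale/=; ring.
rewrite (@continuous_FTC2 _ _ (fun s => (- expR (- c * (s - j)))%R))//.
- by rewrite subrr mulr0 expR0 -EFinB opprK addrC.
- apply: continuous_subspaceT => z; apply: cvgM; first exact: cvg_cst.
  exact: continuous_expR_affine.
- split.
  + by move=> z _; exact: ex_derive.
  + by apply/cvg_at_right_filter; apply: cvgN; exact: continuous_expR_affine.
  + by apply/cvg_at_left_filter; apply: cvgN; exact: continuous_expR_affine.
- by move=> z _; rewrite derive1E; exact: derive_val.
Qed.

End ExpIntegral.

Section Flow.
Context (R : realType) dE (E : measurableType dE) (A : (E -> R) -> E -> R)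
  d (Omega : measurableType d) (X : jump_process A Omega).
Hypothesis mE : forall B : set E, measurable B.
Local Notation q := (exit_rate A).
Local Notation p := (jump_prob A).
Local Open Scope ereal_scope.
Local Notation skel_in := (skel_in X).
Local Notation hold_gt := (hold_gt X).
Local Notation past := (past X).
Local Notation J := (jump_time X).
Notation leb := (@lebesgue_measure R).
Hint Extern 0 (measurable (skel_in _ _)) => by apply: measurable_skel_in : core.
Hint Extern 0 (measurable (hold_gt _ _)) => exact: measurable_hold_gt : core.

Variables (D : set E) (nxt : E -> seq E).
Hypothesis jc : jump_chain p q D nxt.

Definition jumped n (t : R) : set Omega := [set w | J n w <= t%:E].
Definition staying n (t : R) : set Omega := [set w | J n w <= t%:E < J n.+1 w].

Lemma measurable_jumped n t : measurable (jumped n t).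
Proof.
rewrite -[jumped n t]setTI.
exact: (measurable_lee measurableT (measurable_jump_time X n) (measurable_cst t%:E)).
Qed.

Lemma measurable_staying n t : measurable (staying n t).
Proof.
rewrite (_ : staying n t = jumped n t `&` (setT `&` [set w | t%:E < J n.+1 w])).
  apply: measurableI; first exact: measurable_jumped.
  exact: (measurable_lte measurableT (measurable_cst t%:E)
    (measurable_jump_time X n.+1)).
rewrite setTI /staying /jumped; apply/seteqP; split=> w /=.
  by move=> /andP[].
by move=> [-> ->].
Qed.

Hint Resolve measurable_jumped measurable_staying : core.

Lemma jumped_split n t : jumped n t = staying n t `|` jumped n.+1 t.
Proof.
apply/seteqP; split=> w; rewrite /jumped /staying /=.
  by move=> ->/=; have [h|h] := ltP t%:E (J n.+1 w); [left|right].
move=> [/andP[]//|]; apply: le_trans; rewrite jump_timeS leeDl//.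
exact/ltW/hold_gt0.
Qed.

Lemma staying_jumped_disj n t : staying n t `&` jumped n.+1 t = set0.
Proof.
by rewrite -subset0 => w [/andP[_]]; rewrite /jumped/= ltNge => /negP.
Qed.

Lemma measure_jumped (mu : {measure set Omega -> \bar R}) M n t : measurable M ->
  mu (M `&` jumped n t) = mu (M `&` staying n t) + mu (M `&` jumped n.+1 t).
Proof.
move=> mM; rewrite -measureU//; last 3 first.
- exact: measurableI.
- exact: measurableI.
- by rewrite setIACA staying_jumped_disj setI0.
by rewrite -setIUr -jumped_split.
Qed.

(* The conditional probability, given the past up to the n-th jump into y, that
   the process has not left y by time s. *)
Definition survival n y w (s : R) : R :=
  if J n w <= s%:E then expR (- q y * (s - fine (J n w))) else 0%R.

Lemma survival_ge0 n y w s : (0 <= survival n y w s)%R.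
Proof. by rewrite /survival; case: ifP => // _; exact: expR_ge0. Qed.

Lemma measurable_survival n y :
  measurable_fun setT (fun z : Omega * R => survival n y z.1 z.2).
Proof.
apply: measurable_fun_ifT => //.
  apply: measurable_fun_lee.
    by apply: measurableT_comp => //; exact: measurable_jump_time.
  by apply/measurable_EFinP; exact: measurable_snd.
apply: measurableT_comp => //; apply: measurable_funM => //.
apply: measurable_funB; first exact: measurable_snd.
apply: measurableT_comp => //; apply: measurableT_comp => //.
exact: measurable_jump_time.
Qed.

Lemma measurable_survival1 n y s : measurable_fun setT (fun w => (survival n y w s)%:E).
Proof.
by apply/measurable_EFinP; apply: measurable_fun_pair1 (measurable_survival n y).
Qed.

(** When [J n <= t], the event [staying n t] says that holding time [n] exceeds [t - J n]. The set
    [C] encodes this as a condition on the pair, and [joint_law] integrates the exponential tail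
    over the law of [J n]. *)
Lemma law_staying_next x n y w t : D x -> D y -> (0 <= t)%R ->
  law X x (skel_in n [set y] `&` skel_in n.+1 [set w] `&` staying n t) =
  (p y w)%:E *
  \int[mrestr (law X x) (measurable_skel_in X mE n [set y])]_v (survival n y v t)%:E.
Proof.
move=> Dx Dy t0.
have mS2 : measurable (skel_in n [set y] `&` skel_in n.+1 [set w]).
  exact: measurableI.
have mS0 : measurable (skel_in 0 [set y] `&` skel_in 1 [set w]).
  exact: measurableI.
set m := mrestr (law X x) _.
pose nu := image_measure (mrestr (law X y) mS0) (measurable_hold X 0).
pose C : set (\bar R * \bar R) := [set c | c.1 <= t%:E < c.1 + c.2].
have mC : measurable C.
  rewrite (_ : C = (setT `&` [set c | c.1 <= t%:E]) `&`
                   (setT `&` [set c | t%:E < c.1 + c.2])).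
    apply: measurableI.
      by apply: measurable_lee => //; exact: measurable_fst.
    apply: measurable_lte => //.
    by apply: emeasurable_funD; [exact: measurable_fst|exact: measurable_snd].
  rewrite !setTI /C; apply/seteqP; split=> c /=; first by move=> /andP[].
  by move=> [-> ->].
have hrect B1 B2 : measurable B1 -> measurable B2 ->
    mrestr (law X x) mS2 (J n @^-1` B1 `&` hold X n @^-1` B2) =
      m (J n @^-1` B1) * nu B2.
  move=> mB1 mB2; rewrite /= /m /nu /= /image_measure /pushforward /mrestr.
  rewrite (setIC (hold X 0 @^-1` B2)).
  rewrite -(law_hold_in mE jc)//; last exact: past_jump_time.
  by rewrite [in LHS]setIAC !setIA.
have -> : law X x (skel_in n [set y] `&` skel_in n.+1 [set w] `&` staying n t) =
    mrestr (law X x) mS2 (staying n t) by rewrite /= /mrestr setIC.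
have <- : [set v | C (J n v, hold X n v)] = staying n t.
  by apply/seteqP; split=> v; rewrite /C /staying /= jump_timeS.
rewrite (joint_law (measurable_jump_time X n) (measurable_hold X n) hrect mC).
rewrite -ge0_integralZl//; last 3 first.
- exact: measurable_survival1.
- by move=> v _; rewrite lee_fin survival_ge0.
- by rewrite lee_fin (jc_ge0 jc).
apply: eq_integral => v _; rewrite /nu /= /image_measure /pushforward /= /mrestr.
rewrite /survival; case: ifPn => h; last first.
  rewrite mule0 (_ : _ `&` _ = set0) ?measure0//.
  rewrite -subset0 => u [+ _]; rewrite /= /xsection/= inE /C/= => /andP[+ _].
  by rewrite (negbTE h).
have J0 := jump_time_ge0 X n v.
have Jfin : J n v \is a fin_num.
  by rewrite ge0_fin_numE// (le_lt_trans h)// ltry.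
have := law_step mE jc w Dy (pastT X 0) Dy (s := (t - fine (J n v))%R).
rewrite !setTI law_skel0// mul1e -EFinM => <-; last first.
  by rewrite subr_ge0 -lee_fin fineK.
have -> : hold_gt 0 (t - fine (J n v)) = hold X 0 @^-1` xsection C (J n v).
  apply/seteqP; split=> u; rewrite /= /xsection/= inE /C/= h/= /(hold_gt _ _)/=;
    by rewrite EFinB fineK// lteBlDl.
by rewrite setIC.
Qed.

Lemma law_staying x n y t : D x -> D y -> (0 <= t)%R ->
  law X x (skel_in n [set y] `&` staying n t) =
  \int[mrestr (law X x) (measurable_skel_in X mE n [set y])]_v (survival n y v t)%:E.
Proof.
move=> Dx Dy t0; have := law_sum_next mE jc Dx (pastT X n) Dy (measurable_staying n t).
rewrite setTI => ->.
under eq_bigr do rewrite law_staying_next// muleC -[p _ _]mulr1.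
by rewrite (sum_next jc)// mule1.
Qed.

Lemma law_staying_step x n y w t : D x -> D y -> (0 <= t)%R ->
  law X x (skel_in n [set y] `&` skel_in n.+1 [set w] `&` staying n t) =
  (p y w)%:E * law X x (skel_in n [set y] `&` staying n t).
Proof. by move=> Dx Dy t0; rewrite law_staying_next// law_staying. Qed.

(** Pathwise form of the forward equation: once [y] has been entered, the chance of having left by
    time [t] is the integral of the rate [q y] against survival. *)
Lemma survival_integral n y v t : D y -> (0 <= t)%R ->
  (q y)%:E * \int[leb]_(s in `[0%R, t]) (survival n y v s)%:E +
    (survival n y v t)%:E = (\1_(jumped n t) v)%:E.
Proof.
move=> Dy t0; have J0 := jump_time_ge0 X n v.
rewrite indicE; case: (boolP (J n v <= t%:E)) => h; last first.
  rewrite memNset; last exact/negP.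
  rewrite {2}/survival (negbTE h) adde0 integral0_eq ?mule0// => s.
  rewrite /= in_itv/= => /andP[_ st]; rewrite /survival ifF//.
  apply: contraNF h => /le_trans; apply; rewrite lee_fin//.
rewrite mem_set//.
have Jfin : J n v \is a fin_num.
  by rewrite ge0_fin_numE// (le_lt_trans h)// ltry.
have j0 : (0 <= fine (J n v))%R by rewrite -lee_fin fineK.
have jt : (fine (J n v) <= t)%R by rewrite -lee_fin fineK.
have -> : \int[leb]_(s in `[0%R, t]) (survival n y v s)%:E =
    \int[leb]_(s in `[fine (J n v), t]) (expR (- q y * (s - fine (J n v))))%:E.
  rewrite integral_mkcond [RHS]integral_mkcond; apply: eq_integral => s _.
  rewrite !patchE !mem_setE !in_itv/= /survival -{1}(fineK Jfin) lee_fin.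
  case: (leP (fine (J n v)) s) => hs; last by case: ifP.
  by rewrite (le_trans j0 hs).
rewrite integral_expR_itv ?(jc_rate jc Dy)//.
by rewrite {1}/survival h -EFinD subrK.
Qed.

(** The expectation of [survival_integral], after exchanging the integrals by Tonelli: what has
    entered [y] by time [t] has either left it at rate [q y] or is still there. *)
Lemma law_jumped x n y t : D x -> D y -> (0 <= t)%R ->
  (q y)%:E * \int[leb]_(s in `[0%R, t]) law X x (skel_in n [set y] `&` staying n s) +
    law X x (skel_in n [set y] `&` staying n t) =
  law X x (skel_in n [set y] `&` jumped n t).
Proof.
move=> Dx Dy t0; set m := mrestr (law X x) (measurable_skel_in X mE n [set y]).
have -> : \int[leb]_(s in `[0%R, t]) law X x (skel_in n [set y] `&` staying n s) =
    \int[m]_v \int[leb]_(s in `[0%R, t]) (survival n y v s)%:E.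
  pose f (z : Omega * R) : \bar R :=
    ((survival n y z.1 z.2)%:E * (\1_(`[0%R, t]%classic) z.2)%:E).
  have mf : measurable_fun setT f.
    apply: emeasurable_funM.
      by apply/measurable_EFinP; exact: measurable_survival.
    by apply/measurable_EFinP; apply: measurableT_comp => //; exact: measurable_indic.
  have f0 z : 0 <= f z.
    by rewrite mule_ge0// lee_fin ?survival_ge0.
  have := fubini_tonelli (m1 := m) (m2 := leb) f mf f0.
  rewrite [X in X = _ -> _](_ : _ =
      \int[m]_v \int[leb]_(s in `[0%R, t]) (survival n y v s)%:E); last first.
    apply: eq_integral => v _; rewrite [RHS]integral_mkcond.
    apply: eq_integral => s _; rewrite /f /= patchE indicE.
    by case: ifP => _; rewrite ?mule1 ?mule0.
  move=> ->; rewrite integral_mkcond; apply: eq_integral => s _.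
  rewrite patchE; case: ifPn => hs.
    rewrite law_staying//; last by move: hs; rewrite inE/= in_itv/= => /andP[].
    apply: eq_integral => v _; rewrite /f/= indicE hs mule1//.
  rewrite integral0_eq// => v _; rewrite /f/= indicE (negbTE hs) mule0//.
have mI : measurable_fun setT
  (fun v => \int[leb]_(s in `[0%R, t]) (survival n y v s)%:E).
  pose f (z : Omega * R) : \bar R :=
    ((survival n y z.1 z.2)%:E * (\1_(`[0%R, t]%classic) z.2)%:E).
  have mf : measurable_fun setT f.
    apply: emeasurable_funM.
      by apply/measurable_EFinP; exact: measurable_survival.
    by apply/measurable_EFinP; apply: measurableT_comp => //; exact: measurable_indic.
  have f0 z : 0 <= f z.
    by rewrite mule_ge0// lee_fin ?survival_ge0.
  have := measurable_fun_fubini_tonelli_F (m2 := leb) f mf f0.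
  apply: eq_measurable_fun => v _; rewrite /fubini_F [RHS]integral_mkcond.
  apply: eq_integral => s _; rewrite /f /= patchE indicE.
  by case: ifP => _; rewrite ?mule1 ?mule0.
have I0 v : 0 <= \int[leb]_(s in `[0%R, t]) (survival n y v s)%:E.
  by apply: integral_ge0 => s _; rewrite lee_fin survival_ge0.
have q0 : 0 <= (q y)%:E by rewrite lee_fin (jc_rate jc).
rewrite law_staying// -ge0_integralZl// -ge0_integralD//; last 4 first.
- by move=> v _; rewrite mule_ge0.
- exact: measurable_funeM.
- by move=> v _; rewrite lee_fin survival_ge0.
- exact: measurable_survival1.
under eq_integral do rewrite survival_integral//.
by rewrite integral_indic// setIT /= /m /mrestr setIC.
Qed.

End Flow.

(** * A comparison principle for a linear integral inequality *)

Section Comparison.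
Context (R : realType).
Local Open Scope ereal_scope.
Notation leb := (@lebesgue_measure R).

Lemma integral_itv_split (M : R -> \bar R) (s t : R) :
  measurable_fun setT M -> (forall r, 0 <= M r) -> (0 <= s <= t)%R ->
  \int[leb]_(r in `[0%R, t]) M r =
  \int[leb]_(r in `[0%R, s]) M r + \int[leb]_(r in `]s, t]) M r.
Proof.
move=> mM M0 /andP[s0 st]; rewrite -ge0_integral_setU//.
- by congr (integral _ _ _); rewrite -itv_bndbnd_setU// bnd_simp.
- exact: measurable_funTS.
- apply/disj_setPS => r /= [/andP[_]]; rewrite !bnd_simp => rs /andP[].
  by rewrite bnd_simp ltNge rs.
Qed.

(* M solves M' = B' - q M with B' <= q c and M 0 <= c. *)
Lemma comparison (M B : R -> \bar R) (q c : R) : (0 <= q)%R ->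
  measurable_fun setT M -> (forall t, 0 <= M t) ->
  (forall t, (0 <= t)%R -> M t + q%:E * \int[leb]_(s in `[0%R, t]) M s = B t) ->
  B 0%R <= c%:E ->
  (forall s t, (0 <= s)%R -> (s <= t)%R -> B t <= B s + (q * c * (t - s))%:E) ->
  forall t, (0 <= t)%R -> M t <= c%:E.
Proof.
move=> q0 mM M0 hB B0 incB t1 t10.
have I0 a b : 0 <= q%:E * \int[leb]_(s in [set` Interval a b]) M s.
  by rewrite mule_ge0// integral_ge0.
have MB t : (0 <= t)%R -> M t <= B t by move=> t0; rewrite -hB// leeDl.
have c0 : (0 <= c)%R.
  by rewrite -lee_fin (le_trans (M0 0%R))// (le_trans (MB _ (lexx _))).
have Bfin t : (0 <= t)%R -> B t \is a fin_num.
  move=> t0; rewrite ge0_fin_numE; last exact: le_trans (M0 t) (MB _ t0).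
  apply: le_lt_trans (incB _ _ (lexx _) t0) _.
  by rewrite lte_add_pinfty ?ltry// (le_lt_trans B0)// ltry.
have inc s t : (0 <= s)%R -> (s <= t)%R ->
    M t + q%:E * \int[leb]_(r in `]s, t]) M r <= M s + (q * c * (t - s))%:E.
  move=> s0 st; have := incB s t s0 st.
  rewrite -!hB//; last exact: le_trans st.
  rewrite (integral_itv_split mM M0 (s := s)) ?s0//.
  rewrite ge0_muleDr ?integral_ge0//.
  set K := q%:E * \int[leb]_(r in `[0%R, s]) M r.
  have Kfin : K \is a fin_num.
    rewrite ge0_fin_numE ?I0// (@le_lt_trans _ _ (B s))//.
      by rewrite -hB// leeDr.
    by rewrite -ge0_fin_numE ?Bfin// (le_trans (M0 s))// MB.
  by rewrite addeCA (addeC (M s)) -addeA leeD2lE.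
rewrite leNgt; apply/negP => Mt1.
(* [M] is not assumed continuous, so its value at [sup S] is not controlled. A time [s] of [S]
   within [e / (q * c + 1)] of the supremum is used instead; this costs an error of at most
   [q * c * (s0 - s) <= e]. *)
pose S := [set s : R | (0 <= s <= t1)%R /\ M s <= c%:E].
have S0 : S 0%R by split; rewrite ?lexx// (le_trans (MB _ (lexx _))).
have supS : has_sup S.
  by split; [exists 0%R|exists t1 => s [/andP[_ ->]]].
set s0 := sup S.
have s00 : (0 <= s0)%R by apply: ub_le_sup => //; exact: supS.2.
have s0t : (s0 <= t1)%R by apply: ge_sup; [exists 0%R|move=> s [/andP[]]].
have qc1 : (0 < q * c + 1)%R by rewrite ltr_wpDl// mulr_ge0.
suff : M t1 <= c%:E by rewrite leNgt Mt1.
apply/lee_addgt0Pr => e e0.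
have d0 : (0 < e / (q * c + 1))%R by rewrite divr_gt0.
have [s [/andP[s0' st1] Ms] hs] := sup_adherent d0 supS.
have ss0 : (s <= s0)%R by apply: ub_le_sup; [exact: supS.2|split=> //; rewrite s0'].
(* After [s0] the function [M] stays above [c], so the outflow there is at least [q * c] per unit of
   time and cancels the inflow. *)
have low : (c * (t1 - s0))%:E <= \int[leb]_(r in `]s, t1]) M r.
  apply: (@le_trans _ _ (\int[leb]_(r in `]s0, t1]) M r)); last first.
    apply: ge0_subset_integral => //; first exact: measurable_funTS.
    by apply: subset_itvr; rewrite bnd_simp.
  have -> : (c * (t1 - s0))%:E = \int[leb]_(r in `]s0, t1]) (cst c%:E) r.
    rewrite integral_cst//= lebesgue_measure_itv/= lte_fin.
    case: ltP => h; first by rewrite EFinM EFinB.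
    by rewrite (_ : t1 = s0) ?subrr ?mulr0 ?mule0//; apply/eqP; rewrite eq_le h s0t.
  apply: ge0_le_integral => //; last first.
  - move=> r; rewrite /= in_itv/= => /andP[h1 h2]; rewrite leNgt; apply/negP => h.
    suff : (r <= s0)%R by rewrite leNgt h1.
    apply: ub_le_sup; first exact: supS.2.
    by split; [rewrite h2 (le_trans s00)// ltW|exact: ltW].
  - exact: measurable_funTS.
have := inc s t1 s0' st1.
move=> h; have {h} : M t1 + (q * (c * (t1 - s0)))%:E <= c%:E + (q * c * (t1 - s))%:E.
  apply: le_trans (le_trans h _); last by rewrite leeD2r.
  by rewrite leeD2l// EFinM lee_wpmul2l.
rewrite -leeBrDr// => /le_trans; apply; rewrite -!EFinD lee_fin.
have : (q * c * (s0 - s) <= e)%R; last by lra.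
have h : (s0 - s <= e / (q * c + 1))%R by rewrite lerBlDr -lerBlDl ltW.
apply: (@le_trans _ _ ((q * c + 1) * (e / (q * c + 1)))%R).
  apply: ler_pM => //; rewrite ?mulr_ge0 ?subr_ge0//.
  by rewrite lerDl.
by rewrite mulrC divfK// gt_eqF.
Qed.

End Comparison.

Section Flow.
Context (R : realType) dE (E : measurableType dE) (A : (E -> R) -> E -> R)
  d (Omega : measurableType d) (X : jump_process A Omega).
Hypothesis mE : forall B : set E, measurable B.
Local Notation q := (exit_rate A).
Local Notation p := (jump_prob A).
Local Open Scope ereal_scope.
Local Notation skel_in := (skel_in X).
Local Notation hold_gt := (hold_gt X).
Local Notation past := (past X).
Local Notation J := (jump_time X).
Local Notation jumped := (jumped X).
Local Notation staying := (staying X).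
Notation leb := (@lebesgue_measure R).
Hint Extern 0 (measurable (skel_in _ _)) => by apply: measurable_skel_in : core.
Hint Extern 0 (measurable (hold_gt _ _)) => exact: measurable_hold_gt : core.
Hint Extern 0 (measurable (jumped _ _)) => exact: measurable_jumped : core.
Hint Extern 0 (measurable (staying _ _)) => exact: measurable_staying : core.

Variables (D : set E) (nxt : E -> seq E).
Hypothesis jc : jump_chain p q D nxt.

Lemma past_jumped n t : past n (jumped n t).
Proof.
rewrite (_ : jumped n t = J n @^-1` `]-oo, t%:E]).
  by apply: past_jump_time; exact: emeasurable_itv.
by apply/seteqP; split=> w; rewrite /jumped/= in_itv/=.
Qed.

Lemma law_jumped_split x M n t : measurable M ->
  law X x (M `&` jumped n t) =
  law X x (M `&` staying n t) + law X x (M `&` jumped n.+1 t).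
Proof. exact: measure_jumped. Qed.

(** A fraction [p y w] goes to [w] both among the trajectories that entered [y] and among those
    still there; by [law_jumped] the difference is the flux through the jump from [y] to [w]. *)
Lemma law_jumped_step x n y w t : D x -> D y -> (0 <= t)%R ->
  law X x (skel_in n [set y] `&` skel_in n.+1 [set w] `&` jumped n.+1 t) =
  (q y * p y w)%:E *
    \int[leb]_(s in `[0%R, t]) law X x (skel_in n [set y] `&` staying n s).
Proof.
move=> Dx Dy t0.
have mS : measurable (skel_in n [set y] `&` skel_in n.+1 [set w]) by exact: measurableI.
have := law_jumped_split x n t mS.
rewrite (law_staying_step X mE jc)//.
have -> : skel_in n [set y] `&` skel_in n.+1 [set w] `&` jumped n t =
    jumped n t `&` skel_in n [set y] `&` skel_in n.+1 [set w].
  by rewrite setIC setIA.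
rewrite (law_next mE jc)//; last exact: past_jumped.
rewrite (setIC (jumped n t)) -(law_jumped X mE jc)//.
have I0 : 0 <= \int[leb]_(s in `[0%R, t]) law X x (skel_in n [set y] `&` staying n s).
  exact: integral_ge0.
have q0 : (0 <= q y)%R by exact: (jc_rate jc).
have p0 : (0 <= p y w)%R by exact: (jc_ge0 jc).
rewrite muleC ge0_muleDr//; last by rewrite mule_ge0.
rewrite muleA -EFinM (mulrC (p y w)) addeC => /eqP.
set a := (p y w)%:E * _.
have afin : a \is a fin_num.
  by rewrite fin_numM// fin_num_measure//; exact: measurableI.
move=> /eqP /(congr1 (fun e => e - a)).
by rewrite ![a + _]addeC !addeK.
Qed.

(** The function is a difference of two nondecreasing functions of [t]. *)
Lemma measurable_law_staying x M j : measurable M ->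
  measurable_fun setT (fun t => law X x (M `&` staying j t)).
Proof.
move=> mM.
have mjump k : measurable_fun setT (fun t => fine (law X x (M `&` jumped k t))).
  apply: nondecreasing_measurable => // s t st; apply: fine_le.
  - by rewrite fin_num_measure//; exact: measurableI.
  - by rewrite fin_num_measure//; exact: measurableI.
  apply: le_measure; rewrite ?inE; try exact: measurableI.
  by apply: setIS => w; rewrite /jumped/= => /le_trans; apply; rewrite lee_fin.
rewrite (_ : (fun t => _) = (fun t => (fine (law X x (M `&` jumped j t)) -
    fine (law X x (M `&` jumped j.+1 t)))%:E)).
  by apply/measurable_EFinP; exact: measurable_funB.
apply/funext => t; rewrite EFinB !fineK ?fin_num_measure//; try exact: measurableI.
rewrite (law_jumped_split x j t mM) addeK// fin_num_measure//.
exact: measurableI.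
Qed.

(* The mass at w at time t, under the initial masses a on L, of the trajectories
   that have made fewer than n jumps. *)
Definition flow_from (a : E -> \bar R) (L : seq E) n (t : R) w : \bar R :=
  \sum_(x <- L) a x * \sum_(j < n) law X x (skel_in j [set w] `&` staying j t).

Section FlowLemmas.
Variables (a : E -> R) (L : seq E).
Hypothesis a0 : forall x, (0 <= a x)%R.
Local Notation flow := (flow_from (EFin \o a) L).

Lemma flow_ge0 n t w : 0 <= flow n t w.
Proof. by apply: sume_ge0 => x _; rewrite mule_ge0 ?lee_fin// sume_ge0. Qed.

Lemma measurable_flow n w : measurable_fun setT (fun t => flow n t w).
Proof.
apply: emeasurable_sum => x; apply: measurable_funeM.
by apply: emeasurable_sum => j; exact: measurable_law_staying.
Qed.

Lemma integral_flow n t w :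
  \int[leb]_(s in `[0%R, t]) flow n s w =
  \sum_(x <- L) (a x)%:E * \sum_(j < n)
    \int[leb]_(s in `[0%R, t]) law X x (skel_in j [set w] `&` staying j s).
Proof.
rewrite ge0_integral_sum//.
- apply: eq_bigr => x _; rewrite ge0_integralZl//.
  + by congr (_ * _); rewrite ge0_integral_sum// => j;
      apply: measurable_funTS; exact: measurable_law_staying.
  + by apply: measurable_funTS; apply: emeasurable_sum => j;
    exact: measurable_law_staying.
  + by move=> s _; rewrite sume_ge0.
  + by rewrite lee_fin.
- move=> x; apply: measurable_funTS; apply: measurable_funeM.
  by apply: emeasurable_sum => j; exact: measurable_law_staying.
- by move=> x s _; rewrite mule_ge0 ?lee_fin// sume_ge0.
Qed.

(** The integrated forward equation. The shift from [n.+1] to [n] is the point: mass at [w] with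
    fewer than [n.+1] jumps either started there or jumped in from a trajectory with fewer than [n]
    jumps. *)
Lemma flow_balance n t w : {in L, forall x, D x} -> (0 <= t)%R -> D w ->
  flow n.+1 t w + (q w)%:E * \int[leb]_(s in `[0%R, t]) flow n.+1 s w =
  \sum_(x <- L) (a x)%:E * (x == w)%:R%:E +
  \esum_(y in D) ((q y * p y w)%:E * \int[leb]_(s in `[0%R, t]) flow n s y).
Proof.
move=> LD t0 Dw.
have q0 y : D y -> (0 <= q y)%R by move=> Dy; exact: (jc_rate jc).
have p0 y : D y -> (0 <= p y w)%R by move=> Dy; exact: (jc_ge0 jc).
have I0 x j y : 0 <= \int[leb]_(s in `[0%R, t]) law X x
  (skel_in j [set y] `&` staying j s).
  exact: integral_ge0.
transitivity (\sum_(x <- L) (a x)%:E * \sum_(j < n.+1)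
    law X x (skel_in j [set w] `&` jumped j t)).
  rewrite integral_flow ge0_sume_distrr; last first.
    by move=> x _; rewrite mule_ge0 ?lee_fin// sume_ge0.
  rewrite /flow_from -big_split/= big_seq [RHS]big_seq; apply: eq_bigr => x /LD Dx.
  rewrite muleCA -ge0_muleDr ?sume_ge0 ?mule_ge0 ?lee_fin ?q0 ?sume_ge0//.
  congr (_ * _); rewrite ge0_sume_distrr// -big_split/=; apply: eq_bigr => j _.
  by rewrite addeC (law_jumped X mE jc).
have -> : \esum_(y in D) ((q y * p y w)%:E * \int[leb]_(s in `[0%R, t]) flow n s y) =
   \sum_(x <- L) (a x)%:E * \sum_(j < n) \esum_(y in D) ((q y * p y w)%:E *
     \int[leb]_(s in `[0%R, t]) law X x (skel_in j [set y] `&` staying j s)).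
  transitivity (\esum_(y in D) \sum_(x <- L) (a x)%:E * \sum_(j < n) ((q y * p y w)%:E *
     \int[leb]_(s in `[0%R, t]) law X x (skel_in j [set y] `&` staying j s))).
    apply: eq_esum => y Dy; rewrite integral_flow ge0_sume_distrr; last first.
      by move=> x _; rewrite mule_ge0 ?lee_fin// sume_ge0.
    by apply: eq_bigr => x _; rewrite muleCA ge0_sume_distrr.
  rewrite esum_sum; last first.
    move=> y x Dy _; rewrite mule_ge0 ?lee_fin// sume_ge0// => j _.
    by rewrite mule_ge0 ?lee_fin ?mulr_ge0 ?q0 ?p0.
  apply: eq_bigr => x _; rewrite esumZl//; last 2 first.
  - exact: jc_countable jc.
  - move=> y Dy; rewrite sume_ge0// => j _.
    by rewrite mule_ge0 ?lee_fin ?mulr_ge0 ?q0 ?p0.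
  rewrite esum_sum// => y j Dy _.
  by rewrite mule_ge0 ?lee_fin ?mulr_ge0 ?q0 ?p0.
rewrite -big_split/= big_seq [RHS]big_seq; apply: eq_bigr => x /LD Dx.
rewrite -ge0_muleDr; last 2 first.
- by rewrite lee_fin.
- rewrite sume_ge0// => j _; apply: esum_ge0 => y Dy.
  by rewrite mule_ge0 ?lee_fin ?mulr_ge0 ?q0 ?p0.
congr (_ * _); rewrite big_ord_recl; congr (_ + _).
  rewrite (_ : jumped _ t = setT) ?setIT; last first.
    by apply/seteqP; split=> // v _; rewrite /(jumped _ _)/= jump_time0 lee_fin.
  have := law_path X x 0 (fun=> w) (fun=> lexx 0%R).
  rewrite holds_gt0 setIT big_ord0 mulr1 path_ltS path_lt0 setTI eq_sym => ->.
  by rewrite eq_sym.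
apply: eq_bigr => j _.
have mM : measurable (skel_in j.+1 [set w] `&` jumped j.+1 t) by exact: measurableI.
rewrite lift0 (measure_skel_esum (X := X) mE jc (n := j) mM (law_out X mE jc j Dx)).
apply: eq_esum => y Dy; rewrite -law_jumped_step//.
by rewrite setIC setIA.
Qed.

Hypothesis uL : uniq L.
Hypothesis LD : {in L, forall x, D x}.
Hypothesis sub_inv : forall w, D w ->
  \esum_(y in D) (q y * p y w * a y)%:E <= (q w * a w)%:E.

(** Induction on the number of jumps: the inflow into [w] is at most the one produced by [a], which
    subinvariance bounds by [q w * a w], so that [comparison] applies with [c := a w]. *)
Lemma flow_le n t w : (0 <= t)%R -> D w -> flow n t w <= (a w)%:E.
Proof.
move=> t0; elim: n t t0 w => [|n ih] t t0 w Dw.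
  rewrite /flow_from big1 ?lee_fin// => x _; by rewrite big_ord0 mule0.
have q0 y : D y -> (0 <= q y)%R by move=> Dy; exact: (jc_rate jc).
have p0 y : D y -> (0 <= p y w)%R by move=> Dy; exact: (jc_ge0 jc).
have qp0 y : D y -> 0 <= (q y * p y w)%:E by move=> Dy;
  rewrite lee_fin mulr_ge0 ?q0 ?p0.
pose B t := \sum_(x <- L) (a x)%:E * (x == w)%:R%:E +
  \esum_(y in D) ((q y * p y w)%:E * \int[leb]_(s in `[0%R, t]) flow n s y).
apply: (@comparison R (fun t => flow n.+1 t w) B (q w) (a w) (q0 _ Dw)) => //.
- exact: measurable_flow.
- by move=> s; exact: flow_ge0.
- by move=> s s0; rewrite flow_balance.
- rewrite /B [X in _ + X]esum1; last first.
    by move=> y _; rewrite set_itv1 integral_set1 mule0.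
  rewrite adde0; have [wL|wL] := boolP (w \in L).
    rewrite (bigD1_seq w)//= eqxx mule1 big1 ?adde0// => x xw.
    by rewrite (negbTE xw) mule0.
  rewrite big_seq big1 ?lee_fin// => x xL.
  by rewrite (_ : x == w = false) ?mule0//; apply/negbTE; apply: contraNneq wL => <-.
- move=> r s r0 rs; rewrite /B -addeA leeD2l//.
  apply: (@le_trans _ _ (\esum_(y in D) (
      (q y * p y w)%:E * \int[leb]_(s in `[0%R, r]) flow n s y +
      (s - r)%:E * (q y * p y w * a y)%:E))).
    apply: le_esum => y Dy.
    rewrite (integral_itv_split (s := r)); last 3 first.
    + exact: measurable_flow.
    + by move=> ?; exact: flow_ge0.
    + by rewrite r0.
    rewrite ge0_muleDr; try by apply: integral_ge0 => v _; exact: flow_ge0.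
    rewrite leeD2l// [leRHS]muleC [X in _ <= X * _]EFinM -muleA lee_wpmul2l ?qp0//.
    apply: (@le_trans _ _ (\int[leb]_(v in `]r, s]) (cst (a y)%:E) v)).
      apply: ge0_le_integral => //.
      + by move=> v _; exact: flow_ge0.
      + by apply: measurable_funTS; exact: measurable_flow.
      + move=> v; rewrite /= in_itv/= => /andP[rv _]; apply: ih => //.
        by rewrite (le_trans r0)// ltW.
    rewrite integral_cst//= lebesgue_measure_itv/= lte_fin.
    case: ifP => h; first by rewrite -EFinB.
    by rewrite mule0 lee_fin mulr_ge0// ?subr_ge0.
  rewrite esumD; last 2 first.
  + by move=> y Dy; rewrite mule_ge0 ?qp0// integral_ge0// => v _; exact: flow_ge0.
  + by move=> y Dy; rewrite -EFinM lee_fin !mulr_ge0 ?subr_ge0 ?q0 ?p0.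
  rewrite leeD2l// esumZl ?subr_ge0//; last 2 first.
  + exact: jc_countable jc.
  + by move=> y Dy; rewrite lee_fin !mulr_ge0 ?q0 ?p0.
  by rewrite [leRHS]EFinM [leRHS]muleC lee_wpmul2l ?lee_fin ?subr_ge0// sub_inv.
Qed.

End FlowLemmas.
End Flow.

(** * Invariant probabilities *)

Section KernelUnique.
Context (R : realType) (E : pointedType) (D : set E).
Local Open Scope ereal_scope.

(** The minimum [l] of [m] and [m'] is subinvariant, hence invariant as the kernel preserves mass.
    If [m z <= m' z], then [l] and [m] agree at [z], and writing both values there as sums with
    positive weights [k x z] forces [l = m]. Thus [m <= m'], with equal totals. *)
Lemma kernel_unique (k : E -> E -> \bar R) (z : E) (m m' : E -> \bar R) :
  countable D -> D z ->
  (forall x y, D x -> D y -> 0 <= k x y) ->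
  (forall x, D x -> \esum_(y in D) k x y = 1) ->
  (forall x, D x -> 0 < k x z) ->
  (forall x, D x -> 0 <= m x) -> (forall x, D x -> 0 <= m' x) ->
  (forall y, D y -> \esum_(x in D) (m x * k x y) = m y) ->
  (forall y, D y -> \esum_(x in D) (m' x * k x y) = m' y) ->
  \esum_(x in D) m x = 1 -> \esum_(x in D) m' x = 1 ->
  forall x, D x -> m x = m' x.
Proof.
move=> cD; wlog mzm : m m' / m z <= m' z.
  move=> wlg Dz k0 k1 kz m0 m0' inv inv' s s' x Dx.
  have [h|/ltW h] := leP (m z) (m' z); first exact: (wlg m m').
  by apply/esym; exact: (wlg m' m).
move=> Dz k0 k1 kz m0 m0' inv inv' s s'.
pose l x := Order.min (m x) (m' x).
have l0 x : D x -> 0 <= l x by move=> Dx; rewrite /l le_min m0// m0'.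
have lm x : l x <= m x by rewrite /l ge_min lexx.
have lm' x : l x <= m' x by rewrite /l ge_min lexx orbT.
have fin (u : E -> \bar R) : (forall x, D x -> 0 <= u x) -> \esum_(x in D) u x = 1 ->
    forall x, D x -> u x \is a fin_num.
  move=> u0 su x Dx; rewrite ge0_fin_numE ?u0//.
  by apply: (@le_lt_trans _ _ 1); rewrite ?ltry// -su; exact: esum_ge_term.
have lfin x : D x -> l x \is a fin_num.
  move=> Dx; rewrite ge0_fin_numE ?l0//; apply: le_lt_trans (lm x) _.
  by rewrite -ge0_fin_numE ?m0// (fin m).
have kfin x y : D x -> D y -> k x y \is a fin_num.
  by move=> Dx; apply: (fin (k x)); [move=> ? ?; exact: k0|exact: k1].
have ls y : D y -> \esum_(x in D) (l x * k x y) <= l y.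
  move=> Dy; rewrite /l le_min; apply/andP; split.
    rewrite -inv//; apply: le_esum => x Dx; rewrite lee_wpmul2r ?k0//; exact: lm.
  rewrite -inv'//; apply: le_esum => x Dx; rewrite lee_wpmul2r ?k0//; exact: lm'.
have lk0 x y : D x -> D y -> 0 <= l x * k x y by move=> ? ?; rewrite mule_ge0 ?l0 ?k0.
have leq : forall y, D y -> \esum_(x in D) (l x * k x y) = l y.
  apply: esum_eq_of_le.
  - by move=> y Dy; rewrite ls// andbT esum_ge0// => x Dx; exact: lk0.
  - rewrite esum_exchange; last by move=> y x Dy Dx; exact: lk0.
    apply: eq_esum => x Dx; rewrite -(fineK (lfin _ Dx)) esumZl//; last 2 first.
    + by rewrite fine_ge0// l0.
    + by move=> y Dy; exact: k0.
    by rewrite k1// mule1.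
  - apply: (@le_lt_trans _ _ (\esum_(x in D) m x)); last by rewrite s ltry.
    by apply: le_esum.
have lz : l z = m z by rewrite /l min_l.
have e x : D x -> l x = m x.
  move=> Dx; have := @esum_eq_of_le R E D (fun x => l x * k x z)
    (fun x => m x * k x z) _ _ _ x Dx.
  have kz1 : (0 < fine (k x z))%R.
    by rewrite fine_gt0// kz//= -ge0_fin_numE ?k0// kfin.
  rewrite -(fineK (kfin _ _ Dx Dz)) -(fineK (lfin _ Dx)) -(fineK (fin m m0 s _ Dx)).
  rewrite -!EFinM => h; congr EFin; apply: (mulIf (lt0r_neq0 kz1)).
  apply: EFin_inj; apply: h.
  - by move=> y Dy; rewrite lk0//= lee_wpmul2r ?k0.
  - by rewrite leq// inv.
  - by rewrite inv// -ge0_fin_numE ?m0// (fin m).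
apply: esum_eq_of_le.
- by move=> x Dx; rewrite m0//= -e.
- by rewrite s s'.
- by rewrite s' ltry.
Qed.

End KernelUnique.

Section Invariant.
Context (R : realType) dE (E : measurableType dE) (A : (E -> R) -> E -> R)
  d (Omega : measurableType d) (X : jump_process A Omega).
Hypothesis mE : forall B : set E, measurable B.
Local Notation q := (exit_rate A).
Local Notation p := (jump_prob A).
Local Open Scope ereal_scope.
Local Notation skel_in := (skel_in X).
Local Notation J := (jump_time X).
Local Notation staying := (staying X).
Hint Extern 0 (measurable (skel_in _ _)) => by apply: measurable_skel_in : core.
Hint Extern 0 (measurable (staying _ _)) => exact: measurable_staying : core.

Lemma jump_time_le m n w : (m <= n)%N -> J m w <= J n w.
Proof.
move=> /subnK <-; elim: (n - m)%N => [|k ih]; first by rewrite add0n.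
by rewrite addSn jump_timeS (le_trans ih)// leeDl// ltW// hold_gt0.
Qed.

Lemma staying_inj m n t w : staying m t w -> staying n t w -> m = n.
Proof.
wlog mn : m n / (m <= n)%N.
  by move=> h; case: (leqP m n) => [|/ltnW] mn sm sn; [|apply/esym]; exact: h.
move=> /andP[_ tm] /andP[tn _]; apply/eqP; rewrite eqn_leq mn leqNgt.
apply/negP => nm; have := lt_le_trans tm (le_trans (jump_time_le w nm) tn).
by rewrite ltxx.
Qed.

Lemma state_inE t B : state_in X t B = \bigcup_n (skel_in n B `&` staying n t).
Proof.
apply/seteqP; split=> w.
  move=> [y By]; rewrite /state; case: xgetP => // _ -> [n sn <-] [sy].
  by exists n => //; split=> //; rewrite /(skel_in _ _)/= sy.
move=> [n _ [Bn sn]]; exists (skel X n w) => //.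
apply: xget_unique; first by exists n.
by move=> _ [m sm <-]; rewrite (staying_inj sm sn).
Qed.

Lemma measurable_state_in t B : measurable (state_in X t B).
Proof.
by rewrite state_inE; apply: bigcup_measurable => n _; exact: measurableI.
Qed.

Lemma law_state_in x t B :
  law X x (state_in X t B) = \sum_(n <oo) law X x (skel_in n B `&` staying n t).
Proof.
rewrite state_inE measure_semi_bigcup//.
- by move=> n; exact: measurableI.
- by move=> m n _ _ [w [[_ sm] [_ sn]]]; exact: staying_inj sm sn.
- by apply: bigcup_measurable => n _; exact: measurableI.
Qed.

Lemma law_state_in_esum x t B : countable B ->
  law X x (state_in X t B) = \esum_(w in B) law X x (state_in X t [set w]).
Proof.
move=> cB; rewrite -measure_bigcup_esum//; last 2 first.
- by move=> w; exact: measurable_state_in.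
- move=> i j _ _ [w [[_ -> ei] [_ -> ej]]]; by move: ei; rewrite ej => -[].
congr (law X x _); apply/seteqP; split=> w.
  by move=> [y By e]; exists y => //; exists y.
by move=> [y By [_ -> e]]; exists y.
Qed.

Variables (D : set E) (nxt : E -> seq E).
Hypothesis jc : jump_chain p q D nxt.

Section Existence.
Variable pi : probability E R.
Hypothesis sub_inv : forall w, D w ->
  \esum_(y in D) ((q y * p y w)%:E * pi [set y]) <= (q w)%:E * pi [set w].

(** The left side is a supremum over finite sets of initial states and over truncations of the
    number of jumps; each such piece is a [flow_from], bounded by [flow_le]. *)
Lemma invariant_le t w : (0 <= t)%R -> D w ->
  \int[pi]_(x in D) law X x (state_in X t [set w]) <= pi [set w].
Proof.
move=> t0 Dw; rewrite integral_discrete//; last exact: jc_countable jc.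
have pf y : pi [set y] \is a fin_num by exact: fin_num_measure.
apply: ge_ereal_sup => _ [F [finF FD] <-].
rewrite fsbig_finite//=; set L := fset_set F.
have LD : {in enum_fset L, forall x, D x}.
  by move=> x; rewrite in_fset_set// inE => /FD.
under eq_bigr do rewrite law_state_in muleC -(fineK (pf _)).
under eq_bigr do rewrite -nneseriesZl//.
rewrite -nneseries_sum; last by move=> x n _; rewrite mule_ge0// lee_fin fine_ge0.
apply: lime_le.
  apply: is_cvg_nneseries => n _ _; rewrite sume_ge0// => x _.
  by rewrite mule_ge0// lee_fin fine_ge0.
apply: nearW => n.
have := @flow_le R dE E A d Omega X mE D nxt jc (fun x => fine (pi [set x]))
  (enum_fset L) _ (fset_uniq _) LD _ n t w t0 Dw.
rewrite fineK//.
rewrite (_ : flow_from _ _ _ _ _ _ = \sum_(0 <= i < n) \sum_(x <- enum_fset L)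
   (fine (pi [set x]))%:E * law X x (skel_in i [set w] `&` staying i t)).
  apply; first by move=> x; rewrite fine_ge0.
  move=> v Dv; rewrite EFinM fineK//.
  by under eq_esum do rewrite EFinM fineK//; exact: sub_inv.
rewrite exchange_big/=; apply: eq_bigr => x _.
by rewrite ge0_sume_distrr//= big_mkord.
Qed.

Hypothesis pD : pi D = 1.
Hypothesis conservative : forall t x, (0 <= t)%R -> D x ->
  law X x (state_in X t D) = 1.

Lemma invariant_probability_sub : invariant_probability X D pi.
Proof.
have cD : countable D by exact: jc_countable jc.
have pDm : (pi : {measure set E -> \bar R}) D = 1 by exact: pD.
split=> // t t0 B mB BD.
have cB : countable B by exact: sub_countable (subset_card_le BD) cD.
have esum_law C : C `<=` D -> \int[pi]_(x in D) law X x (state_in X t C) =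
    \esum_(w in C) \int[pi]_(x in D) law X x (state_in X t [set w]).
  move=> CD; have cC : countable C by exact: sub_countable (subset_card_le CD) cD.
  rewrite integral_discrete//.
  under [RHS]eq_esum do rewrite integral_discrete//.
  rewrite esum_exchange; last by move=> w x _ _; rewrite mule_ge0.
  apply: eq_esum => x Dx.
  have pf : (pi : {measure set E -> \bar R}) [set x] \is a fin_num
    by exact: fin_num_measure.
  rewrite -(fineK pf); under [RHS]eq_esum do rewrite muleC.
  by rewrite esumZl ?fine_ge0// law_state_in_esum// muleC.
have e : forall w, D w ->
    \int[pi]_(x in D) law X x (state_in X t [set w]) = pi [set w].
  apply: esum_eq_of_le.
  - by move=> w Dw; rewrite invariant_le// andbT integral_ge0.
  - rewrite -esum_law// -measure_discrete// pDm.
    rewrite (eq_integral (cst 1)); first by rewrite integral_cst// mul1e pDm.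
    by move=> x /[!inE] Dx; rewrite conservative.
  - by rewrite -measure_discrete// pDm ltry.
rewrite esum_law// (measure_discrete mE)//.
by apply: eq_esum => w Bw; rewrite e//; exact: BD.
Qed.

End Existence.

Lemma invariant_probability_unique (pi pi' : probability E R) (z : E) : D z ->
  (forall x, D x -> law X x (state_in X 1 D) = 1) ->
  (forall x, D x -> 0 < law X x (state_in X 1 [set z])) ->
  invariant_probability X D pi -> invariant_probability X D pi' ->
  forall B, measurable B -> pi B = pi' B.
Proof.
move=> Dz cons pos [pD inv] [pD' inv'] B mB.
have cD : countable D by exact: jc_countable jc.
have e x : D x -> pi [set x] = pi' [set x].
  apply: (@kernel_unique R E D (fun x y => law X x (state_in X 1 [set y])) z
    (fun x => pi [set x]) (fun x => pi' [set x])) => //.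
  - by move=> y Dy; rewrite -law_state_in_esum// cons.
  - move=> y Dy; under eq_esum do rewrite muleC.
    by rewrite -integral_discrete// inv// => _ ->.
  - move=> y Dy; under eq_esum do rewrite muleC.
    by rewrite -integral_discrete// inv'// => _ ->.
  - by rewrite -measure_discrete.
  - by rewrite -measure_discrete.
(* [B] may be uncountable, whereas sums over atoms need a countable set; both probabilities are
   carried by [D]. *)
have restr (mu : probability E R) : mu D = 1 -> mu B = mu (B `&` D).
  move=> muD; rewrite -[in LHS](setIT B) -(setUv D) setIUr measureU//; last first.
    by rewrite setIACA setICr setI0.
  rewrite [X in _ + X](_ : _ = 0) ?adde0//.
  have muC : mu (~` D) = 0 by rewrite probability_setC// muD subee.
  by apply: subset_measure0 muC.
rewrite (restr pi)// (restr pi')// !(measure_discrete mE).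
- by apply: eq_esum => x [_ Dx]; exact: e.
- by apply: sub_countable cD; apply: subset_card_le; exact: subIsetr.
- by apply: sub_countable cD; apply: subset_card_le; exact: subIsetr.
Qed.

End Invariant.

(** * Recurrence *)

Section Visits.
Context (R : realType) dE (E : measurableType dE) (A : (E -> R) -> E -> R)
  d (Omega : measurableType d) (X : jump_process A Omega).
Hypothesis mE : forall B : set E, measurable B.
Local Notation q := (exit_rate A).
Local Notation p := (jump_prob A).
Local Open Scope ereal_scope.
Local Notation skel_in := (skel_in X).
Local Notation hold_gt := (hold_gt X).
Local Notation past := (past X).
Local Notation J := (jump_time X).
Local Notation jumped := (jumped X).
Local Notation staying := (staying X).
Hint Extern 0 (measurable (skel_in _ _)) => by apply: measurable_skel_in : core.
Hint Extern 0 (measurable (hold_gt _ _)) => exact: measurable_hold_gt : core.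
Hint Extern 0 (measurable (jumped _ _)) => exact: measurable_jumped : core.
Hint Extern 0 (measurable (staying _ _)) => exact: measurable_staying : core.

Variables (D : set E) (nxt : E -> seq E).
Hypothesis jc : jump_chain p q D nxt.

Lemma law_setD x (B C : set Omega) : measurable B -> measurable C ->
  law X x (B `\` C) = law X x B - law X x (B `&` C).
Proof.
by move=> mB mC; rewrite measureD// (le_lt_trans (probability_le1 _ _)) ?ltry.
Qed.

Lemma law_short_step x n B y w s : D x -> past n B -> D y -> (0 <= s)%R ->
  law X x (B `&` skel_in n [set y] `&` skel_in n.+1 [set w] `&` ~` hold_gt n s) =
  law X x (B `&` skel_in n [set y]) * (p y w * (1 - expR (- q y * s)))%:E.
Proof.
move=> Dx pB Dy s0; set M := B `&` skel_in n [set y] `&` skel_in n.+1 [set w].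
have mB := past_measurable pB.
have mM : measurable M by do 2 apply: measurableI => //.
have PM : law X x M = law X x (B `&` skel_in n [set y]) * (p y w)%:E.
  by rewrite (law_next mE jc).
have Pfin : law X x (B `&` skel_in n [set y]) \is a fin_num.
  by rewrite fin_num_measure//; exact: measurableI.
rewrite -setDE law_setD// PM (law_step mE jc)// -(fineK Pfin) -!EFinM -EFinB;
  congr EFin; ring.
Qed.

Variable z : E.

(** Step [n] is not a stay longer than 1 at [z]. The positive lower bound makes infinitely many such
    stays add up to infinite time, which serves both non-explosion and the occupation time. *)
Definition miss n : set Omega := ~` (skel_in n [set z] `&` hold_gt n 1).
Definition miss_from m n : set Omega :=
  [set w | forall i, (m <= i)%N -> (i < m + n)%N -> miss i w].

Lemma miss_fromS m n : miss_from m n.+1 = miss m `&` miss_from m.+1 n.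
Proof.
apply/seteqP; split=> w.
  move=> h; split; first by apply: h => //; rewrite addnS ltnS leq_addr.
  by move=> i mi ilt; apply: h; [exact: ltnW|rewrite addnS -addSn].
move=> [hm h] i; rewrite leq_eqVlt => /predU1P[<-//|mi] ilt.
by apply: h => //; rewrite addSn -addnS.
Qed.

Lemma miss_from0 m : miss_from m 0 = setT.
Proof.
by apply/seteqP; split=> // w _ i mi; rewrite addn0 ltnNge mi.
Qed.

Lemma measurable_miss n : measurable (miss n).
Proof. by apply: measurableC; exact: measurableI. Qed.

Lemma measurable_miss_from m n : measurable (miss_from m n).
Proof.
elim: n m => [|n ih] m; first by rewrite miss_from0.
by rewrite miss_fromS; apply: measurableI => //; exact: measurable_miss.
Qed.

Hint Resolve measurable_miss measurable_miss_from : core.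

(** The probability that a visit to [y] is not a long stay at [z]. It is 0 at [z] when [z] is
    absorbing. *)
Definition damp (y : E) : R := if y == z then (1 - expR (- q z))%R else 1%R.

Fixpoint miss_prob n (y : E) : R :=
  if n is m.+1 then (damp y * \sum_(w <- nxt y) p y w * miss_prob m w)%R else 1%R.

Lemma law_miss_step x m B y w : D x -> past m B -> D y ->
  law X x (B `&` skel_in m [set y] `&` miss m `&` skel_in m.+1 [set w]) =
  law X x (B `&` skel_in m [set y]) * (p y w * damp y)%:E.
Proof.
move=> Dx pB Dy; rewrite /damp; case: eqP => [yz|/eqP yz].
  subst y; have := @law_short_step x m B z w 1%R Dx pB Dy ler01.
  rewrite mulr1 => <-; congr (law X x _); apply/seteqP; split=> v.
    by move=> [[[Bv sv] mv] sw]; split=> // hv; apply: mv.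
  by move=> [[[Bv sv] sw] hv]; split=> //; split=> // -[].
rewrite mulr1 -(law_next mE jc)//; congr (law X x _); congr (_ `&` _).
apply: setIidl => v [_ sv] [sz _]; move/eqP : yz; apply.
by rewrite -sv -sz.
Qed.

Lemma law_miss_from x m n B y : D x -> past m B -> D y ->
  law X x (B `&` skel_in m [set y] `&` miss_from m n) =
  law X x (B `&` skel_in m [set y]) * (miss_prob n y)%:E.
Proof.
move=> Dx; elim: n m B y => [|n ih] m B y pB Dy.
  by rewrite miss_from0 setIT mule1.
have mB := past_measurable pB.
(* [miss m] involves holding time [m], which belongs to the past only from [m.+1] on; the induction
   is therefore over all past events [B]. *)
have pM : past m.+1 (B `&` skel_in m [set y] `&` miss m).
  apply: pastI.
    by apply: pastI; [exact: pastW|apply: past_skel].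
  by apply: pastC; apply: pastI; [exact: past_skel|exact: past_hold].
rewrite miss_fromS (law_sum_next mE jc)//; last exact: measurableI.
transitivity (\sum_(w <- nxt y) law X x (B `&` skel_in m [set y]) *
    (p y w * damp y * miss_prob n w)%:E).
  rewrite big_seq [RHS]big_seq; apply: eq_bigr => w wy.
  rewrite EFinM muleA -law_miss_step// -ih//; last exact: jc_next jc _ _ Dy wy.
  congr (law X x _); rewrite setIA; congr (_ `&` _).
  by rewrite setIAC.
have Pfin : law X x (B `&` skel_in m [set y]) \is a fin_num.
  by rewrite fin_num_measure//; exact: measurableI.
rewrite -(fineK Pfin); under eq_bigr do rewrite -EFinM.
rewrite sumEFin -EFinM; congr EFin; rewrite /= !mulr_sumr.
by apply: eq_bigr => w _; ring.
Qed.

Hypothesis miss_cvg0 : forall y e, D y -> (0 < e)%R -> exists n, (miss_prob n y < e)%R.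

Lemma law_miss_forever x m : D x -> law X x (\bigcap_n miss_from m n) = 0.
Proof.
move=> Dx; set N := \bigcap_n _.
have mN : measurable N by apply: bigcap_measurableType => n _.
rewrite (measure_skel_esum (X := X) mE jc (n := m) mN (law_out X mE jc m Dx)).
apply: esum1 => y Dy; apply/eqP; rewrite eq_le measure_ge0 andbT.
apply/lee_addgt0Pr => e e0; rewrite add0e.
have [n hn] := miss_cvg0 Dy e0.
apply: (@le_trans _ _ (law X x (setT `&` skel_in m [set y] `&` miss_from m n))).
  apply: le_measure; rewrite ?inE; [exact: measurableI|do 2 apply: measurableI => //|].
  by rewrite setTI setIC; apply: setIS => w; exact.
rewrite law_miss_from//; last exact: pastT.
have P1 : law X x (setT `&` skel_in m [set y]) <= 1.
  by apply: probability_le1; exact: measurableI.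
have [m0|m0] := leP 0%R (miss_prob n y).
  apply: (@le_trans _ _ (1 * (miss_prob n y)%:E)); first by rewrite lee_wpmul2r.
  by rewrite mul1e lee_fin ltW.
apply: (@le_trans _ _ 0); last by rewrite lee_fin ltW.
by rewrite mule_ge0_le0// lee_fin ltW.
Qed.

(** Reachability of [z] from every state of [D], phrased through sets closed under jumps: it is used
    as an induction principle, without any notion of path. *)
Hypothesis hitz : forall (Q : set E) x, D x -> Q x ->
  (forall a b, D a -> Q a -> (0 < p a b)%R -> Q b) -> Q z.

(** If [y] were absorbing, the set of [y] alone would be closed under jumps and could not contain
    [z]. *)
Lemma rate_gt0 y : D y -> y != z -> (0 < q y)%R.
Proof.
move=> Dy yz; rewrite lt_neqAle (jc_rate jc)// andbT eq_sym; apply: contra yz => q0.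
rewrite eq_sym; apply/eqP; apply: (hitz (Q := [set y]) Dy) => // a b _ ->.
by rewrite /jump_prob q0; case: eqP => [->//|_]; rewrite ltxx.
Qed.

Lemma law_hold_infinite x n : D x ->
  law X x (skel_in n (~` [set z]) `&` hold X n @^-1` [set +oo]) = 0.
Proof.
move=> Dx; set N := _ `&` _.
have mN : measurable N.
  by apply: measurableI => //; rewrite -[X in measurable X]setTI;
    exact: measurable_hold.
rewrite (measure_skel_esum (X := X) mE jc (n := n) mN (law_out X mE jc n Dx)).
apply: esum1 => y Dy; have [yz|yz] := eqVneq y z.
  rewrite (_ : _ `&` _ = set0) ?measure0//; rewrite -subset0 => w [[h _] e].
  by apply: h; rewrite -yz; exact: e.
have q0 := rate_gt0 Dy yz.
apply/eqP; rewrite eq_le measure_ge0 andbT; apply/lee_addgt0Pr => e e0; rewrite add0e.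
(* Chosen so that [expR (- q y * s) <= e]; the maximum with 0 takes care of [e > 1]. *)
pose s := Num.max 0%R (- ln e / q y)%R.
have s0 : (0 <= s)%R by rewrite /s le_max lexx.
apply: (@le_trans _ _ (law X x (setT `&` skel_in n [set y] `&` hold_gt n s))).
  apply: le_measure; rewrite ?inE; [exact: measurableI|do 2 apply: measurableI => //|].
  move=> w [[_ h] sw]; split=> //; rewrite /(hold_gt _ _)/= h ltry//.
rewrite (law_hold mE jc)//; last exact: pastT.
apply: (@le_trans _ _ (1 * (expR (- q y * s))%:E)).
  by rewrite lee_wpmul2r ?lee_fin ?expR_ge0//; apply: probability_le1;
    exact: measurableI.
rewrite mul1e lee_fin -[leRHS](lnK e0) ler_expR mulNr lerNl.
by rewrite -ler_pdivrMl// mulrC le_max lexx orbT.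
Qed.

(* Almost surely, the walk makes infinitely many stays of length more than 1 at
   z, and every infinite stay happens at z. *)
Definition good : set Omega :=
  (\bigcap_m ~` (\bigcap_n miss_from m n)) `&`
  (\bigcap_n ~` (skel_in n (~` [set z]) `&` hold X n @^-1` [set +oo])).

Lemma ae_good x : D x -> {ae law X x, forall w, good w}.
Proof.
move=> Dx.
have n1 : (law X x).-negligible (\bigcup_m \bigcap_n miss_from m n).
  apply: negligible_bigcup => m; exists (\bigcap_n miss_from m n); split=> //.
    by apply: bigcap_measurableType => n _.
  exact: law_miss_forever.
have n2 : (law X x).-negligible
    (\bigcup_n (skel_in n (~` [set z]) `&` hold X n @^-1` [set +oo])).
  apply: negligible_bigcup => n.
  exists (skel_in n (~` [set z]) `&` hold X n @^-1` [set +oo]); split=> //.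
    apply: measurableI => //; rewrite -[X in measurable X]setTI; exact: measurable_hold.
  exact: law_hold_infinite.
have := negligibleU n1 n2; apply: negligibleS => w; rewrite /good /= => h.
apply: contrapT => h'; apply: h; split=> n _ hn; apply: h'; [left|right]; by exists n.
Qed.

Lemma good_visits w m : good w ->
  exists2 i, (m <= i)%N & skel X i w = z /\ 1 < hold X i w.
Proof.
move=> [/(_ m I) h _]; apply: contrapT => h'; apply: h => n _ i mi _ [sz hz].
by apply: h'; exists i.
Qed.

Lemma good_hold w n : good w -> hold X n w = +oo -> skel X n w = z.
Proof.
move=> [_ /(_ n I) h] hn; apply: contrapT => h'; exact: h.
Qed.

Lemma good_jump_time_ge w k : good w -> exists n, k%:R%:E <= J n w.
Proof.
move=> gw; elim: k => [|k [n hn]]; first by exists 0%N; exact: jump_time_ge0.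
have [i ni [_ hi]] := good_visits n gw; exists i.+1.
rewrite jump_timeS -natr1 EFinD leeD//; last exact: ltW.
exact: le_trans hn (jump_time_le X w ni).
Qed.

Lemma good_cvg w : good w -> jump_time X ^~ w @ \oo --> +oo.
Proof.
move=> gw; apply/cvgeyPge => M;
  have [n hn] := good_jump_time_ge (Num.truncn `|M|).+1 gw.
near=> m; apply: (@le_trans _ _ (J n w)); last first.
  by apply: jump_time_le; near: m; exact: nbhs_infty_ge.
apply: le_trans hn; rewrite lee_fin (le_trans (ler_norm _))// ltW//.
by rewrite truncnS_gt.
Unshelve. all: by end_near. Qed.

Lemma non_explosive_of_visits : non_explosive X D.
Proof.
move=> x Dx; apply: filterS (ae_good Dx) => w; exact: good_cvg.
Qed.

Lemma good_staying w t : good w -> (0 <= t)%R -> exists n, staying n t w.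
Proof.
move=> gw t0.
have [n hn] := good_jump_time_ge (Num.truncn t).+1 gw.
have ex : exists n, t%:E < J n w.
  by exists n; apply: lt_le_trans hn; rewrite lte_fin truncnS_gt.
case: (ex_minnP ex) => -[|m]; first by rewrite jump_time0 lte_fin ltNge t0.
move=> hm min; exists m; rewrite /(staying _ _)/= hm andbT leNgt; apply/negP => /min.
by rewrite ltnn.
Qed.

Lemma conservative t x : (0 <= t)%R -> D x -> law X x (state_in X t D) = 1.
Proof.
move=> t0 Dx; have mS := measurable_state_in X mE t D.
have h : law X x (~` state_in X t D) = 0.
  have n3 : (law X x).-negligible (\bigcup_n skel_in n (~` D)).
    apply: negligible_bigcup => n; exists (skel_in n (~` D)); split=> //.
    exact: (law_out X mE jc).
  have : (law X x).-negligible (~` state_in X t D).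
    have := negligibleU (ae_good Dx) n3; apply: negligibleS => w; rewrite state_inE.
    move=> h; have [gw|] := pselect (good w); last by left.
    have [n sn] := good_staying gw t0; right; exists n => //.
    by move=> Dn; apply: h; exists n.
  by move/(negligibleP _ (measurableC mS)).
have := probability_setC (law X x) mS; rewrite h => /eqP.
rewrite eq_sym sube_eq ?fin_num_adde_defl ?fin_num_measure//.
by rewrite add0e => /eqP <-.
Qed.

(** The times spent in [B] are the disjoint union of the intervals [I n]. Infinitely many of them
    come from stays at [z] longer than 1, unless an infinite stay ends the trajectory. *)
Lemma good_occupation w (B : set E) : B z -> good w -> occupation_time X B w = +oo.
Proof.
move=> Bz gw; rewrite /occupation_time.
pose I n : set R := [set t : R | B (skel X n w) /\ J n w <= t%:E < J n.+1 w].
have mI n : measurable (I n).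
  rewrite /I; have [Bn|nB] := pselect (B (skel X n w)); last first.
    by rewrite (_ : [set _ | _] = set0)//; apply/seteqP; split=> // t [].
  rewrite (_ : [set _ | _] = EFin @^-1` `[J n w, J n.+1 w[); last first.
    by apply/seteqP; split=> t /=; rewrite in_itv/=; [case|split].
  rewrite -[X in measurable X]setTI; apply: EFin_measurable => //.
  exact: emeasurable_itv.
have tI : trivIset setT I.
  by move=> m n _ _ [t [[_ sm] [_ sn]]]; exact: staying_inj sm sn.
have -> : [set t | (0 <= t)%R /\ state_in X t B w] = \bigcup_n I n.
  apply/seteqP; split=> t.
    by move=> [t0]; rewrite state_inE => -[n _ [Bn sn]]; exists n.
  move=> [n _ [Bn sn]]; split; last by rewrite state_inE; exists n.
  by move: sn => /andP[Jt _]; rewrite -lee_fin (le_trans _ Jt)// jump_time_ge0.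
rewrite measure_semi_bigcup//; last by apply: bigcup_measurable => n _; exact: mI.
apply/eqP; rewrite -leye_eq leNgt; apply/negP => hfin.
(* If some jump time is infinite, the first such index has an infinite holding time before it; by
   [good_hold] that stay is at [z], and [I n] is a half-line. *)
have [fin|inf] := pselect (forall n, J n w < +oo); last first.
  have [n Jn Jn1] : exists2 n, J n w < +oo & J n.+1 w = +oo.
    have ex : exists n, J n w == +oo.
      apply: contrapT => h; apply: inf => n; rewrite ltey; apply/negP => hn.
      by apply: h; exists n.
    case: (ex_minnP ex) => -[|m]; first by rewrite jump_time0.
    move=> /eqP hm min; exists m => //; rewrite ltey; apply/negP => /min.
    by rewrite ltnn.
  have hn : hold X n w = +oo.
    move: Jn1; rewrite jump_timeS; move: Jn (jump_time_ge0 X n w).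
    by case: (J n w) => // r _ _; case: (hold X n w).
  have Bn : B (skel X n w) by rewrite (good_hold gw hn).
  have Jfin : J n w \is a fin_num by rewrite ge0_fin_numE// jump_time_ge0.
  have le : lebesgue_measure (I n) <= \sum_(0 <= i <oo) lebesgue_measure (I i).
    rewrite (nneseriesD1 (n := n))//; first by rewrite leeDl// nneseries_ge0.
  have : lebesgue_measure (I n) = +oo.
    have -> : I n = `[fine (J n w), +oo[%classic.
      apply/seteqP; split=> t; rewrite /I/= in_itv/= andbT -lee_fin fineK//
        Jn1 ltry andbT.
        by case.
      by split.
    by rewrite lebesgue_measure_itv/= ltry.
  by move=> e; move: (le_lt_trans le hfin); rewrite e ltxx.
have [c hc] : exists k : nat, \sum_(0 <= i <oo) lebesgue_measure (I i) < k%:R%:E.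
  have s0 : 0 <= \sum_(0 <= i <oo) lebesgue_measure (I i) by exact: nneseries_ge0.
  exists (Num.truncn (fine (\sum_(0 <= i <oo) lebesgue_measure (I i)))).+1.
  by rewrite -[ltLHS]fineK ?ge0_fin_numE// lte_fin truncnS_gt.
suff [n hn] : exists n, c%:R%:E <= \sum_(0 <= i < n) lebesgue_measure (I i).
  have le : \sum_(0 <= i < n) lebesgue_measure (I i) <=
      \sum_(0 <= i <oo) lebesgue_measure (I i) by exact: nneseries_lim_ge.
  by have := le_lt_trans (le_trans hn le) hc; rewrite ltxx.
elim: {hc} c => [|c [n hn]]; first by exists 0%N; rewrite big_geq.
have [i ni [sz hi]] := good_visits n gw; exists i.+1.
rewrite big_nat_recr//= -natr1 EFinD leeD//.
  apply: le_trans hn _; rewrite (big_cat_nat _ ni)//= leeDl//.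
  by rewrite sume_ge0.
have Jfin : J i w \is a fin_num by rewrite ge0_fin_numE ?fin// jump_time_ge0.
have J1fin : J i.+1 w \is a fin_num by rewrite ge0_fin_numE ?fin// jump_time_ge0.
have -> : I i = `[fine (J i w), fine (J i.+1 w)[%classic.
  apply/seteqP; split=> t; rewrite /I/= in_itv/= -lee_fin -lte_fin !fineK//.
    by case.
  by split=> //; rewrite sz.
rewrite lebesgue_measure_itv/= lte_fin fine_lt//; last first.
  by rewrite jump_timeS lteDl// hold_gt0.
by rewrite EFinN !fineK// jump_timeS addeAC subee// add0e ltW.
Qed.

Lemma recurrent_of_visits : D z -> recurrent X D.
Proof.
move=> Dz; exists (\d_z : {sigma_finite_measure set E -> \bar R}).
split; first by rewrite /= diracE mem_set.
move=> B mB BD; rewrite /= diracE lte_fin ltr0n lt0b => /set_mem Bz x Dx.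
by apply: filterS (ae_good Dx) => w; exact: good_occupation.
Qed.

(** The bound 1 matches the time at which uniqueness uses the semigroup. It is strict to leave room
    for one more jump in [early_reach]. *)
Definition early n : set Omega := [set w | J n w < 1].

Lemma early_bigcup n : early n = \bigcup_k jumped n (1 - k.+1%:R^-1).
Proof.
apply/seteqP; split=> w; rewrite /early /=; last first.
  by move=> [k _]; rewrite /(jumped _ _)/= => /le_lt_trans; apply;
    rewrite lte_fin ltrBlDr ltrDl.
move=> h; have J0 := jump_time_ge0 X n w.
have Jfin : J n w \is a fin_num by rewrite ge0_fin_numE// (lt_trans h)// ltry.
have h1 : (fine (J n w) < 1)%R by rewrite -lte_fin fineK.
have [k hk] := ltr_add_invr h1.
by exists k => //; rewrite /(jumped _ _)/= -(fineK Jfin) lee_fin lerBrDr ltW.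
Qed.

Lemma measurable_early n : measurable (early n).
Proof. by rewrite early_bigcup; apply: bigcup_measurable. Qed.

Lemma early_reach x y : D x ->
  (forall Q : set E, Q x ->
    (forall a b, D a -> Q a -> (0 < p a b)%R -> Q b) -> Q y) ->
  D y /\ exists n, 0 < law X x (skel_in n [set y] `&` early n).
Proof.
move=> Dx hy.
apply: (hy [set y | D y /\ exists n, 0 < law X x (skel_in n [set y] `&` early n)]).
  split=> //; exists 0%N; rewrite (_ : early 0 = setT) ?setIT ?law_skel0//.
  by apply/seteqP; split=> // w _; rewrite /early/= jump_time0.
move=> a b Da [_ [n hn]] pab.
have Db : D b.
  have [bn|bn] := boolP (b \in nxt a); first exact: (jc_next jc Da bn).
  by move: pab; rewrite (jc_out jc Da bn) ltxx.
split=> //; have [q0|q0] := eqVneq (q a) 0%R.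
  exists n; move: pab; rewrite /jump_prob q0 eqxx; case: eqP => [<-//|_].
  by rewrite ltxx.
have qa : (0 < q a)%R by rewrite lt_neqAle eq_sym q0 (jc_rate jc).
have [k hk] : exists k, 0 < law X x (skel_in n [set a] `&` jumped n (1 - k.+1%:R^-1)).
  apply: contrapT => h; move: hn; rewrite early_bigcup setI_bigcupr.
  rewrite (_ : law X x _ = 0) ?ltxx//; apply/eqP; rewrite eq_le measure_ge0 andbT.
  apply: le_trans (generalized_Boole_inequality _ _ _) _.
  - by move=> k; exact: measurableI.
  - by apply: bigcup_measurable => k _; exact: measurableI.
  rewrite eseries0// => k _ _; apply/eqP; rewrite eq_le measure_ge0 andbT leNgt.
  by apply/negP => hk; apply: h; exists k.
(* The slack before time 1 is at least [k.+1%:R^-1]; a holding time of at most half of it has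
   positive probability because [q a > 0]. *)
exists n.+1; pose s : R := (k.+1%:R^-1 / 2)%R.
have s0 : (0 < s)%R by rewrite divr_gt0.
have := law_short_step b Dx (past_jumped X n (1 - k.+1%:R^-1)) Da (ltW s0).
rewrite (setIC (jumped _ _)) => e.
apply: (@lt_le_trans _ _ (law X x (skel_in n [set a] `&` jumped n (1 - k.+1%:R^-1)
   `&` skel_in n.+1 [set b] `&` ~` hold_gt n s))).
  rewrite e mule_gt0// lte_fin mulr_gt0// subr_gt0 -expR0 ltr_expR.
  by rewrite mulNr oppr_lt0 mulr_gt0.
apply: le_measure; rewrite ?inE.
- by apply: measurableI; [do 2 apply: measurableI => //|exact: measurableC].
- by apply: measurableI => //; exact: measurable_early.
move=> w [[[_ jw] sw] hw]; split=> //; rewrite /early/= jump_timeS.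
move: jw hw; rewrite /(jumped _ _) /(hold_gt _ _) /= => jw /negP; rewrite -leNgt => hw.
apply: le_lt_trans (leeD jw hw) _; rewrite -EFinD lte_fin.
have : (0 < k.+1%:R^-1 :> R)%R by [].
by rewrite /s; move: (_^-1)%R => v v0; lra.
Qed.

Lemma law_state1_gt0 x : D x -> D z -> 0 < law X x (state_in X 1 [set z]).
Proof.
move=> Dx Dz; have [|_ [n hn]] := @early_reach x z Dx.
  by move=> Q Qx hQ; exact: (hitz Dx Qx hQ).
have pe : past n (early n).
  by rewrite early_bigcup; apply: past_bigcup => k; exact: past_jumped.
apply: (@lt_le_trans _ _ (law X x (early n `&` skel_in n [set z] `&` hold_gt n 1))).
  rewrite (law_hold mE jc)// mule_gt0//; first by rewrite setIC.
  by rewrite lte_fin expR_gt0.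
apply: le_measure; rewrite ?inE.
- by do 2 apply: measurableI => //; exact: measurable_early.
- exact: measurable_state_in.
move=> w [[ew sw] hw]; rewrite state_inE; exists n => //; split=> //.
rewrite /(staying _ _)/= jump_timeS (ltW ew)/=.
by apply: (lt_le_trans hw); rewrite leeDr// jump_time_ge0.
Qed.

Lemma attainable_sub x : D x -> attainable X x `<=` D.
Proof.
move=> Dx y hy; apply: contrapT => nDy; move: hy; rewrite /attainable/=.
set U := \bigcup_(t in _) _.
have : (law X x).-negligible U.
  have n3 : (law X x).-negligible (\bigcup_n skel_in n (~` D)).
    apply: negligible_bigcup => n; exists (skel_in n (~` D)); split=> //.
    exact: (law_out X mE jc).
  apply: negligibleS n3 => w [t _]; rewrite state_inE => -[n _ [sw _]].
  by exists n => //; rewrite /(skel_in _ _)/= sw.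
suff mU : measurable U by move/(negligibleP _ mU) => ->; rewrite ltxx.
(* An uncountable union over times becomes a countable one over jumps: [y] is occupied at some time
   exactly when it is the state after some finite jump time. *)
rewrite (_ : U = \bigcup_n (skel_in n [set y] `&` [set w | J n w < +oo])).
  apply: bigcup_measurable => n _; apply: measurableI => //.
  rewrite -[X in measurable X]setTI.
  exact: (measurable_lte measurableT (measurable_jump_time X n) (measurable_cst +oo)).
apply/seteqP; split=> w.
  move=> [t _]; rewrite state_inE => -[n _ [sw /andP[Jt _]]]; exists n => //.
  by split=> //=; rewrite (le_lt_trans Jt)// ltry.
move=> [n _ [sw Jn]]; have J0 := jump_time_ge0 X n w.
have Jfin : J n w \is a fin_num by rewrite ge0_fin_numE.
exists (fine (J n w)); first by rewrite /= in_itv/= andbT fine_ge0.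
rewrite state_inE; exists n => //; split=> //.
by rewrite /(staying _ _)/= fineK// lexx/= jump_timeS lteDl// hold_gt0.
Qed.

Lemma sub_attainable x y : D x ->
  (forall Q : set E, Q x ->
    (forall a b, D a -> Q a -> (0 < p a b)%R -> Q b) -> Q y) ->
  attainable X x y.
Proof.
move=> Dx hy; have [_ [n hn]] := early_reach Dx hy; apply: lt_le_trans hn _.
set U := \bigcup_(t in _) _.
have sub : skel_in n [set y] `&` early n `<=` U.
  move=> w [sw Jn]; have J0 := jump_time_ge0 X n w.
  have Jfin : J n w \is a fin_num by rewrite ge0_fin_numE// (lt_trans Jn)// ltry.
  exists (fine (J n w)); first by rewrite /= in_itv/= andbT fine_ge0.
  rewrite state_inE; exists n => //; split=> //.
  by rewrite /(staying _ _)/= fineK// lexx/= jump_timeS lteDl// hold_gt0.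
apply: le_measure => //; rewrite inE.
  by apply: measurableI => //; exact: measurable_early.
rewrite (_ : U = \bigcup_n (skel_in n [set y] `&` [set w | J n w < +oo])).
  apply: bigcup_measurable => m _; apply: measurableI => //.
  rewrite -[X in measurable X]setTI.
  exact: (measurable_lte measurableT (measurable_jump_time X m) (measurable_cst +oo)).
apply/seteqP; split=> w.
  move=> [t _]; rewrite state_inE => -[m _ [sw /andP[Jt _]]]; exists m => //.
  by split=> //=; rewrite (le_lt_trans Jt)// ltry.
move=> [m _ [sw Jn]]; have J0 := jump_time_ge0 X m w.
have Jfin : J m w \is a fin_num by rewrite ge0_fin_numE.
exists (fine (J m w)); first by rewrite /= in_itv/= andbT fine_ge0.
rewrite state_inE; exists m => //; split=> //.
by rewrite /(staying _ _)/= fineK// lexx/= jump_timeS lteDl// hold_gt0.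
Qed.

End Visits.

(** * Lyapunov functions *)

Section FiniteMax.
Context (R : realDomainType) (E : choiceType).

Lemma seq_argmax (h : E -> R) (s : seq E) : s != [::] ->
  exists2 x, x \in s & forall y, y \in s -> h y <= h x.
Proof.
elim: s => // a s ih _; have [->|/ih[x xs hx]] := eqVneq s [::].
  by exists a; rewrite ?mem_head// => y; rewrite inE => /eqP ->.
have [ax|xa] := leP (h a) (h x).
  exists x; first by rewrite inE xs orbT.
  by move=> y; rewrite inE => /predU1P[->//|]; exact: hx.
exists a; first by rewrite mem_head.
by move=> y; rewrite inE => /predU1P[->//|/hx/le_trans]; apply; exact: ltW.
Qed.

Lemma finite_argmax (h : E -> R) (F : set E) : finite_set F -> F !=set0 ->
  exists2 x, F x & forall y, F y -> h y <= h x.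
Proof.
move=> finF [a Fa]; have [|x xF hx] := @seq_argmax h (enum_fset (fset_set F)).
  have : a \in enum_fset (fset_set F) by rewrite in_fset_set// mem_set.
  by case: (enum_fset _).
exists x; first by move: xF; rewrite in_fset_set// inE.
by move=> y Fy; apply: hx; rewrite in_fset_set// mem_set.
Qed.

End FiniteMax.

Section Lyapunov.
Context (R : realType) (E : choiceType) (p : E -> E -> R) (q : E -> R)
  (D : set E) (nxt : E -> seq E).
Hypothesis jc : jump_chain p q D nxt.
Hypothesis absorb : forall x y, D x -> q x = 0 -> p x y = (x == y)%:R.

Definition mean (h : E -> R) (x : E) : R := \sum_(y <- nxt x) p x y * h y.

Lemma mean_cst c x : D x -> mean (fun=> c) x = c.
Proof. by move=> Dx; rewrite /mean -mulr_suml (jc_sum jc)// mul1r. Qed.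

Lemma meanB h k x : mean (fun y => h y - k y) x = mean h x - mean k x.
Proof. by rewrite /mean -sumrB; apply: eq_bigr => y _; rewrite mulrBr. Qed.

Lemma meanZ c h x : mean (fun y => c * h y) x = c * mean h x.
Proof. by rewrite /mean mulr_sumr; apply: eq_bigr => y _; rewrite mulrCA. Qed.

Lemma le_mean h k x : D x -> (forall y, D y -> h y <= k y) -> mean h x <= mean k x.
Proof.
move=> Dx hk; rewrite /mean big_seq [leRHS]big_seq; apply: ler_sum => y yx.
by rewrite ler_wpM2l ?(jc_ge0 jc)// hk//; exact: (jc_next jc Dx yx).
Qed.

(** Maximum principle: the non-negative terms [p x v * (m - h v)] have a sum at most 0, so each of
    them vanishes. *)
Lemma mean_max (h : E -> R) m x y : D x -> (forall y, D y -> h y <= m) ->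
  m <= mean h x -> 0 < p x y -> h y = m.
Proof.
move=> Dx hm mx pxy; have yx : y \in nxt x.
  by apply: contraTT pxy => /(jc_out jc Dx) ->; rewrite ltxx.
have : mean (fun y => m - h y) x <= 0 by rewrite meanB mean_cst// subr_le0.
have t0 v : v \in nxt x -> 0 <= p x v * (m - h v).
  move=> vx; rewrite mulr_ge0 ?(jc_ge0 jc)// subr_ge0 hm//.
  exact: (jc_next jc Dx vx).
rewrite /mean (bigD1_seq y)//=; last exact: (jc_uniq jc).
move=> h0; have : p x y * (m - h y) <= 0.
  apply: le_trans h0; rewrite lerDl big_seq_cond sumr_ge0// => v /andP[vx _].
  exact: t0.
rewrite pmulr_rle0// subr_le0 => h1; apply/eqP; rewrite eq_le h1 andbT.
by rewrite hm//; exact: (jc_next jc Dx yx).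
Qed.

Variables (f : E -> R) (eps beta : R).
Hypothesis eps0 : 0 < eps.
Hypothesis beta0 : 0 <= beta.
Hypothesis f0 : forall x, D x -> 0 <= f x.
Hypothesis fproper : forall K, finite_set [set x | D x /\ f x <= K].
Hypothesis drift : forall x, D x -> q x * (mean f x - f x) <= beta - eps * f x.

Variable z : E.
Hypothesis Dz : D z.
Hypothesis hitz : forall (Q : set E) x, D x -> Q x ->
  (forall a b, D a -> Q a -> 0 < p a b -> Q b) -> Q z.

Lemma mean_absorbing h x : D x -> q x = 0 -> mean h x = h x.
Proof.
move=> Dx q0; rewrite -[RHS](mean_cst (h x) Dx) /mean; apply: eq_bigr => y _.
by rewrite absorb//; case: eqP => [->//|_]; rewrite !mul0r.
Qed.

Lemma mean_le_of_large x : D x -> beta / eps < f x -> mean f x <= f x.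
Proof.
move=> Dx fx; have [q0|q0] := eqVneq (q x) 0; first by rewrite mean_absorbing.
have qx : 0 < q x by rewrite lt_neqAle eq_sym q0 (jc_rate jc).
rewrite -subr_le0 -(pmulr_rle0 _ qx) (le_trans (drift Dx))//.
by rewrite subr_le0 mulrC -ler_pdivrMr// ltW.
Qed.

Section Subharmonic.
Variable g : E -> R.
Hypothesis g01 : forall x, D x -> 0 <= g x <= 1.
Hypothesis gsub : forall x, D x -> g x <= mean g x.

(* Off the finite set where the drift of f may be positive, g - e * f is
   subharmonic and tends to -oo, so it is maximal on that finite set or at z;
   then e tends to 0. *)
Lemma subharmonic_le_z x : D x -> g x <= g z.
Proof.
pose F := [set x | D x /\ f x <= beta / eps] `|` [set z].
have finF : finite_set F by rewrite finite_setU; split=> //; exact: finite_set1.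
have [x0 Fx0 hx0] := @finite_argmax R E g F finF (ex_intro _ z (or_intror erefl)).
have Dx0 : D x0 by case: Fx0 => [[]|->].
have gx0 : 0 <= g x0 by case/andP: (g01 Dx0).
have bound e y : 0 < e -> D y -> g y <= g x0 + e * f y.
  move=> e0 Dy; rewrite leNgt; apply/negP => hy.
  pose h y := g y - e * f y.
  (* Outside this finite set [e * f] exceeds [1 >= g], so [h] is negative there and its maximum over
     [L] is its maximum over [D]. *)
  pose L := [set y | D y /\ f y <= e^-1].
  have Ly : L y.
    split=> //; rewrite -[e^-1]mul1r ler_pdivlMr// mulrC.
    have : g y <= 1 by case/andP: (g01 Dy).
    by have := hy; lra.
  have [xs [Dxs _] hxs] := finite_argmax h (fproper e^-1) (ex_intro _ y Ly).
  have ms : g x0 < h xs by apply: lt_le_trans (hxs _ Ly); rewrite /h; lra.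
  have hmax v : D v -> h v <= h xs.
    move=> Dv; have [Lv|/negP nLv] := boolP (f v <= e^-1); first exact: hxs.
    apply: le_trans (ltW ms); apply: le_trans gx0.
    have gv : g v <= 1 by case/andP: (g01 Dv).
    move: nLv => /negP; rewrite -ltNge => nLv.
    have : 1 < e * f v by rewrite -ltr_pdivrMl// mulr1.
    by rewrite /h; lra.
  have : [set v | D v /\ h v = h xs] z.
    apply: (hitz (x := xs)) => // a b Da [_ ha] pab.
    have Db : D b.
      have [bn|/(jc_out jc Da) e'] := boolP (b \in nxt a).
        exact: (jc_next jc Da bn).
      by move: pab; rewrite e' ltxx.
    split=> //; apply: (mean_max (x := a)) => //.
    rewrite -ha /h meanB meanZ.
    (* A maximiser of [h] lies outside [F], where [h <= g <= g x0]; hence [f] has non-positive drift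
       at it and [h] is subharmonic there. *)
    have fa : beta / eps < f a.
      rewrite ltNge; apply/negP => fa; have := hx0 a (or_introl (conj Da fa)).
      have : 0 <= e * f a by rewrite mulr_ge0 ?f0// ltW.
      by move: ms; rewrite -ha /h; lra.
    have := gsub Da; have := mean_le_of_large Da fa.
    have : e * mean f a <= e * f a by rewrite ler_wpM2l ?mean_le_of_large// ltW.
    by lra.
  move=> [_ hz]; have := hx0 z (or_intror erefl).
  have : 0 <= e * f z by rewrite mulr_ge0 ?f0// ltW.
  by move: ms; rewrite -hz /h; lra.
have gmax y : D y -> g y <= g x0.
  move=> Dy; apply/ler_addgt0Pr => e e0.
  have fy := f0 Dy; have f1 : 0 < f y + 1 by rewrite ltr_wpDl.
  (* With this value in [bound], the error [e / (f y + 1) * f y] is at most [e]. *)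
  have e1 : 0 < e / (f y + 1) by rewrite divr_gt0.
  apply: le_trans (bound _ _ e1 Dy) _; rewrite lerD2l mulrAC.
  by rewrite ler_pdivrMr// ler_wpM2l ?ltW// ltrDl.
move=> Dx; suff -> : g z = g x0 by exact: gmax.
have : [set v | D v /\ g v = g x0] z.
  apply: (hitz (x := x0)) => // a b Da [_ ha] pab.
  have Db : D b.
    have [bn|/(jc_out jc Da) e'] := boolP (b \in nxt a).
      exact: (jc_next jc Da bn).
    by move: pab; rewrite e' ltxx.
  by split=> //; apply: (mean_max (x := a)) => //; rewrite -ha gsub.
by case.
Qed.

End Subharmonic.

Section Damped.
Variable damp : E -> R.
Hypothesis damp01 : forall x, D x -> 0 <= damp x <= 1.
Hypothesis damp_z : damp z < 1.

Fixpoint damped n (y : E) : R :=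
  if n is m.+1 then damp y * mean (damped m) y else 1.

Lemma damped01 n y : D y -> 0 <= damped n y <= 1.
Proof.
elim: n y => [|n ih] y Dy /=; first by rewrite ler01 lexx.
have m0 : 0 <= mean (damped n) y.
  by rewrite -[leLHS](mean_cst 0 Dy); apply: le_mean => // v /ih/andP[].
have m1 : mean (damped n) y <= 1.
  by rewrite -[leRHS](mean_cst 1 Dy); apply: le_mean => // v /ih/andP[].
have /andP[d0 d1] := damp01 Dy.
by rewrite mulr_ge0//= mulr_ile1.
Qed.

Lemma damped_nonincreasing n y : D y -> damped n.+1 y <= damped n y.
Proof.
elim: n y => [|n ih] y Dy; first by case/andP: (damped01 1 Dy).
have /andP[d0 _] := damp01 Dy.
by rewrite /= ler_wpM2l//; apply: le_mean.
Qed.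

(** The decreasing limit [g] satisfies [g <= damp * mean g], so it is subharmonic and maximal at
    [z]. There [g z <= damp z * g z] with [damp z < 1], which leaves [g z <= 0]. *)
Lemma damped_cvg0 y e : D y -> 0 < e -> exists n, damped n y < e.
Proof.
have le_d m n v : D v -> (m <= n)%N -> damped n v <= damped m v.
  move=> Dv /subnK <-; elim: (n - m)%N => [|k ih]; first by rewrite add0n.
  by rewrite addSn (le_trans (damped_nonincreasing _ Dv)).
pose g v := inf (range (damped ^~ v)).
have hinf v : D v -> has_inf (range (damped ^~ v)).
  move=> Dv; split; first by exists (damped 0 v); exists 0%N.
  by exists 0 => _ [n _ <-]; case/andP: (damped01 n Dv).
have g_le n v : D v -> g v <= damped n v.
  by move=> Dv; apply: ge_inf; [exact: (hinf _ Dv).2|exists n].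
have g_near v c : D v -> 0 < c -> exists n, damped n v < g v + c.
  by move=> Dv c0; have [_ [n _ <-]] := inf_adherent c0 (hinf _ Dv); exists n.
have g01 v : D v -> 0 <= g v <= 1.
  move=> Dv; rewrite (le_trans (g_le 0 _ Dv)) ?lexx// andbT.
  apply: lb_le_inf; first exact: (hinf _ Dv).1.
  by move=> _ [n _ <-]; case/andP: (damped01 n Dv).
have g_sub v : D v -> g v <= damp v * mean g v.
  move=> Dv; apply/ler_addgt0Pr => c c0.
  (* There are finitely many successors, so one [n] serves them all and the limit passes through
     [mean]. *)
  have [n hn] : exists n, forall w, w \in nxt v -> damped n w <= g w + c.
    have : forall w, w \in nxt v -> D w by move=> w; exact: (jc_next jc Dv).
    elim: (nxt v) => [|w s ih] hs; first by exists 0%N.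
    have Dw : D w by apply: hs; rewrite mem_head.
    have [|n hn] := ih; first by move=> u us; apply: hs; rewrite inE us orbT.
    have [m hm] := g_near w c Dw c0; exists (maxn m n) => u.
    rewrite inE => /predU1P[->|us].
      by apply: le_trans (ltW hm); apply: le_d => //; exact: leq_maxl.
    apply: le_trans (hn _ us); apply: le_d; last exact: leq_maxr.
    by apply: hs; rewrite inE us orbT.
  have /andP[d0 d1] := damp01 Dv.
  apply: le_trans (g_le n.+1 _ Dv) _ => /=.
  apply: (@le_trans _ _ (damp v * (mean g v + c))).
    rewrite ler_wpM2l// -[X in _ + X](mean_cst c Dv) /mean -big_split/=.
    rewrite big_seq [leRHS]big_seq; apply: ler_sum => w wv.
    by rewrite -mulrDr ler_wpM2l ?(jc_ge0 jc)// hn.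
  by rewrite mulrDr lerD2l ler_piMl// ltW.
have mg0 v : D v -> 0 <= mean g v.
  by move=> Dv; rewrite -[leLHS](mean_cst 0 Dv); apply: le_mean => // w /g01/andP[].
have hz v : D v -> g v <= g z.
  apply: subharmonic_le_z => // w Dw; apply: le_trans (g_sub _ Dw) _.
  by have /andP[d0 d1] := damp01 Dw; rewrite ler_piMl// mg0.
have gz0 : g z <= 0.
  have /andP[d0 _] := damp01 Dz.
  have : g z <= damp z * g z.
    apply: le_trans (g_sub _ Dz) _; rewrite ler_wpM2l//.
    by rewrite -[leRHS](mean_cst (g z) Dz); apply: le_mean.
  rewrite -subr_ge0 -{2}[g z]mul1r -mulrBl nmulr_rge0//.
  by rewrite subr_lt0.
move=> Dy e0; have [n hn] := g_near y e Dy e0; exists n.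
by apply: lt_le_trans hn _; rewrite gerDr (le_trans (hz _ Dy)).
Qed.

End Damped.

End Lyapunov.

(** * Probabilities with prescribed atoms *)

Section PointMasses.
Context (R : realType) dE (E : measurableType dE).
Hypothesis mE : forall B : set E, measurable B.
Local Open Scope ereal_scope.

Lemma point_mass_probability (D : set E) (a : E -> R) : countable D ->
  (forall x, 0 <= a x)%R -> \esum_(x in D) (a x)%:E = 1 ->
  exists pi : probability E R, pi D = 1 /\ forall x, D x -> pi [set x] = (a x)%:E.
Proof.
move=> /countable_bij_nat[K [h bh]] a0 a1; have [hK hi hs] := bh.
pose c n : R := if n \in K then a (h n) else 0%R.
have c0 n : (0 <= c n)%R by rewrite /c; case: ifP.
pose r n : {nonneg R} := NngNum (c0 n).
pose m : {measure set E -> \bar R} := mseries (fun n => mscale (r n) \d_(h n)) 0.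
have mE' B : m B = \sum_(0 <= n <oo | n \in K) (a (h n))%:E * \d_(h n) B.
  rewrite /m /= /mseries [RHS]eseries_mkcond; apply: eq_eseriesr => n _.
  transitivity ((c n)%:E * \d_(h n) B); first by [].
  by rewrite /c; case: ifP => // _; rewrite mul0e.
have mD : m D = 1.
  rewrite mE' -a1 (reindex_esum K D h)// -[in RHS](set_mem_set K) -nneseries_esum.
    apply: eq_eseriesr => n /set_mem Kn.
    by rewrite diracE mem_set ?mule1//; exact: hK.
  by move=> n _; rewrite lee_fin.
have mT : m setT = 1.
  rewrite -mD !mE'; apply: eq_eseriesr => n /set_mem Kn.
  by rewrite !diracE !mem_set//; exact: hK.
pose mixin := Measure_isProbability.Build _ _ _ m mT.
pose P : probability E R := HB.pack (Measure.sort m) mixin (Measure.on m).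
exists P; split=> [|x Dx]; first exact: mD.
have [n Kn <-] := hs x Dx.
change (m [set h n] = (a (h n))%:E); rewrite mE'.
rewrite (nneseriesD1 (n := n)); last 2 first.
- by move=> k _; rewrite mule_ge0// lee_fin.
- exact: mem_set.
rewrite diracE mem_set//= mule1 eseries0 ?adde0// => k _ /andP[/set_mem Kk kn].
rewrite diracE memNset ?mule0// => /= e; move/eqP : kn; apply.
by apply: hi => //; rewrite inE.
Qed.

End PointMasses.

(** * Occupation measure of an excursion from [z] *)

Section Green.
Context (R : realType) dE (E : measurableType dE) (p : E -> E -> R) (q : E -> R)
  (D : set E) (nxt : E -> seq E).
Hypothesis mE : forall B : set E, measurable B.
Hypothesis jc : jump_chain p q D nxt.
Local Notation mean := (mean p nxt).

Variables (f : E -> R) (eps beta : R).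
Hypothesis eps0 : 0 < eps.
Hypothesis beta0 : 0 <= beta.
Hypothesis f0 : forall x, D x -> 0 <= f x.
Hypothesis fproper : forall K, finite_set [set x | D x /\ f x <= K].
Hypothesis drift : forall x, D x -> q x * (mean f x - f x) <= beta - eps * f x.

Variable z : E.
Hypothesis Dz : D z.
Hypothesis hitz : forall (Q : set E) x, D x -> Q x ->
  (forall a b, D a -> Q a -> 0 < p a b -> Q b) -> Q z.
Hypothesis q_gt0 : forall x, D x -> 0 < q x.

(* Expectation over one jump, killed on jumping into z; [green n h] is the
   expected sum of h over the first n states of an excursion from z. *)
Definition taboo (h : E -> R) : E -> R := mean (fun y => (y != z)%:R * h y).

Definition green n (h : E -> R) : R := \sum_(k < n) iter k taboo h z.

Lemma le_taboo n h k x : D x -> (forall y, D y -> h y <= k y) ->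
  iter n taboo h x <= iter n taboo k x.
Proof.
move=> Dx hk; elim: n x Dx => [|n ih] x Dx /=; first exact: hk.
by apply: (le_mean jc) => // y Dy; rewrite ler_wpM2l ?ler0n// ih.
Qed.

Lemma le_green n h k : (forall y, D y -> h y <= k y) -> green n h <= green n k.
Proof. by move=> hk; apply: ler_sum => i _; exact: le_taboo. Qed.

Lemma iter_tabooS n h x : iter n.+1 taboo h x =
  \sum_(y <- nxt x) p x y * ((y != z)%:R * iter n taboo h y).
Proof. by []. Qed.

Lemma taboo_sum (s : seq E) (c : E -> R) (k : E -> E -> R) n x :
  iter n taboo (fun y => \sum_(v <- s) c v * k v y) x =
  \sum_(v <- s) c v * iter n taboo (k v) x.
Proof.
elim: n x => // n ih x; rewrite iter_tabooS.
under eq_bigr do rewrite ih mulrA mulr_sumr.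
rewrite exchange_big; apply: eq_bigr => v _.
by rewrite iter_tabooS mulr_sumr; apply: eq_bigr => y _; ring.
Qed.

Lemma green_sum (s : seq E) (c : E -> R) (k : E -> E -> R) n :
  green n (fun y => \sum_(v <- s) c v * k v y) = \sum_(v <- s) c v * green n (k v).
Proof.
rewrite /green; under eq_bigr do rewrite taboo_sum.
by rewrite exchange_big/=; apply: eq_bigr => v _; rewrite mulr_sumr.
Qed.

Lemma tabooD n h k x :
  iter n taboo (fun y => h y + k y) x = iter n taboo h x + iter n taboo k x.
Proof.
elim: n x => // n ih x; rewrite !iter_tabooS -big_split.
by apply: eq_bigr => y _; rewrite /= ih !mulrDr.
Qed.

Lemma tabooZ n c h x : iter n taboo (fun y => c * h y) x = c * iter n taboo h x.
Proof.
elim: n x => // n ih x; rewrite !iter_tabooS mulr_sumr.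
by apply: eq_bigr => y _; rewrite ih; ring.
Qed.

Lemma greenD n h k : green n (fun y => h y + k y) = green n h + green n k.
Proof. by rewrite /green -big_split/=; apply: eq_bigr => i _; exact: tabooD. Qed.

Lemma greenZ n c h : green n (fun y => c * h y) = c * green n h.
Proof. by rewrite /green mulr_sumr; apply: eq_bigr => i _; exact: tabooZ. Qed.

Lemma taboo_ge0 n h x : D x -> (forall y, D y -> 0 <= h y) -> 0 <= iter n taboo h x.
Proof.
move=> Dx h0; have -> : 0 = iter n taboo (fun y => 0 * h y) x by rewrite tabooZ mul0r.
by apply: le_taboo => // y Dy; rewrite mul0r h0.
Qed.

Lemma green_ge0 n h : (forall y, D y -> 0 <= h y) -> 0 <= green n h.
Proof. by move=> h0; apply: sumr_ge0 => i _; exact: taboo_ge0. Qed.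

Lemma greenS n h : green n.+1 h = h z + green n (taboo h).
Proof.
rewrite /green big_ord_recl; congr (_ + _).
by apply: eq_bigr => i _; rewrite -iterSr.
Qed.

Lemma green_leS n h : (forall y, D y -> 0 <= h y) -> green n h <= green n.+1 h.
Proof. by move=> h0; rewrite /green big_ord_recr/= lerDl taboo_ge0. Qed.

Definition indic_point (y x : E) : R := (x == y)%:R.

Lemma taboo_point y w : D y -> taboo (indic_point w) y = p y w * (w != z)%:R.
Proof.
move=> Dy; rewrite /taboo /mean /indic_point; have [wn|wn] := boolP (w \in nxt y).
  rewrite (bigD1_seq w)//=; last exact: (jc_uniq jc).
  rewrite eqxx mulr1 big1 ?addr0// => v /negbTE vw.
  by rewrite vw !mulr0.
rewrite (jc_out jc Dy wn) mul0r big_seq big1// => v vn.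
by rewrite (_ : v == w = false) ?mulr0//; apply/negbTE; apply: contraNneq wn => <-.
Qed.

Lemma mean_taboo h y : D y -> mean h y = taboo h y + p y z * h z.
Proof.
move=> Dy; rewrite /taboo /mean.
have [zn|zn] := boolP (z \in nxt y).
  rewrite (bigD1_seq z)//= ?(jc_uniq jc)//.
  rewrite [in RHS](bigD1_seq z)//= ?(jc_uniq jc)// eqxx mul0r mulr0 add0r addrC.
  by congr (_ + _); apply: eq_bigr => v ->; rewrite mul1r.
rewrite (jc_out jc Dy zn) mul0r addr0 big_seq [RHS]big_seq.
apply: eq_bigr => v vn; rewrite (_ : v != z) ?mul1r//.
by apply: contraNneq zn => <-.
Qed.

(** The probability of having returned to [z] within [n] jumps and that of not having returned add
    up to 1, which is the identity proved by induction. *)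
Lemma green_return n : green n (p ^~ z) <= 1.
Proof.
have h : green n (p ^~ z) + iter n taboo (fun=> 1) z = 1.
  elim: n => [|n ih]; first by rewrite /green big_ord0 add0r.
  rewrite /green big_ord_recr/= -addrA -[RHS]ih; congr (_ + _).
  rewrite -iterS iterSr -tabooD.
  have e y : D y -> p y z + taboo (fun=> 1) y = 1.
    by move=> Dy; have := mean_taboo (fun=> 1) Dy;
      rewrite (mean_cst jc)// mulr1 addrC => <-.
  by apply/eqP; rewrite eq_le; apply/andP; split; apply: le_taboo => // y Dy; rewrite e.
by rewrite -[leRHS]h lerDl taboo_ge0.
Qed.

Lemma green_point_z n : green n (indic_point z) <= 1.
Proof.
case: n => [|n]; first by rewrite /green big_ord0.
rewrite greenS /indic_point eqxx gerDl.
apply: (@le_trans _ _ (green n (fun y => 0 * indic_point z y))).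
  by apply: le_green => y Dy; rewrite taboo_point// eqxx mulr0 mul0r.
by rewrite greenZ mul0r.
Qed.

(** Subinvariance for the jump chain. For [w != z] a jump into [w] is the next visit of the
    excursion; for [w = z] the return probability is at most 1, the weight of the initial visit. *)
Lemma green_into n w : green n (p ^~ w) <= green n.+1 (indic_point w).
Proof.
have i0 y : 0 <= indic_point w y by exact: ler0n.
rewrite greenS; have [wz|wz] := eqVneq w z.
  rewrite wz {1}/indic_point eqxx; apply: le_trans (green_return n) _.
  by rewrite lerDl; apply: green_ge0 => y Dy; rewrite taboo_point// eqxx mulr0.
rewrite {1}/indic_point (_ : z == w = false) ?add0r; last first.
  by rewrite eq_sym; exact/negbTE.
by apply: le_green => y Dy; rewrite taboo_point// wz mulr1.
Qed.

(** By [green_into], visits to [b] are at least [p a b] times visits to [a]. So the states with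
    unbounded visits would form a set closed under jumps, hence contain [z], which an excursion
    visits only once. *)
Lemma green_point_bounded y : D y -> exists C, forall n, green n (indic_point y) <= C.
Proof.
move=> Dy; apply: contrapT => unb.
pose Q := [set v | D v /\ ~ exists C, forall n, green n (indic_point v) <= C].
have : Q z.
  apply: (hitz Dy) => // a b Da [_ ua] pab.
  have Db : D b.
    have [bn|/(jc_out jc Da) e'] := boolP (b \in nxt a).
      exact: (jc_next jc Da bn).
    by move: pab; rewrite e' ltxx.
  split=> // -[C hC]; apply: ua; exists (C / p a b) => n.
  rewrite ler_pdivlMr// mulrC -greenZ.
  apply: (@le_trans _ _ (green n (p ^~ b))).
    apply: le_green => v Dv; rewrite /indic_point; case: eqP => [->|_].
      by rewrite mulr1.
    by rewrite mulr0 (jc_ge0 jc).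
  exact: le_trans (green_into n b) (hC _).
by move=> [_]; apply; exists 1; exact: green_point_z.
Qed.

(** Division by [q] turns visits into expected time. The drift inequality telescopes along the
    excursion and bounds the sum of [(eps * f - beta) / q] by [f z]; off a finite set this dominates
    [(1 + f) / q] up to a constant, and [green_point_bounded] pays for that set. The 1 gives finite
    total mass, [f] gives integrability. *)
Lemma green_lyapunov : exists K, forall n, green n (fun y => (1 + f y) / q y) <= K.
Proof.
(* [f y > K0] gives [eps / 2 * (1 + f y) <= eps * f y - beta]; below [K0] the same bound holds after
   adding [b = beta + eps / 2]. *)
pose K0 := 2 * beta / eps + 1.
pose F := [set x | D x /\ f x <= K0].
have finF : finite_set F by exact: fproper.
have [CF hCF] : exists C, forall n, green n (fun y => (y \in F)%:R / q y) <= C.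
  have sD : forall y, y \in enum_fset (fset_set F) -> D y.
    by move=> y; rewrite in_fset_set// inE => -[].
  have [C hC] : exists C, forall n,
      \sum_(v <- enum_fset (fset_set F)) (q v)^-1 * green n (indic_point v) <= C.
    elim: (enum_fset _) sD => [_|v s ih hs].
      by exists 0 => n; rewrite big_nil.
    have Dv : D v by apply: hs; rewrite mem_head.
    have [|C hC] := ih; first by move=> u us; apply: hs; rewrite inE us orbT.
    have [C' hC'] := green_point_bounded Dv.
    exists ((q v)^-1 * C' + C) => n; rewrite big_cons lerD//.
    by rewrite ler_wpM2l// invr_ge0 ltW// q_gt0.
  exists C => n; apply: le_trans (hC n); rewrite -green_sum; apply: le_green => y Dy.
  have t0 v : v \in enum_fset (fset_set F) -> 0 <= (q v)^-1 * indic_point v y.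
    by move=> /sD Dv; rewrite mulr_ge0 ?ler0n// invr_ge0 ltW// q_gt0.
  case: (boolP (y \in F)) => yF; last by rewrite mul0r big_seq sumr_ge0.
  rewrite (bigD1_seq y)/= ?fset_uniq ?in_fset_set//.
  rewrite {1}/indic_point eqxx mul1r mulr1 lerDl big_seq_cond sumr_ge0// => v.
  by move=> /andP[/t0].
pose b := beta + eps / 2.
have lyap n : green n (fun y => (eps * f y - beta) / q y) <= f z.
  have : green n f <= green n.+1 f by exact: green_leS.
  rewrite greenS => h1; have : green n (taboo f) <= green n (fun y =>
      f y + (-1) * ((eps * f y - beta) / q y)).
    apply: le_green => y Dy; apply: (@le_trans _ _ (mean f y)).
      by rewrite mean_taboo// lerDl mulr_ge0 ?(jc_ge0 jc)// f0.
    rewrite mulN1r -lerBlDl -mulNr ler_pdivlMr ?q_gt0// mulrC opprB.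
    exact: drift.
  rewrite greenD greenZ; lra.
exists (2 / eps * (f z + b * CF)) => n.
have : green n (fun y => eps / 2 * ((1 + f y) / q y)) <=
    green n (fun y => (eps * f y - beta) / q y + b * ((y \in F)%:R / q y)).
  apply: le_green => y Dy; rewrite !mulrA -mulrDl ler_wpM2r//.
    by rewrite invr_ge0 ltW// q_gt0.
  have fy := f0 Dy; case: (boolP (y \in F)) => yF.
    rewrite mulr1 /b.
    have : 0 <= eps * f y by rewrite mulr_ge0// ltW.
    by lra.
  rewrite mulr0 addr0.
  have : K0 < f y by rewrite ltNge; apply: contra yF => h; rewrite inE.
  rewrite /K0 -ltrBrDr ltr_pdivrMr// => h; have := eps0; lra.
rewrite greenZ greenD greenZ => h.
have b0 : 0 <= b by rewrite /b addr_ge0// divr_ge0// ltW.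
have h1 := ler_wpM2l b0 (hCF n); have h2 := lyap n.
rewrite mulrAC ler_pdivlMr//; lra.
Qed.

Lemma green_pos n : 1 <= green n.+1 (indic_point z).
Proof.
rewrite greenS {1}/indic_point eqxx lerDl green_ge0// => y Dy.
by rewrite taboo_point// eqxx mulr0.
Qed.

Local Open Scope ereal_scope.

Let t n y := iter n taboo (indic_point y) z.

Let t_ge0 n y : (0 <= t n y)%R.
Proof. by apply: taboo_ge0 => // v _; exact: ler0n. Qed.

Definition green_limit y : \bar R :=
  \sum_(0 <= n <oo) (iter n taboo (indic_point y) z)%:E.

Lemma green_le_limit n y : (green n (indic_point y))%:E <= green_limit y.
Proof.
rewrite /green -sumEFin -(big_mkord xpredT (fun n => (t n y)%:E)).
by apply: nneseries_lim_ge => k _ _; rewrite lee_fin.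
Qed.

Lemma green_limit_ge0 y : 0 <= green_limit y.
Proof. by apply: nneseries_ge0 => n _ _; rewrite lee_fin; exact: t_ge0. Qed.

Lemma green_limit_fin y : D y -> green_limit y \is a fin_num.
Proof.
move=> Dy; have [C hC] := green_point_bounded Dy.
rewrite ge0_fin_numE ?green_limit_ge0//; apply: (@le_lt_trans _ _ C%:E);
  last exact: ltry.
apply: lime_le; first by apply: is_cvg_nneseries => n _ _; rewrite lee_fin;
  exact: t_ge0.
by apply: nearW => n; rewrite big_mkord sumEFin lee_fin hC.
Qed.

(** A partial sum over finitely many states and [n] steps is [green n] of a function below [h]. *)
Lemma esum_green (h : E -> R) K : (forall y, D y -> (0 <= h y)%R) ->
  (forall n, (green n h)%:E <= K) ->
  \esum_(y in D) ((h y)%:E * green_limit y) <= K.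
Proof.
move=> h0 hK; apply: ge_ereal_sup => _ [F [finF FD] <-].
rewrite fsbig_finite//=; set L := fset_set F.
have LD : {in enum_fset L, forall y, D y}.
  by move=> y; rewrite in_fset_set// inE => /FD.
have ht n y : y \in enum_fset L -> 0 <= (h y)%:E * (t n y)%:E.
  by move=> /LD Dy; rewrite mule_ge0// lee_fin ?h0//; exact: t_ge0.
have e y : (h y)%:E * green_limit y = \sum_(0 <= n <oo) (h y)%:E * (t n y)%:E.
  by rewrite nneseriesZl// => n _; rewrite lee_fin; exact: t_ge0.
rewrite big_seq; under eq_bigr do rewrite e.
rewrite -nneseries_sum; last by move=> y n /ht.
apply: lime_le.
  by apply: is_cvg_nneseries => n _ _; rewrite sume_ge0// => y /ht.
apply: nearW => n; apply: le_trans (hK n).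
have -> : \sum_(0 <= i < n) \sum_(y <- enum_fset L | y \in enum_fset L)
    (h y)%:E * (t i y)%:E =
    (\sum_(y <- enum_fset L) h y * green n (indic_point y))%R%:E.
  transitivity ((\sum_(0 <= i < n) \sum_(y <- enum_fset L) h y * t i y)%R%:E).
    by rewrite -sumEFin; apply: eq_bigr => i _; rewrite -big_seq -sumEFin.
  rewrite exchange_big/=; congr EFin; apply: eq_bigr => y _.
  by rewrite /green mulr_sumr big_mkord.
rewrite lee_fin -green_sum; apply: le_green => y Dy.
have [yL|yL] := boolP (y \in enum_fset L).
  rewrite (bigD1_seq y)//= ?fset_uniq// {1}/indic_point eqxx mulr1.
  rewrite big1 ?addr0// => v vy; rewrite /indic_point eq_sym (negbTE vy) mulr0//.
rewrite big_seq big1 ?h0// => v vL; rewrite /indic_point.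
by rewrite (_ : y == v = false) ?mulr0//; apply/negbTE; apply: contraNneq yL => ->.
Qed.

(** The masses are the expected times [green_limit y / q y], normalised by their sum [Z].
    Multiplying by the rates cancels [q y], so subinvariance reduces to [green_into]. *)
Lemma exists_subinvariant : exists pi : probability E R,
  [/\ pi D = 1,
      forall w, D w -> \esum_(y in D) ((q y * p y w)%:E * pi [set y]) <=
        (q w)%:E * pi [set w] &
      \int[pi]_(x in D) (f x)%:E < +oo].
Proof.
have cD := jc_countable jc.
have [K hK] := green_lyapunov.
have iq0 y : D y -> (0 <= (q y)^-1)%R by move=> Dy; rewrite invr_ge0 ltW// q_gt0.
have fq0 y : D y -> (0 <= (1 + f y) / q y)%R.
  by move=> Dy; rewrite mulr_ge0 ?iq0// addr_ge0// f0.
have total : \esum_(y in D) (((1 + f y) / q y)%:E * green_limit y) <= K%:E.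
  by apply: esum_green => // n; rewrite lee_fin.
pose Z := \esum_(y in D) ((q y)^-1%:E * green_limit y).
have Zterm y : D y -> 0 <= (q y)^-1%:E * green_limit y.
  by move=> Dy; rewrite mule_ge0 ?green_limit_ge0// lee_fin iq0.
have Zfin : Z \is a fin_num.
  rewrite ge0_fin_numE; last by apply: esum_ge0 => y; exact: Zterm.
  apply: (@le_lt_trans _ _ K%:E); last exact: ltry.
  apply: le_trans total; apply: le_esum => y Dy; rewrite lee_wpmul2r ?green_limit_ge0//.
  by rewrite lee_fin ler_peMl ?iq0// lerDl f0.
have Z0 : (0 < fine Z)%R.
  rewrite -lte_fin fineK//; apply: (@lt_le_trans _ _ ((q z)^-1%:E * green_limit z)).
    rewrite mule_gt0 ?lte_fin ?invr_gt0 ?q_gt0//.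
    by apply: (@lt_le_trans _ _ 1) => //; apply: le_trans (green_le_limit 1 z);
      rewrite lee_fin green_pos.
  exact: esum_ge_term.
pose a y : R := if y \in D then
  ((fine Z)^-1 * ((q y)^-1 * fine (green_limit y)))%R else 0%R.
have a0 y : (0 <= a y)%R.
  rewrite /a; case: ifPn => // /set_mem Dy;
    rewrite !mulr_ge0 ?iq0 ?invr_ge0 ?(ltW Z0)//.
  by rewrite fine_ge0// green_limit_ge0.
have aE y : D y -> (a y)%:E = (fine Z)^-1%:E * ((q y)^-1%:E * green_limit y).
  by move=> Dy; rewrite /a mem_set// !EFinM fineK// green_limit_fin.
have Zi0 : (0 <= (fine Z)^-1)%R by rewrite invr_ge0 ltW.
have a1 : \esum_(y in D) (a y)%:E = 1.
  rewrite (eq_esum aE) esumZl//.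
  by rewrite -/Z -[X in _ * X](fineK Zfin) -EFinM mulVf ?lt0r_neq0.
have [pi [piD pia]] := point_mass_probability cD a0 a1.
exists pi; split=> //.
- move=> w Dw; rewrite pia// aE// muleCA [X in _ <= _ * X](_ : _ = green_limit w);
  last first.
    by rewrite muleA -EFinM divff ?mul1e// lt0r_neq0 ?q_gt0.
  rewrite (_ : \esum_(y in D) _ =
      (fine Z)^-1%:E * \esum_(y in D) ((p y w)%:E * green_limit y)).
    rewrite lee_wpmul2l ?lee_fin//; apply: esum_green.
      by move=> y Dy; rewrite (jc_ge0 jc).
    move=> n; apply: le_trans (green_le_limit n.+1 w).
    by rewrite lee_fin green_into.
  rewrite -esumZl//; last first.
    by move=> y Dy; rewrite mule_ge0 ?green_limit_ge0// lee_fin (jc_ge0 jc).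
  apply: eq_esum => y Dy; rewrite pia// aE// muleCA; congr (_ * _).
  rewrite muleA -EFinM; congr (_%:E * _).
  by rewrite mulrAC divff ?mul1r// lt0r_neq0 ?q_gt0.
rewrite integral_discrete//.
have pim x : D x -> (pi : {measure set E -> \bar R}) [set x] = (a x)%:E by exact: pia.
apply: (@le_lt_trans _ _ ((fine Z)^-1 * K)%:E); last exact: ltry.
rewrite EFinM; apply: le_trans (lee_wpmul2l _ total); last by rewrite lee_fin.
rewrite -esumZl//; last first.
  by move=> y Dy; rewrite mule_ge0 ?green_limit_ge0// lee_fin fq0.
apply: le_esum => y Dy; rewrite pim// aE// muleCA lee_wpmul2l ?lee_fin//.
rewrite muleA -EFinM lee_wpmul2r ?green_limit_ge0// lee_fin.
by rewrite ler_wpM2r ?iq0// lerDr.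
Qed.

End Green.

(** * The Foster-Lyapunov criterion *)

Section Foster.
Context (R : realType) dE (E : measurableType dE) (A : (E -> R) -> E -> R)
  d (Omega : measurableType d) (X : jump_process A Omega).
Hypothesis mE : forall B : set E, measurable B.
Local Notation q := (exit_rate A).
Local Notation p := (jump_prob A).
Variables (D : set E) (nxt : E -> seq E).
Hypothesis jc : jump_chain p q D nxt.
Variables (f : E -> R) (eps beta : R).
Hypothesis eps0 : 0 < eps.
Hypothesis beta0 : 0 <= beta.
Hypothesis f0 : forall x, 0 <= f x.
Hypothesis fproper : forall K, finite_set [set x | D x /\ f x <= K].
Hypothesis drift : forall x, D x ->
  q x * (mean p nxt f x - f x) <= beta - eps * f x.
Variable z : E.
Hypothesis Dz : D z.
Hypothesis hitz : forall (Q : set E) x, D x -> Q x ->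
  (forall a b, D a -> Q a -> 0 < p a b -> Q b) -> Q z.

Lemma miss_probE n y :
  miss_prob A nxt z n y = damped p nxt (damp A z) n y.
Proof.
by elim: n y.
Qed.

Lemma miss_prob_cvg0 y e : D y -> 0 < e -> exists n, miss_prob A nxt z n y < e.
Proof.
move=> Dy e0.
have absorb a b : D a -> q a = 0 -> p a b = (a == b)%:R.
  by move=> _ q0; rewrite /jump_prob q0 eqxx.
have d01 x : D x -> 0 <= damp A z x <= 1.
  move=> Dx; rewrite /damp; case: eqP => [_|_]; last by rewrite ler01 lexx.
  apply/andP; split; last by rewrite gerBl expR_ge0.
  by rewrite subr_ge0 -expR0 ler_expR oppr_le0 (jc_rate jc).
have dz : damp A z z < 1 by rewrite /damp eqxx gtrBl expR_gt0.
have fD x : D x -> 0 <= f x by move=> _; exact: f0.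
have [n hn] := damped_cvg0 jc absorb eps0 fD fproper drift Dz hitz d01 dz Dy e0.
by exists n; rewrite miss_probE.
Qed.

Local Open Scope ereal_scope.

Lemma exists_sub_probability : exists pi : probability E R,
  [/\ pi D = 1,
      forall w, D w -> \esum_(y in D) ((q y * p y w)%:E * pi [set y]) <=
        (q w)%:E * pi [set w] &
      \int[pi]_(x in D) (f x)%:E < +oo].
Proof.
(* An absorbing [z] carries the Dirac mass, whose flux vanishes. Otherwise all rates on [D] are
   positive, as the division by [q] requires. *)
have [qz|qz] := eqVneq (q z) 0%R.
  exists \d_z; split.
  - by rewrite /= diracE mem_set.
  - move=> w Dw; rewrite [leLHS]esum1; last first.
      move=> y Dy; rewrite /= diracE; have [->|yz] := eqVneq y z.
        by rewrite qz mul0r mul0e.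
      by rewrite memNset ?mule0//= => e; move/eqP : yz; rewrite e.
    by rewrite mule_ge0// lee_fin (jc_rate jc).
  - rewrite integral_dirac//.
    by rewrite diracE mem_set// mul1e ltry.
apply: (exists_subinvariant mE jc eps0 beta0 _ fproper drift Dz hitz).
  by move=> x _; exact: f0.
move=> x Dx; have [->|xz] := eqVneq x z.
  by rewrite lt_neqAle eq_sym qz (jc_rate jc).
exact: (rate_gt0 jc hitz Dx xz).
Qed.

Lemma foster_lyapunov :
  [/\ non_explosive X D, recurrent X D &
      exists pi : probability E R,
        [/\ invariant_probability X D pi,
            forall pi' : probability E R, invariant_probability X D pi' ->
              forall B, measurable B -> pi' B = pi B &
            \int[pi]_x (f x)%:E < +oo]].
Proof.
have cons t x : (0 <= t)%R -> D x -> law X x (state_in X t D) = 1.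
  exact: (conservative X mE jc miss_prob_cvg0 hitz).
split.
- exact: (non_explosive_of_visits X mE jc miss_prob_cvg0 hitz).
- exact: (recurrent_of_visits X mE jc miss_prob_cvg0 hitz Dz).
have [pi [piD sub fint]] := exists_sub_probability.
exists pi.
have inv : invariant_probability X D pi.
  exact: (invariant_probability_sub mE jc sub piD cons).
split=> //.
  move=> pi' inv' B mB.
  apply: (invariant_probability_unique mE jc Dz _ _ inv' inv mB).
    by move=> x Dx; rewrite cons.
  by move=> x Dx; apply: (law_state1_gt0 X mE jc hitz Dx Dz).
have piC : pi (~` D) = 0 by rewrite probability_setC// piD subee.
rewrite -(setUv D) ge0_integral_setU//.
- by rewrite [X in _ + X](_ : _ = 0) ?adde0// null_set_integral.
- by move=> x _; rewrite lee_fin f0.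
- exact/disj_setPCl.
Qed.

End Foster.

(** * Chains *)

Section Inner.
Context (R : realType) disp (V : orderType disp) (C : complex V) (n : nat).
Local Notation chain := (chain R C n).
Implicit Types s u v : chain.

Definition supp s : {fset simplexes C n} := fset_set [set t | s t != 0].

Lemma in_supp s t : (t \in supp s) = (s t != 0).
Proof.
have /asboolP fs := coef_finsupp s.
by rewrite in_fset_set//; apply/idP/idP; rewrite inE.
Qed.

Lemma suppP s t : t \notin supp s -> s t = 0.
Proof. by rewrite in_supp negbK => /eqP. Qed.

Lemma chainP s u : (forall t, s t = u t) -> s = u.
Proof. by move=> h; apply: val_inj; apply/funext. Qed.

Lemma chainNE s t : (- s) t = - s t. Proof. by []. Qed.
Lemma chainZE a s t : (a *: s) t = a * s t. Proof. by []. Qed.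
Lemma chain0E t : (0 : chain) t = 0. Proof. by []. Qed.

Lemma chain_sumE I (r : seq I) (P : pred I) (F : I -> chain) t :
  (\sum_(i <- r | P i) F i) t = \sum_(i <- r | P i) F i t.
Proof. by apply: (big_morph (fun s : chain => s t)). Qed.

Lemma innerE s u (B : {fset simplexes C n}) : (supp s `<=` B)%fset ->
  inner s u = \sum_(t <- B) s t * u t.
Proof.
move=> sB; apply: fsbigTE => t tB; rewrite suppP ?mul0r//.
by apply: contra tB; exact: (fsubsetP sB).
Qed.

Lemma innerC s u : inner s u = inner u s.
Proof.
rewrite (innerE _ (fsubsetUl (supp s) (supp u))).
rewrite (innerE _ (fsubsetUr (supp s) (supp u))).
by apply: eq_bigr => t _; rewrite mulrC.
Qed.

Lemma innerDl s s' u : inner (s + s') u = inner s u + inner s' u.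
Proof.
pose B := (supp s `|` supp s' `|` supp (s + s')%R)%fset.
have h1 : (supp s `<=` B)%fset by rewrite /B -fsetUA fsubsetUl.
have h2 : (supp s' `<=` B)%fset by rewrite /B (fsetUC (supp s)) -fsetUA fsubsetUl.
have h3 : (supp (s + s')%R `<=` B)%fset by rewrite fsubsetUr.
rewrite (innerE _ h1) (innerE _ h2) (innerE _ h3).
by rewrite -big_split; apply: eq_bigr => t _; exact: mulrDl.
Qed.

Lemma innerZl a s u : inner (a *: s) u = a * inner s u.
Proof.
rewrite (innerE _ (fsubsetUl (supp s) (supp (a *: s)%R))).
rewrite (innerE _ (fsubsetUr (supp s) (supp (a *: s)%R))).
by rewrite mulr_sumr; apply: eq_bigr => t _; rewrite chainZE mulrA.
Qed.

Lemma innerNl s u : inner (- s) u = - inner s u.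
Proof. by rewrite -scaleN1r innerZl mulN1r. Qed.

Lemma innerBl s s' u : inner (s - s') u = inner s u - inner s' u.
Proof. by rewrite innerDl innerNl. Qed.

Lemma innerDr s u u' : inner s (u + u') = inner s u + inner s u'.
Proof. by rewrite innerC innerDl !(innerC s). Qed.

Lemma innerNr s u : inner s (- u) = - inner s u.
Proof. by rewrite innerC innerNl innerC. Qed.

Lemma innerBr s u u' : inner s (u - u') = inner s u - inner s u'.
Proof. by rewrite innerDr innerNr. Qed.

Lemma innerZr a s u : inner s (a *: u) = a * inner s u.
Proof. by rewrite innerC innerZl innerC. Qed.

Lemma inner0l u : inner 0 u = 0.
Proof. by rewrite -(scale0r (0 : chain)) innerZl mul0r. Qed.

Lemma inner_suml I (r : seq I) (P : pred I) (F : I -> chain) u :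
  inner (\sum_(i <- r | P i) F i) u = \sum_(i <- r | P i) inner (F i) u.
Proof.
apply: (big_morph (fun s : chain => inner s u)); last exact: inner0l.
by move=> s s'; rewrite innerDl.
Qed.

Lemma inner_sumr I (r : seq I) (P : pred I) (F : I -> chain) u :
  inner u (\sum_(i <- r | P i) F i) = \sum_(i <- r | P i) inner u (F i).
Proof. by rewrite innerC inner_suml; apply: eq_bigr => i _; exact: innerC. Qed.

Lemma normsqE s : normsq s = \sum_(t <- supp s) s t ^+ 2.
Proof. by rewrite /normsq (innerE _ (fsubset_refl _)). Qed.

Lemma normsq_ge0 s : 0 <= normsq s.
Proof. by rewrite normsqE sumr_ge0// => t _; rewrite sqr_ge0. Qed.

Lemma coef_le_normsq s t : s t ^+ 2 <= normsq s.
Proof.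
have [ts|/suppP ->] := boolP (t \in supp s); last by rewrite expr0n/= normsq_ge0.
rewrite normsqE (bigD1_seq t)//= ?fset_uniq// lerDl sumr_ge0// => u _.
by rewrite sqr_ge0.
Qed.

Lemma normsq_eq0 s : normsq s = 0 -> s = 0.
Proof.
move=> s0; apply: chainP => t; rewrite chain0E; apply/eqP.
by rewrite -sqrf_eq0 eq_le sqr_ge0 andbT -s0 coef_le_normsq.
Qed.

Lemma normsqB s u : normsq (s - u) = normsq s - 2 * inner u s + normsq u.
Proof. by rewrite /normsq innerBl !innerBr (innerC s u); ring. Qed.

Lemma normsqD_le s u : normsq (s + u) <= 2 * normsq s + 2 * normsq u.
Proof.
have := normsq_ge0 (s - u); rewrite normsqB.
rewrite /normsq innerDl !innerDr (innerC s u); lra.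
Qed.

End Inner.

(** * Norms of combinations through the Gram matrix *)

Section Gram.
Context (R : realType) disp (V : orderType disp) (C : complex V) (n : nat).
Local Notation chain := (chain R C n).
Variables (N : nat) (v : 'I_N -> chain).

Let gram : 'M[R]_N := \matrix_(i, j) inner (v i) (v j).

(* gram *m M *m gram = gram, with M a pseudo-inverse, expresses the norm of a
   combination of the v i through its inner products with the v i. *)
Lemma normsq_span_le : exists2 kappa : R, 0 <= kappa &
  forall x : 'I_N -> R, normsq (\sum_i x i *: v i) <=
    kappa * \sum_i inner (v i) (\sum_j x j *: v j) ^+ 2.
Proof.
(* A pseudo-inverse is used because the vectors may be dependent, as opposite steps are. *)
have [M MK] : exists M, gram *m M *m gram = gram.
  by exists (pinvmx gram); rewrite mulmxKpV.
exists (\sum_i \sum_j `|M i j|); first by rewrite !sumr_ge0// => i _; rewrite sumr_ge0.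
move=> x; set b := \sum_i x i *: v i.
pose w i := inner (v i) b; pose X : 'rV[R]_N := \row_i x i.
have gramT : gram^T = gram by apply/matrixP => i j; rewrite !mxE innerC.
pose W : 'rV[R]_N := \row_i w i.
have Xw : X *m gram = W.
  apply/matrixP => i j; rewrite !mxE /w /b inner_sumr; apply: eq_bigr => k _.
  by rewrite !mxE innerZr innerC.
have -> : normsq b = \sum_i \sum_j w i * M i j * w j.
  transitivity ((X *m gram *m X^T) 0 0).
    rewrite Xw mxE /normsq {1}/b inner_suml; apply: eq_bigr => i _.
    by rewrite !mxE innerZl mulrC.
  rewrite -MK !mulmxA Xw -!mulmxA.
  have -> : gram *m X^T = W^T by rewrite -Xw trmx_mul gramT.
  rewrite mulmxA mxE exchange_big/=; apply: eq_bigr => j _.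
  by rewrite !mxE mulr_suml; apply: eq_bigr => i _; rewrite !mxE.
rewrite mulr_suml; apply: ler_sum => i _; rewrite mulr_suml; apply: ler_sum => j _.
have wle k : w k ^+ 2 <= \sum_i w i ^+ 2.
  by rewrite (bigD1 k)//= lerDl sumr_ge0// => l _; rewrite sqr_ge0.
apply: le_trans (ler_norm _) _; rewrite !normrM.
have h : `|w i| * `|w j| <= \sum_i w i ^+ 2.
  have := wle i; have := wle j; rewrite -(real_normK (num_real (w i))).
  rewrite -[w j ^+ 2](real_normK (num_real (w j))).
  have := sqr_ge0 (`|w i| - `|w j|); nra.
rewrite mulrAC mulrC; apply: ler_wpM2l => //.
Qed.

End Gram.

(** * The finite set of steps and the generator *)

Section Steps.
Context (R : realType) disp (V : orderType disp) (C : complex V) (n : nat).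
Local Notation chain := (chain R C n).
Hypothesis finC : finite_set (simplexes C n.+1).
Implicit Types s e : chain.

Lemma finite_simplexesT : finite_set [set: simplexes C n.+1].
Proof.
by rewrite (eq_finite_set (card_setT _)).
Qed.

Lemma boundaryN (s : Defs.chain R C n.+1) : boundary (- s) = - boundary s.
Proof.
rewrite /boundary !fsbig_finite; [|exact: finite_simplexesT..].
by rewrite -sumrN; apply: eq_bigr => t _; exact: scaleNr.
Qed.

Lemma boundary_simplex (t : simplexes C n.+1) :
  boundary (simplex_chain R t) = simplex_boundary R t.
Proof.
rewrite /boundary (fsbigTE [fset t]%fset) ?big_seq_fset1/= ?eqxx ?scale1r//.
by move=> u; rewrite inE /= => /negbTE ->; rewrite scale0r.
Qed.

(** The generator counts each target chain once; [undup] ensures this without an argument that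
    distinct oriented simplexes have distinct boundaries. *)
Definition steps : seq chain :=
  let T := fset_set [set: simplexes C n.+1] in
  undup ([seq simplex_boundary R t | t <- T] ++
         [seq - simplex_boundary R t | t <- T]).

Lemma mem_steps e : e \in steps <->
  exists2 t : Defs.chain R C n.+1, oriented t & e = boundary t.
Proof.
rewrite mem_undup mem_cat; split.
  case/orP => /mapP[t _ ->].
    by exists (simplex_chain R t); [exists t; left|rewrite boundary_simplex].
  exists (- simplex_chain R t); first by exists t; right.
  by rewrite boundaryN boundary_simplex.
have tT (t : simplexes C n.+1) : t \in fset_set [set: simplexes C n.+1].
  by rewrite in_fset_set ?inE//; exact: finite_simplexesT.
move=> [_ [t [->|->]] ->]; apply/orP; [left|right]; apply/mapP; exists t => //.
  by rewrite boundary_simplex.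
by rewrite boundaryN boundary_simplex.
Qed.

Lemma stepsN e : (- e \in steps) = (e \in steps).
Proof.
suff h e' : e' \in steps -> - e' \in steps.
  by apply/idP/idP => /h//; rewrite opprK.
move=> /mem_steps[t [u tu] ->]; apply/mem_steps; exists (- t).
  by exists u; case: tu => ->; [right|left; rewrite opprK].
by rewrite boundaryN.
Qed.

Lemma steps_int e t : e \in steps -> e t \is a Num.int.
Proof.
have int_bd (u : simplexes C n.+1) : simplex_boundary R u t \is a Num.int.
  rewrite /simplex_boundary chain_sumE rpred_sum// => v _.
  by rewrite chainZE rpredM ?rpredX ?rpredN1//=; case: eqP => _;
    rewrite ?rpred0 ?rpred1.
rewrite mem_undup mem_cat => /orP[] /mapP[u _ ->]; first exact: int_bd.
by rewrite chainNE rpredN.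
Qed.

Lemma neighbourE s s' : neighbour s s' <->
  exists2 e, e \in steps & 0 < inner e s /\ s' = s - e.
Proof.
have wE e : (0 < weight s e) = (0 < inner e s) by rewrite /weight lt_max ltxx orbF.
split=> [[t ot [wt ->]]|[e /mem_steps[t ot ->] [wt ->]]].
  by exists (boundary t); [apply/mem_steps; exists t|rewrite -wE].
by exists t => //; rewrite wE.
Qed.

Definition step_rate s e : R := Num.max (inner e s) 0.

(** Distinct steps lead to distinct targets, and forbidden steps may stay in the sum since their
    rate is 0. *)
Lemma generatorE (F : chain -> R) s :
  generator F s = \sum_(e <- steps) step_rate s e * (F (s - e) - F s).
Proof.
transitivity (\sum_(s' <- [seq s - e | e <- steps & 0 < inner e s])
   (F s' - F s) * transition s s').
  rewrite /generator; set L := [seq _ | _ <- _ & _].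
  have uL : uniq L.
    rewrite map_inj_uniq ?filter_uniq ?undup_uniq// => a b /addrI.
    exact: oppr_inj.
  have <- : [set` L] = [set s' | neighbour s s'].
    apply/seteqP; split=> s' /=.
      move=> /mapP[e]; rewrite mem_filter => /andP[e0 eS] ->.
      by apply/neighbourE; exists e.
    move=> /neighbourE[e eS [e0 ->]]; apply/mapP; exists e => //.
    by rewrite mem_filter e0.
  by rewrite -fsbig_seq.
rewrite big_map big_filter big_mkcond/=; apply: eq_big_seq => e eS.
rewrite /step_rate; case: ifPn => [e0|]; last first.
  by rewrite -leNgt => e0; rewrite max_r// mul0r.
have -> : transition s (s - e) = Num.max (inner e s) 0.
  rewrite /transition; case: asboolP => [_|[]]; last by apply/neighbourE; exists e.
  by rewrite /weight opprB addrC subrK.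
by rewrite mulrC.
Qed.

End Steps.

(** * The walk as a jump chain *)

Section Walk.
Context (R : realType) disp (V : orderType disp) (C : complex V) (n : nat).
Local Notation chain := (chain R C n).
Hypothesis finC : finite_set (simplexes C n.+1).
Implicit Types s x y e : chain.
Local Notation steps := (steps R C n).
Local Notation A := (@generator R disp V C n).
Local Notation p := (jump_prob A).
Local Notation q := (exit_rate A).

Lemma step_rate_ge0 s e : 0 <= step_rate s e.
Proof. by rewrite /step_rate le_max lexx orbT. Qed.

Lemma step_rate0 s : step_rate s 0 = 0.
Proof. by rewrite /step_rate inner0l maxxx. Qed.

Lemma indic_set1 x y : \1_[set y] x = (x == y)%:R :> R.
Proof. by rewrite indicE; congr (nat_of_bool _)%:R; apply/idP/eqP; rewrite inE. Qed.

Lemma rateE x y : x != y ->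
  rate A x y = \sum_(e <- steps) step_rate x e * (x - e == y)%:R.
Proof.
move=> xy; rewrite /rate generatorE//; apply: eq_bigr => e _.
by rewrite !indic_set1 (negbTE xy) subr0.
Qed.

Lemma exit_rateE x : q x = \sum_(e <- steps) step_rate x e.
Proof.
rewrite /exit_rate /rate generatorE// -sumrN; apply: eq_bigr => e _.
rewrite !indic_set1 eqxx subr_eq -subr_eq0 opprD addNKr oppr_eq0.
have [->|_] := eqVneq e 0; first by rewrite step_rate0 mul0r oppr0.
by rewrite sub0r mulrN1 opprK.
Qed.

Lemma exit_rate_ge0 x : 0 <= q x.
Proof. by rewrite exit_rateE sumr_ge0// => e _; exact: step_rate_ge0. Qed.

Lemma exit_rate_eq0 x e : q x = 0 -> e \in steps -> step_rate x e = 0.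
Proof.
rewrite exit_rateE => /eqP; rewrite psumr_eq0 => [/allP h eS|? _];
  last exact: step_rate_ge0.
by apply/eqP/(h e eS).
Qed.

(** At an absorbing chain [jump_prob] stays put, so the chain is its own target. *)
Definition targets x : seq chain :=
  if q x == 0 then [:: x] else [seq x - e | e <- steps & 0 < inner e x].

Lemma targets_uniq x : uniq (targets x).
Proof.
rewrite /targets; case: ifP => // _.
rewrite map_inj_uniq ?filter_uniq ?undup_uniq// => a b /addrI; exact: oppr_inj.
Qed.

Lemma step_neq x e : 0 < inner e x -> x == x - e = false.
Proof.
move=> e0; apply/negbTE; rewrite eq_sym subr_eq -subr_eq0 opprD addNKr oppr_eq0.
by apply: contraTneq e0 => ->; rewrite inner0l ltxx.
Qed.

Lemma jump_prob_step x e : e \in steps -> 0 < inner e x ->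
  p x (x - e) = step_rate x e / q x.
Proof.
move=> eS e0; have re : step_rate x e != 0.
  by rewrite /step_rate max_l ?gt_eqF// ltW.
rewrite /jump_prob ifF; last by apply: contra_neqF re => /eqP /exit_rate_eq0; exact.
rewrite step_neq// rateE ?step_neq// (bigD1_seq e)//= ?undup_uniq// eqxx mulr1.
rewrite big1 ?addr0// => e' ee'; rewrite (inj_eq (addrI x)) (inj_eq oppr_inj).
by rewrite (negbTE ee') mulr0.
Qed.

Lemma mean_targets (h : chain -> R) x :
  q x * (mean p targets h x - h x) =
    \sum_(e <- steps) step_rate x e * (h (x - e) - h x).
Proof.
have [q0|q0] := eqVneq (q x) 0.
  by rewrite q0 mul0r big_seq big1// => e eS; rewrite exit_rate_eq0// mul0r.
rewrite mulrBr /mean /targets (negbTE q0) big_map big_filter mulr_sumr.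
under [RHS]eq_bigr do rewrite mulrBr.
rewrite sumrB -mulr_suml -exit_rateE; congr (_ - _).
rewrite big_mkcond/=; apply: eq_big_seq => e eS; case: ifPn => e0.
  by rewrite jump_prob_step// mulrA (mulrC (q x)) divfK.
by rewrite /step_rate max_r ?mul0r// leNgt.
Qed.

Lemma mean_prob1 x : \sum_(y <- targets x) p x y = 1.
Proof.
have [q0|q0] := eqVneq (q x) 0.
  by rewrite /targets q0 eqxx big_seq1 /jump_prob q0 !eqxx.
apply: (mulfI q0); have := mean_targets (cst 1) x; rewrite /mean.
under [in RHS]eq_bigr do rewrite subrr mulr0.
rewrite big1_eq; under eq_bigr do rewrite mulr1.
by rewrite mulrBr => /eqP; rewrite subr_eq0 => /eqP.
Qed.

Lemma jump_prob_out x y : y \notin targets x -> p x y = 0.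
Proof.
rewrite /targets /jump_prob; case: ifP => [_|q0 yx];
  first by rewrite inE eq_sym => /negbTE ->.
case: eqVneq => // xy; rewrite rateE// big_seq big1 ?mul0r// => e eS.
case: eqP => [xe|_]; last by rewrite mulr0.
rewrite /step_rate max_r ?mul0r// leNgt; apply: contra yx => e0.
by apply/mapP; exists e; rewrite ?mem_filter ?e0.
Qed.

Lemma jump_prob_ge0 x y : 0 <= p x y.
Proof.
rewrite /jump_prob; case: ifP => // _; case: eqVneq => // xy.
rewrite rateE// mulr_ge0 ?invr_ge0 ?exit_rate_ge0// sumr_ge0// => e _.
by rewrite mulr_ge0// step_rate_ge0.
Qed.

Lemma jump_prob_gt0 x e : e \in steps -> 0 < inner e x -> 0 < p x (x - e).
Proof.
move=> eS e0; rewrite lt_neqAle jump_prob_ge0 andbT eq_sym.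
have re : step_rate x e != 0 by rewrite /step_rate max_l ?gt_eqF// ltW.
rewrite jump_prob_step// mulf_neq0// invr_neq0//.
by apply: contra_neq re => /exit_rate_eq0; exact.
Qed.

Inductive walk x : chain -> Prop :=
| walk_refl : walk x x
| walk_step y e : walk x y -> e \in steps -> 0 < inner e y -> walk x (y - e).

Lemma walk_trans x y z : walk x y -> walk y z -> walk x z.
Proof. by move=> xy; elim=> // w e _ xw eS e0; exact: walk_step. Qed.

Lemma walk_jump x y (Q : set chain) : walk x y -> Q x ->
  (forall a b, walk x a -> Q a -> 0 < p a b -> Q b) -> Q y.
Proof.
move=> xy Qx cQ; elim: xy => // a e xa Qa eS e0.
by apply: (cQ a) => //; exact: jump_prob_gt0.
Qed.

(** Opposite steps have separate coefficients, so a chain may have many vectors [c]; the induction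
    in [walk_join] is on the vector. *)
Definition lattice x0 (c : {ffun 'I_(size steps) -> int}) : chain :=
  x0 + \sum_i (c i)%:~R *: steps`_i.

Lemma walk_lattice x y : walk x y -> exists c, y = lattice x c.
Proof.
elim=> [|_ e _ [c ->] eS _].
  by exists [ffun=> 0]; rewrite /lattice big1 ?addr0// => i _; rewrite ffunE scale0r.
have ie : (index e steps < size steps)%N by rewrite index_mem.
pose i0 := Ordinal ie.
exists [ffun i => c i - (i == i0)%:R].
rewrite /lattice -addrA; congr (_ + _).
under [RHS]eq_bigr do rewrite ffunE rmorphB/= scalerBl.
rewrite sumrB; congr (_ - _);
  rewrite (bigD1 i0)//= eqxx scale1r nth_index// big1 ?addr0//.
by move=> i /negbTE ->; rewrite scale0r.
Qed.

Lemma jump_chain_walk x : jump_chain p q (walk x) targets.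
Proof.
split.
- apply: sub_countable (countableP [set: {ffun 'I_(size steps) -> int}]).
  apply: (card_le_trans (B := range (lattice x))); last exact: card_image_le.
  by apply: subset_card_le => y /walk_lattice[c ->]; exists c.
- exact: targets_uniq.
- move=> a b xa; rewrite /targets; case: ifP => _; first by rewrite inE => /eqP ->.
  move=> /mapP[e]; rewrite mem_filter => /andP[e0 eS] ->; exact: walk_step.
- by move=> *; exact: jump_prob_ge0.
- by move=> a b _; exact: jump_prob_out.
- by move=> a _; exact: mean_prob1.
- by move=> a _; exact: exit_rate_ge0.
Qed.

End Walk.

(** * Drift and level sets of the squared norm *)

Section Drift.
Context (R : realType) disp (V : orderType disp) (C : complex V) (n : nat).
Local Notation chain := (chain R C n).
Hypothesis finC : finite_set (simplexes C n.+1).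
Implicit Types s x y e : chain.
Local Notation steps := (steps R C n).
Local Notation A := (@generator R disp V C n).
Local Notation p := (jump_prob A).
Local Notation q := (exit_rate A).

Lemma sum_step_rate2 x :
  \sum_(e <- steps) inner e x ^+ 2 = 2 * \sum_(e <- steps) step_rate x e ^+ 2.
Proof.
have sqE e : inner e x ^+ 2 = step_rate x e ^+ 2 + step_rate x (- e) ^+ 2.
  rewrite /step_rate innerNl; have [e0|e0] := leP 0 (inner e x).
    by rewrite max_r ?oppr_le0// expr0n addr0.
  by rewrite max_l ?oppr_ge0 ?ltW// sqrrN expr0n add0r.
under eq_bigr do rewrite sqE.
rewrite big_split/= mulr_natl mulr2n; congr (_ + _).
rewrite -(big_map -%R xpredT (fun e => step_rate x e ^+ 2)).
apply: perm_big; apply: uniq_perm; rewrite ?(map_inj_uniq oppr_inj) ?undup_uniq//.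
by move=> e; rewrite -{1}[e]opprK (mem_map oppr_inj) stepsN.
Qed.

Lemma walk_coercive x0 : exists a b : R, [/\ 0 <= a, 0 <= b &
  forall x, walk x0 x ->
    normsq x <= b + a * \sum_(e <- steps) step_rate x e ^+ 2].
Proof.
have [kappa k0 hk] := normsq_span_le (fun i : 'I_(size steps) => steps`_i).
pose S0 := \sum_(e <- steps) inner e x0 ^+ 2.
have S0ge0 : 0 <= S0 by rewrite sumr_ge0// => e _; exact: sqr_ge0.
(* With [U] the sum of squared rates: [|x|^2 <= 2 |x0|^2 + 2 |x - x0|^2], and
   [|x - x0|^2 <= kappa (4 U + 2 S0)]. *)
exists (8 * kappa), (2 * normsq x0 + 4 * kappa * S0); split.
- by rewrite mulr_ge0.
- by rewrite addr_ge0 ?mulr_ge0 ?normsq_ge0.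
move=> x /walk_lattice[c xc].
have := normsqD_le x0 (x - x0); rewrite addrC subrK => h1.
have h2 : normsq (x - x0) <= kappa * \sum_(e <- steps) inner e (x - x0) ^+ 2.
  have := hk (fun i => (c i)%:~R); rewrite xc /lattice addrC addKr => h.
  by apply: le_trans h _; rewrite (big_nth 0) big_mkord.
have h3 : \sum_(e <- steps) inner e (x - x0) ^+ 2 <=
    2 * \sum_(e <- steps) inner e x ^+ 2 + 2 * S0.
  rewrite !mulr_sumr -big_split; apply: ler_sum => e _ /=.
  by rewrite innerBr; have := sqr_ge0 (inner e x + inner e x0); lra.
rewrite (sum_step_rate2 x) in h3.
have h4 := ler_wpM2l k0 h3; clear -h1 h2 h4.
set U := \sum_(e <- steps) step_rate x e ^+ 2 in h4 *.
by set W := \sum_(e <- steps) inner e (x - x0) ^+ 2 in h2 h4; lra.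
Qed.

(** With [r = <e, x> >= 0] a term is [r (|e|^2 - 2 r)], and [r |e|^2 <= r^2 + |e|^4]. *)
Lemma sum_step_drift x :
  \sum_(e <- steps) step_rate x e * (normsq (x - e) - normsq x) <=
  \sum_(e <- steps) normsq e ^+ 2 - \sum_(e <- steps) step_rate x e ^+ 2.
Proof.
rewrite -sumrB; apply: ler_sum => e _; rewrite normsqB /step_rate.
have [e0|e0] := leP 0 (inner e x).
  have := sqr_ge0 (inner e x - normsq e); have := mulr_ge0 e0 (normsq_ge0 e).
  by rewrite !expr2; lra.
by rewrite mul0r expr0n subr0 sqr_ge0.
Qed.

Lemma drift_walk x0 : exists eps beta : R, [/\ 0 < eps, 0 <= beta &
  forall x, walk x0 x ->
    \sum_(e <- steps) step_rate x e * (normsq (x - e) - normsq x) <=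
    beta - eps * normsq x].
Proof.
have [a [b [a0 b0 hab]]] := walk_coercive x0.
have a1 : 0 < a + 1 by rewrite ltr_wpDl.
(* Coercivity gives [U >= (|x|^2 - b) / (a + 1)]; the added 1 keeps the divisor positive when
   [a = 0]. *)
exists (a + 1)^-1, (\sum_(e <- steps) normsq e ^+ 2 + (a + 1)^-1 * b); split.
- by rewrite invr_gt0.
- rewrite addr_ge0//; first by rewrite sumr_ge0// => e _; exact: sqr_ge0.
  by rewrite mulr_ge0// invr_ge0 ltW.
move=> x xx; apply: le_trans (sum_step_drift x) _.
set N := \sum_(e <- steps) normsq e ^+ 2; have := hab _ xx.
set U := \sum_(e <- steps) _ => hU; have U0 : 0 <= U.
  by rewrite sumr_ge0// => e _; exact: sqr_ge0.
rewrite -addrA lerD2l lerNl opprB -mulrBr mulrC ler_pdivrMr//.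
by lra.
Qed.

Lemma chain_expand s (B : {fset simplexes C n}) : (supp s `<=` B)%fset ->
  s = \sum_(t : B) s (val t) *: simplex_chain R (val t).
Proof.
move=> sB; apply: chainP => t; rewrite chain_sumE.
rewrite -(big_seq_fsetE _ _ xpredT (fun u => (s u *: simplex_chain R u) t)).
transitivity (\sum_(u <- B) s u * (t == u)%:R); last by apply: eq_bigr.
have [tB|tB] := boolP (t \in B).
  rewrite (bigD1_seq t)//= ?fset_uniq// eqxx mulr1 big1 ?addr0//.
  by move=> u ut; rewrite eq_sym (negbTE ut) mulr0.
rewrite big_seq big1 => [|u uB].
  by rewrite suppP//; apply: contra tB; exact: (fsubsetP sB).
by case: eqP => [tu|]; rewrite ?mulr0//; rewrite -tu (negbTE tB) in uB.
Qed.

(** The coefficients of [x - x0] are integers, vanish outside the finite union [B] of the supports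
    of the steps and are bounded by [M]. Shifted by [M], they become a function from [B] to the
    integers up to [2 M]. *)
Lemma finite_walk_level x0 K : finite_set [set x | walk x0 x /\ normsq x <= K].
Proof.
pose B := (\bigcup_(e <- steps) supp e)%fset.
pose L : R := 2 * K + 2 * normsq x0.
pose M := (Num.truncn L).+1.
pose g (c : {ffun B -> 'I_(M.*2).+1}) : chain :=
  x0 + \sum_t ((c t : nat)%:R - M%:R) *: simplex_chain R (val t).
apply: (@sub_finite_set _ _ (range g)); last exact: finite_image.
move=> x [/walk_lattice[c xc] xK].
pose u := x - x0.
have uE : u = \sum_i (c i)%:~R *: steps`_i by rewrite /u xc /lattice addrC addKr.
have uint t : u t \is a Num.int.
  rewrite uE chain_sumE rpred_sum// => i _.
  by rewrite chainZE rpredM ?intr_int// steps_int ?mem_nth.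
have usupp : (supp u `<=` B)%fset.
  apply/fsubsetP => t; apply: contraLR => tB; rewrite in_supp negbK.
  rewrite uE chain_sumE big1// => i _; rewrite chainZE suppP ?mulr0//.
  apply: contra tB => tS; apply/bigfcupP; exists steps`_i => //.
  by rewrite mem_nth.
have uM t : `|u t| <= M%:R.
  have h1 : `|u t| ^+ 2 <= L.
    rewrite real_normK ?num_real// (le_trans (coef_le_normsq _ _))//.
    apply: le_trans (normsqD_le _ _) _; rewrite /L.
    have -> : normsq (- x0) = normsq x0 by rewrite /normsq innerNl innerNr opprK.
    by rewrite lerD2r ler_pM2l.
  have h2 : `|u t| <= `|u t| ^+ 2.
    have /natrP[m ->] : `|u t| \is a Num.nat by rewrite natr_norm_int.
    by rewrite -natrX ler_nat; nia.
  apply: le_trans h2 (le_trans h1 _); rewrite /M.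
  exact: ltW (truncnS_gt _).
exists [ffun t : B => inord (Num.truncn (u (val t) + M%:R))] => //.
rewrite /g -[RHS](subrK x0) addrC; congr (_ + _).
rewrite [RHS](chain_expand usupp); apply: eq_bigr => t _; congr (_ *: _).
have := uM (val t); rewrite ler_norml => /andP[lo hi].
have nat_u : u (val t) + M%:R \is a Num.nat.
  rewrite natrEint; apply/andP; split; first by rewrite rpredD ?natr_int.
  by rewrite -lerBlDr sub0r.
rewrite ffunE inordK; last first.
  by rewrite ltnS -(ler_nat R) truncnK// -addnn natrD lerD2r.
by rewrite truncnK// addrK.
Qed.

End Drift.

(** * Common successors *)

Section Confluence.
Context (R : realType) disp (V : orderType disp) (C : complex V) (n : nat).
Local Notation chain := (chain R C n).
Hypothesis finC : finite_set (simplexes C n.+1).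
Implicit Types s x y e : chain.
Local Notation steps := (steps R C n).

Lemma lattice_step x (c : {ffun 'I_(size steps) -> int}) i m :
  lattice x [ffun j => c j - (j == i)%:R * m] = lattice x c - m%:~R *: steps`_i.
Proof.
rewrite /lattice -addrA; congr (_ + _).
under eq_bigr do rewrite ffunE rmorphB/= scalerBl.
rewrite sumrB; congr (_ - _); rewrite (bigD1 i)//= eqxx mul1r big1 ?addr0//.
by move=> j /negbTE ->; rewrite mul0r scale0r.
Qed.

(* Induction on sum_i |c i|: since |y - x|^2 = sum_i c i (<v_i, y> - <v_i, x>), if
   y != x then one of y and x can move towards the other along some v_i. *)
Lemma walk_join x (c : {ffun 'I_(size steps) -> int}) :
  exists2 z, walk x z & walk (lattice x c) z.
Proof.
have [N] := ubnP (\sum_i `|c i|)%N; elim: N => // N IH in x c *; rewrite ltnS => cN.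
have [yx|yx] := eqVneq (lattice x c) x; first by exists x; rewrite ?yx;
  exact: walk_refl.
pose y := lattice x c; pose v (i : 'I_(size steps)) : chain := steps`_i.
have [i ci] : exists i, 0 < (c i)%:~R * (inner (v i) y - inner (v i) x).
  apply/not_existsP => h; move/eqP: yx; apply; apply/eqP; rewrite -subr_eq0.
  apply/eqP/normsq_eq0/le_anti; rewrite normsq_ge0 andbT -/y.
  have {1}-> : normsq (y - x) = inner (\sum_i (c i)%:~R *: v i) (y - x).
    by rewrite /normsq {1}/y /lattice addrC addKr.
  rewrite inner_suml sumr_le0// => i _.
  by rewrite innerZl innerBr leNgt; apply/negP/h.
have ci0 : c i != 0 by apply: contraTneq ci => ->; rewrite mul0r ltxx.
pose m := sgz (c i); pose e : chain := m%:~R *: v i.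
have eS : e \in steps.
  have vS : v i \in steps by rewrite mem_nth.
  rewrite /e /m sgz_def ci0 mulr1n; case: (c i < 0); last by rewrite scale1r.
  by rewrite scaleN1r stepsN.
pose c' := [ffun j => c j - (j == i)%:R * m].
have c'N : (\sum_i `|c' i| < N)%N.
  apply: leq_trans cN; rewrite (bigD1 i)// [leqRHS](bigD1 i)//= -addSn.
  rewrite leq_add//; last first.
    by apply: leq_sum => j ji; rewrite ffunE (negbTE ji) mul0r subr0.
  by rewrite ffunE eqxx mul1r /m; clear -ci0; case: (c i) ci0 => [[|k]|k]//= _; lia.
have c'E : lattice x c' = y - e by exact: lattice_step.
have ye : 0 < inner e y - inner e x.
  rewrite /e !innerZl -mulrBr; move: ci; rewrite /m sgz_def ci0 mulr1n.
  set d := inner _ _ - _; have [c0|c0] := ltP (c i) 0.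
    by rewrite nmulr_rgt0 ?ltrz0// mulN1r oppr_gt0.
  by rewrite pmulr_rgt0 ?mul1r// ltr0z lt_neqAle eq_sym ci0.
have [ey|ey] := ltP 0 (inner e y).
  have [z xz yz] := IH x _ c'N; exists z => //; rewrite c'E in yz.
  exact: (walk_trans (walk_step (walk_refl y) eS ey) yz).
(* Otherwise [<e, x> < <e, y> <= 0], so [x] may move to [x + e], from which [y] has the smaller
   coefficients [c']. *)
have ex : 0 < inner (- e) x by rewrite innerNl; lra.
have [z xz yz] := IH (x - - e) _ c'N; exists z.
  have eNS : - e \in steps by rewrite stepsN.
  exact: (walk_trans (walk_step (walk_refl x) eNS ex) xz).
rewrite -/y; suff <- : lattice (x - - e) c' = y by [].
by rewrite opprK /lattice addrAC -/(lattice x c') c'E subrK.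
Qed.

Lemma walk_confluent x y1 y2 : walk x y1 -> walk x y2 ->
  exists2 z, walk y1 z & walk y2 z.
Proof.
move=> /walk_lattice[c1 ->] /walk_lattice[c2 ->].
have := walk_join (lattice x c1) [ffun i => c2 i - c1 i].
suff -> : lattice (lattice x c1) [ffun i => c2 i - c1 i] = lattice x c2 by [].
rewrite /lattice -addrA -big_split/=; congr (_ + _); apply: eq_bigr => i _.
by rewrite ffunE -scalerDl -rmorphD/= addrC subrK.
Qed.

(* The finite set of chains with |x|^2 <= beta / eps is reached from everywhere,
   by descending along |.|^2. *)
Lemma walk_sink x0 : exists2 z, walk x0 z & forall x, walk x0 x -> walk x z.
Proof.
have [eps [beta [eps0 beta0 drift]]] := drift_walk finC x0.
pose K := beta / eps.
have low x : walk x0 x -> exists2 y, walk x y & normsq y <= K.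
  move=> x0x; pose L := [set y | walk x y /\ normsq y <= normsq x].
  have [||y [xy yx] ymin] := @finite_argmax R chain (fun y => - normsq y) L.
  - exact: finite_walk_level.
  - by exists x; split=> //; exact: walk_refl.
  exists y => //; rewrite leNgt; apply/negP => Ky.
  have := drift y (walk_trans x0x xy).
  (* Above [K] the drift is negative, whereas at a minimiser [y] no allowed step lowers the norm, so
     that its drift is non-negative. *)
  apply/negP; rewrite -ltNge.
  apply: (@lt_le_trans _ _ 0); first by move: Ky; rewrite /K ltr_pdivrMr//; lra.
  rewrite big_seq sumr_ge0// => e eS; rewrite /step_rate.
  have [e0|e0] := ltP 0 (inner e y); last by rewrite mul0r.
  rewrite pmulr_rge0// subr_ge0 leNgt; apply/negP => ye.
  have /ymin : L (y - e); last by lra.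
  split; first exact: walk_step.
  by lra.
have [F FE] : exists F : seq chain, [set` F] = [set y | walk x0 y /\ normsq y <= K].
  exists (enum_fset (fset_set [set y | walk x0 y /\ normsq y <= K])).
  by rewrite fset_setK//; exact: finite_walk_level.
have [z x0z Fz] : exists2 z, walk x0 z & forall y, y \in F -> walk y z.
  have: {in F, forall y, walk x0 y}.
    move=> y yF; have : [set` F] y by [].
    by rewrite FE => -[].
  (* A common successor [z0] of the states already treated is joined with the next state by
     [walk_confluent]. *)
  elim: F {FE} => [_|y F IH FD]; first by exists x0 => //; exact: walk_refl.
  have [|z0 x0z0 Fz0] := IH; first by move=> w wF; apply: FD; rewrite inE wF orbT.
  have x0y : walk x0 y by apply: FD; exact: mem_head.
  have [z z0z yz] := walk_confluent x0z0 x0y; exists z; first exact: walk_trans z0z.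
  move=> w; rewrite inE => /orP[/eqP ->//|wF].
  exact: walk_trans (Fz0 _ wF) z0z.
exists z => // x x0x; have [y xy yK] := low x x0x.
apply: (walk_trans xy); apply: Fz.
suff : [set` F] y by [].
by rewrite FE; split=> //; exact: (walk_trans x0x xy).
Qed.

End Confluence.

Theorem theorem20 (R : realType) (disp : Order.disp_t) (V : orderType disp)
  (C : complex V) (k : nat)
  (d : measure_display) (Omega : measurableType d)
  (X : jump_process (@generator R disp V C k.+1) Omega)
  (X0 : chain R C k.+1) :
  countable [set: V] ->
  finite_set (simplexes C k.+2) ->
  boundary X0 = 0 ->
  [/\ non_explosive X (attainable X X0),
      recurrent X (attainable X X0) &
      exists pi : probability (chain R C k.+1) R,
        [/\ invariant_probability X (attainable X X0) pi,
            forall pi' : probability (chain R C k.+1) R,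
              invariant_probability X (attainable X X0) pi' ->
              forall B, measurable B -> pi' B = pi B &
            (\int[pi]_s (normsq s)%:E < +oo)%E]].
Proof.
move=> _ finC _.
have mE (B : set (chain R C k.+1)) : measurable B by [].
have jc := jump_chain_walk finC X0.
(* The class, defined through the law of the process, is replaced by combinatorial reachability, in
   terms of which drift, level sets and sink are stated. *)
have -> : attainable X X0 = walk X0.
  apply/seteqP; split; first exact: (attainable_sub mE jc (walk_refl X0)).
  move=> y xy; apply: (sub_attainable X mE jc (walk_refl X0)) => Q Qx cQ.
  exact: (walk_jump finC xy Qx cQ).
have [eps [beta [eps0 beta0 drift]]] := drift_walk finC X0.
have [z X0z zsink] := walk_sink finC X0.
apply: (foster_lyapunov X mE jc eps0 beta0 _ _ _ X0z).
- exact: normsq_ge0.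
- exact: finite_walk_level.
- by move=> x xx; rewrite mean_targets//; exact: drift.
- move=> Q x xx Qx cQ; apply: (walk_jump finC (zsink _ xx) Qx) => a b xa.
  by apply: cQ; exact: walk_trans xa.
Qed.
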